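(* Let $n\le 7$ and let $E_0\subset\mathbb{R}^n$ be a compact set with $C^2$ boundary which is strictly mean convex in the sense that $H_{\partial E_0}>0$ on $\partial E_0$. For $h>0$ let $E_h(t)$, $t\ge 0$, denote the piecewise constant in time approximation built by the Almgren-Taylor-Wang scheme with time step $h$ starting from $E_0$. Let $T\in(0,\infty)$, and let $h_j\downarrow 0$ be a sequence and $E(t)\subset\mathbb{R}^n$, $t\in(0,T)$, the time slices of a set $E$ such that $E_{h_j}\to E$ in $L^1$, i.e. $\int_0^T |E_{h_j}(t)\,\Delta\, E(t)|\,dt\to 0$. Then $$\lim_{j\to\infty}\int_0^T P(E_{h_j}(t))\,dt=\int_0^T P(E(t))\,dt .$$
   Context: Notation: $P(E)=\sup\{\int_E \operatorname{div}\xi\,dx:\ \xi\in C^1_c(\mathbb{R}^n;\mathbb{R}^n),\ \|\xi\|_\infty\le 1\}$ is the De Giorgi perimeter in $\mathbb{R}^n$; $|\cdot|$ is Lebesgue measure; $\Delta$ between sets is the symmetric difference; $d_F(x)=\operatorname{dist}(x,\partial F)$ is the distance to the boundary of $F$ (with $\operatorname{dist}(x,\emptyset)=+\infty$). For sets of finite perimeter $F$ one always uses the representative with $\overline{\partial^*F}=\partial F$, where $\partial^*F$ is the reduced boundary. $H_{\partial F}$ is the scalar mean curvature (sum of principal curvatures) with respect to the exterior normal, with the sign such that balls have positive mean curvature. Almgren-Taylor-Wang scheme: given $E_0$ and $h>0$, the sets $E_1,E_2,\dots$ are successively chosen as minimizers $$E_k\in\arg\min_{E}\Big\{P(E)+\frac1h\int_{E\Delta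 E_{k-1}}d_{E_{k-1}}\,dx\Big\},$$ (so once $E_{k-1}$ is empty, $E_k$ is empty), and $E_h(t)=E_k$ for $t\in[kh,(k+1)h)$. *)

(* Defs.v *)
From HB Require Import structures.
From mathcomp Require Import all_boot all_order all_algebra.
From mathcomp Require Import all_classical all_reals all_analysis.

Set Implicit Arguments.
Unset Strict Implicit.
Unset Printing Implicit Defensive.

Import Order.TTheory GRing.Theory Num.Theory.
Import numFieldNormedType.Exports.

Local Open Scope classical_set_scope.
Local Open Scope ring_scope.

(* The library norm of ['rV[R]_n] is the sup norm: it gives the right topology
   and the right differentials, but metric notions need the Euclidean norm. *)
Section euclidean.
Context {R : realType} {n : nat}.
Implicit Types (x y : 'rV[R]_n) (A : set 'rV[R]_n).

Definition dotp x y : R := \sum_(i < n) x 0 i * y 0 i.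

Definition enorm x : R := Num.sqrt (dotp x x).

Definition eball x (r : R) : set 'rV[R]_n := [set y | enorm (y - x) < r].

(* Equal to +oo when [A] is empty. *)
Definition edist_to x A : \bar R :=
  ereal_inf [set (enorm (x - y))%:E | y in A].

Definition boundary A : set 'rV[R]_n := closure A `\` interior A.

End euclidean.

Section lebesgue_outer.
Context {R : realType} {n : nat}.
Local Open Scope ereal_scope.
Implicit Types (c : option ('rV[R]_n * 'rV[R]_n)) (X : set 'rV[R]_n).

(* [Some (a, b)] codes the closed box with corners [a] and [b]; [None] codes the
   empty set, so that finite families of boxes are admissible coverings. *)
Definition box c : set 'rV[R]_n :=
  if c is Some ab
  then [set x | forall i, (ab.1 0 i <= x 0 i <= ab.2 0 i)%R] else set0.

Definition box_vol c : \bar R :=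
  if c is Some ab
  then (\prod_(i < n) Num.max 0 (ab.2 0 i - ab.1 0 i))%:E else 0.

Definition lebesgue_outer X : \bar R :=
  ereal_inf [set \sum_(k <oo) box_vol (F k) |
    F in [set F : nat -> option ('rV[R]_n * 'rV[R]_n) |
           X `<=` \bigcup_k box (F k)]].

Lemma box_vol_ge0 c : 0 <= box_vol c.
Proof.
by case: c => [ab|]//=; rewrite lee_fin prodr_ge0// => i _; rewrite le_max lexx.
Qed.

Lemma lebesgue_outer_ge0 X : 0 <= lebesgue_outer X.
Proof.
apply: le_ereal_inf_tmp => _ [F _ <-].
by apply: nneseries_ge0 => k _ _; exact: box_vol_ge0.
Qed.

Lemma lebesgue_outer0 : lebesgue_outer set0 = 0.
Proof.
apply/eqP; rewrite eq_le lebesgue_outer_ge0 andbT.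
apply: ereal_inf_lbound; exists (fun=> None) => //=.
by rewrite eseries0.
Qed.

Lemma le_lebesgue_outer : {homo lebesgue_outer : A B / A `<=` B >-> A <= B}.
Proof.
move=> A B AB; apply/ereal_inf_le_tmp => x [F BF] <-.
by exists F => //; apply: subset_trans AB BF.
Qed.

Lemma lebesgue_outer_sigma_subadditive : sigma_subadditive lebesgue_outer.
Proof.
move=> A; have [[i ioo]|] := pselect (exists i, lebesgue_outer (A i) = +oo).
  rewrite (eseries_pinfty _ _ ioo) ?leey// => k _.
  by rewrite -ltNye (lt_le_trans _ (lebesgue_outer_ge0 _)).
rewrite -forallNE => Aoo.
suff add2e (e : {posnum R}) : lebesgue_outer (\bigcup_n A n) <=
    \sum_(i <oo) lebesgue_outer (A i) + e%:num%:E.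
  by apply/lee_addgt0Pr => _/posnumP[].
rewrite (le_trans _ (epsilon_trick _ _ _))//; last first.
  by move=> k; exact: lebesgue_outer_ge0.
pose P k (B : nat -> option ('rV[R]_n * 'rV[R]_n)) :=
  A k `<=` \bigcup_j box (B j) /\
  \sum_(j <oo) box_vol (B j) <=
    lebesgue_outer (A k) + (e%:num / (2 ^ k.+1)%:R)%:E.
have [G PG] : {G & forall k, P k (G k)}.
  apply: (@choice _ _ P) => k; rewrite /P /lebesgue_outer.
  set S := (X in ereal_inf X); move infS : (ereal_inf S) => iS.
  case: iS infS => [r Sr|Soo|Soo].
  - have en1 : (0 < e%:num / (2 ^ k.+1)%:R)%R by [].
    have /(lb_ereal_inf_adherent en1) : ereal_inf S \is a fin_num by rewrite Sr.
    move=> [x [B AkB muBx] xS].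
    by exists B; split => //; rewrite muBx -Sr; exact/ltW.
  - by have := Aoo k; rewrite /lebesgue_outer Soo.
  - suff : lbound S 0 by move/le_ereal_inf_tmp; rewrite Soo.
    move=> /= _ [B AkB <-]; apply: nneseries_ge0 => *; exact: box_vol_ge0.
have vG_ge0 x : 0 <= (box_vol \o uncurry G) x by exact: box_vol_ge0.
apply: (@le_trans _ _ (\esum_(i in setT) (box_vol \o uncurry G) i)).
  rewrite /lebesgue_outer; apply: ereal_inf_lbound => /=.
  have /card_esym/ppcard_eqP[f] := card_nat2.
  exists (uncurry G \o f).
    move=> t [i _ /((PG i).1)] [j _ Gijt].
    by exists (f^-1%FUN (i, j)) => //=; rewrite invK ?inE.
  rewrite -(esum_pred_image (box_vol \o uncurry G) _ xpredT) ?[fun=> _]set_true//.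
  by rewrite image_eq.
rewrite (_ : esum _ _ = \sum_(i <oo) \sum_(j <oo) box_vol (G i j)); last first.
  pose J : nat -> set (nat * nat) := fun i => [set (i, j) | j in setT].
  rewrite (_ : setT = \bigcup_k J k); last first.
    by rewrite predeqE => -[a b]; split => // _; exists a => //; exists b.
  rewrite esum_bigcupT /=; last 2 first.
    - apply/trivIsetP => i j _ _ ij.
      rewrite predeqE => -[k m] /=; split => //= -[] [_] _ [<-{k} _].
      by move=> [m' _] [] /esym/eqP; rewrite (negbTE ij).
    - by move=> /= [k m]; exact: box_vol_ge0.
  rewrite -(image_id [set: nat]) -fun_true esum_pred_image//; last first.
    by move=> k _; apply: esum_ge0 => x _; exact: vG_ge0.
  apply: eq_eseriesr => /= j _.
  rewrite -(esum_pred_image (box_vol \o uncurry G) (pair j) predT)//=; last first.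
    by move=> ? ? _ _; exact: (@can_inj _ _ _ snd).
    by move=> k _; exact: box_vol_ge0.
  by congr esum; rewrite predeqE => -[a b]; split; move=> [i _ <-]; exists i.
apply: lee_lim.
- apply: is_cvg_nneseries => k *.
  by apply: nneseries_ge0 => m *; exact: (vG_ge0 (k, m)).
- by apply: is_cvg_nneseries => k *; apply: adde_ge0 => //;
    exact: lebesgue_outer_ge0.
- by near=> k; apply: lee_sum => i _; exact: (PG i).2.
Unshelve. all: by end_near. Qed.

HB.instance Definition _ := isOuterMeasure.Build R 'rV[R]_n lebesgue_outer
  lebesgue_outer0 lebesgue_outer_ge0 le_lebesgue_outer
  lebesgue_outer_sigma_subadditive.

End lebesgue_outer.

Notation lebesgue_rV R n := (caratheodory_type (@lebesgue_outer R n)).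
Notation borel_rV R n := (g_sigma_algebraType (@open 'rV[R]_n)).

Definition lebesgue {R : realType} {n : nat} : set (lebesgue_rV R n) -> \bar R :=
  lebesgue_outer.

HB.instance Definition _ (R : realType) (n : nat) :=
  Measure.copy (@lebesgue R n)
    ((@lebesgue_outer R n : {outer_measure set _ -> \bar R})
       : set (lebesgue_rV R n) -> \bar R).

Section perimeter.
Context {R : realType} {n : nat}.
Implicit Types (F : set 'rV[R]_n) (xi : 'rV[R]_n -> 'rV[R]_n).

Definition C1_on {W : normedModType R} (U : set 'rV[R]_n) (f : 'rV[R]_n -> W) :=
  forall x, U x -> differentiable f x /\
    forall v, {for x, continuous ('D_v f)}.

Definition C2_on {W : normedModType R} (U : set 'rV[R]_n) (f : 'rV[R]_n -> W) :=
  C1_on U f /\ forall v, C1_on U ('D_v f).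

Definition C1c xi := C1_on setT xi /\ compact (closure [set x | xi x != 0]).

Definition divergence xi (x : 'rV[R]_n) : R :=
  \sum_(i < n) 'D_(delta_mx 0 i) xi x 0 i.

Definition perimeter F : \bar R :=
  ereal_sup [set (\int[lebesgue]_(x in F) (divergence xi x)%:E)%E |
    xi in [set xi | C1c xi /\ forall x, enorm (xi x) <= 1]].

(* Polar decomposition [nu m] of minus the distributional gradient of the indicator
   of [F]: [m] is its total variation measure and [nu] the measure theoretic outer
   normal. They exist when [F] has finite perimeter; [m] is then unique, and [nu] is
   unique up to an [m]-null set. *)
Definition gauss_green F (m : {finite_measure set (borel_rV R n) -> \bar R})
    (nu : borel_rV R n -> 'rV[R]_n) :=
  [/\ forall i, measurable_fun setT (fun x => nu x 0 i),
      {ae m, forall x, enorm (nu x) = 1} &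
      forall xi, C1c xi ->
        (\int[lebesgue]_(x in F) (divergence xi x)%:E =
         \int[m]_x (dotp (xi x) (nu x))%:E)%E].

Definition mean_normal (m : {finite_measure set (borel_rV R n) -> \bar R})
    (nu : borel_rV R n -> 'rV[R]_n) (x : 'rV[R]_n) (r : R) : 'rV[R]_n :=
  \row_i (Rintegral m (eball x r) (fun y => nu y 0 i) / fine (m (eball x r))).

Definition reduced_boundary F : set 'rV[R]_n :=
  [set x | exists m nu, [/\ gauss_green F m nu,
     forall r : R, 0 < r -> (0 < m (eball x r))%E &
     exists2 w, enorm w = 1 & mean_normal m nu x @ 0^'+ --> w]].

(* Points with a unit limit of the averaged normal that lie in the support of [m]
   make up the reduced boundary; the representative chosen in a Lebesgue class is
   the one whose topological boundary is the closure of that set. *)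
Definition good_representative F := closure (reduced_boundary F) = boundary F.

End perimeter.

Section mean_curvature.
Context {R : realType} {n : nat}.
Implicit Types (E U : set 'rV[R]_n) (psi : 'rV[R]_n -> R) (x : 'rV[R]_n).

Definition grad psi x : 'rV[R]_n := \row_i 'D_(delta_mx 0 i) psi x.

Definition C2_defining E x U psi :=
  [/\ open U, U x, C2_on U psi, forall y, U y -> grad psi y != 0 &
      forall y, U y -> (E y <-> psi y <= 0)].

Definition C2_boundary E :=
  forall x, boundary E x -> exists U psi, C2_defining E x U psi.

(* For a defining function [psi] of [E], the exterior unit normal at the points of
   the boundary of [E], extended to a neighbourhood by the same formula. *)
Definition exterior_normal psi x : 'rV[R]_n :=
  (enorm (grad psi x))^-1 *: grad psi x.

(* The principal curvatures are the eigenvalues of the differential of the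
   exterior normal on the tangent space; [e] is an orthonormal eigenbasis. *)
Definition principal_curvatures E x (kappa : 'I_n.-1 -> R) :=
  exists U psi (e : 'I_n.-1 -> 'rV[R]_n),
    [/\ C2_defining E x U psi,
        forall i, dotp (e i) (exterior_normal psi x) = 0,
        forall i j, dotp (e i) (e j) = (i == j)%:R &
        forall i, 'D_(e i) (exterior_normal psi) x = kappa i *: e i].

(* The sum does not depend on the defining function, the eigenbasis or the
   enumeration [kappa]. *)
Definition mean_curvature E x : R :=
  xget 0 [set H | exists2 kappa, principal_curvatures E x kappa &
                    H = \sum_(i < n.-1) kappa i].

End mean_curvature.

Section atw.
Context {R : realType} {n : nat}.
Implicit Types (E F : set 'rV[R]_n).

Definition lebesgue_measurable E := measurable (E : set (lebesgue_rV R n)).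

Definition atw_functional (h : R) F E : \bar R :=
  (perimeter E +
   (h^-1)%:E * \int[lebesgue]_(x in E `+` F) edist_to x (boundary F))%E.

Definition atw_step (h : R) F E :=
  [/\ lebesgue_measurable E,
      forall E', lebesgue_measurable E' ->
        (atw_functional h F E <= atw_functional h F E')%E &
      good_representative E].

Definition atw_approximation (h : R) (E0 : set 'rV[R]_n)
    (Eh : R -> set 'rV[R]_n) :=
  exists Ek : nat -> set 'rV[R]_n,
    [/\ Ek 0%N = E0, forall k, atw_step h (Ek k) (Ek k.+1) &
        forall k t, k%:R * h <= t < k.+1%:R * h -> Eh t = Ek k].

(* Space-time is ['rV[R]_(n + 1)], with time as the last coordinate. *)
Definition time_slice (E : set 'rV[R]_(n + 1)) (t : R) : set 'rV[R]_n :=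
  [set x | E (row_mx x (const_mx t))].

End atw.

(* Main.v *)
Require Import Defs.
From HB Require Import structures.
From mathcomp Require Import all_boot all_order all_algebra.
From mathcomp Require Import all_classical all_reals all_analysis.
From mathcomp Require Import measurable_realfun ring lra.
Set Implicit Arguments.
Unset Strict Implicit.
Unset Printing Implicit Defensive.
Import Order.TTheory GRing.Theory Num.Theory.
Import numFieldNormedType.Exports.
Local Open Scope classical_set_scope.
Local Open Scope ring_scope.

(** The approximations of a strictly mean convex set shrink, and they shrink at a
    speed that is bounded from below. This makes the perimeters converge.

    The exterior normal of [E0] is extended to a compactly supported field of
    length at most 1 by a partition of unity. Its divergence is the mean curvature
    on the boundary, hence positive near it, and bounding perimeters from below by
    tests with this field outside [E0] ([calibration_test],
    [mean_convex_calibration]) shows two things: [E0] has finite perimeter, and the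
    first step lies at distance at least [delta * h] inside [E0]
    ([minimizer_calibrated]). If one set lies inside another one at a positive
    distance, so do their minimizers, weakly ([minimizer_comparison]): exchanging
    the wrongly placed part does not increase the perimeters, because these are
    submodular ([perimeter_submod]), and it decreases the distance terms. Applied
    to consecutive steps and their translates, this propagates the speed of the
    first step to all steps ([nested_step]). A second consequence of submodularity
    is that every step minimizes the perimeter among the sets between itself and
    [E0] ([outward_minimizing]).

    Two approximations with small time steps that are both close to the limit set
    [E] in the mean are ordered after an arbitrarily small delay: otherwise, at all
    the intermediate times, they would differ by a ball of fixed radius
    ([flows_ordered]). By outward minimality, at a later time an approximation has
    at most the perimeter that [E] has at an earlier time, and by lower
    semicontinuity also conversely ([perimeter_delay]). Hence the perimeter of [E]
    is a nonincreasing function of time, up to a null set of times, and the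
    perimeters of the approximations converge to it at every continuity point,
    that is, at almost every time. They are bounded by the perimeter of [E0], so
    their integrals converge.

    Relations between sets hold up to null sets, whereas the distance term refers to
    the topological boundary. The two are reconciled by the choice of the
    representatives: around each boundary point, both the set and its complement
    have positive measure ([good_representative_essential],
    [C2_boundary_essential]). *)

(** * The Euclidean norm *)

Section euclidean_norm.
Context {R : realType} {n : nat}.
Implicit Types (x y z : 'rV[R]_n).

Lemma dotpC x y : dotp x y = dotp y x.
Proof. by apply: eq_bigr => i _; rewrite mulrC. Qed.

Lemma dotpDr z x y : dotp z (x + y) = dotp z x + dotp z y.
Proof. by rewrite /dotp -big_split/=; apply: eq_bigr => i _; rewrite mxE mulrDr. Qed.

Lemma dotpZr z a x : dotp z (a *: x) = a * dotp z x.
Proof. by rewrite /dotp mulr_sumr; apply: eq_bigr => i _; rewrite mxE mulrCA. Qed.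

Lemma dotpNr z x : dotp z (- x) = - dotp z x.
Proof. by rewrite -scaleN1r dotpZr mulN1r. Qed.

Lemma dotpBr z x y : dotp z (x - y) = dotp z x - dotp z y.
Proof. by rewrite dotpDr dotpNr. Qed.

Lemma dotpDl z x y : dotp (x + y) z = dotp x z + dotp y z.
Proof. by rewrite dotpC dotpDr ![dotp z _]dotpC. Qed.

Lemma dotpZl z a x : dotp (a *: x) z = a * dotp x z.
Proof. by rewrite dotpC dotpZr dotpC. Qed.

Lemma dotpNl z x : dotp (- x) z = - dotp x z.
Proof. by rewrite dotpC dotpNr dotpC. Qed.

Lemma dotp0r x : dotp x 0 = 0.
Proof. by rewrite /dotp big1// => i _; rewrite mxE mulr0. Qed.

Lemma dotp_delta x i : dotp (delta_mx 0 i) x = x 0 i.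
Proof.
rewrite /dotp (bigD1 i)//= big1 ?addr0 ?mxE ?eqxx ?mul1r// => j ji.
by rewrite mxE (negbTE ji) andbF mul0r.
Qed.

Lemma dotp_ge0 x : 0 <= dotp x x.
Proof. by apply: sumr_ge0 => i _; rewrite -expr2 sqr_ge0. Qed.

Lemma dotp_eq0 x : (dotp x x == 0) = (x == 0).
Proof.
apply/idP/eqP => [|->]; last by rewrite dotp0r.
rewrite /dotp psumr_eq0; last by move=> i _; rewrite -expr2 sqr_ge0.
move=> /allP h; apply/rowP => i; rewrite mxE.
have := h i (mem_index_enum _); rewrite implyTb -expr2 sqrf_eq0.
exact/eqP.
Qed.

Lemma enorm_ge0 x : 0 <= enorm x. Proof. exact: sqrtr_ge0. Qed.

Lemma enorm_sqr x : enorm x ^+ 2 = dotp x x.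
Proof. by rewrite sqr_sqrtr ?dotp_ge0. Qed.

Lemma enorm_eq0 x : (enorm x == 0) = (x == 0).
Proof. by rewrite -(sqrf_eq0 (enorm x)) enorm_sqr dotp_eq0. Qed.

Lemma enorm0 : enorm (0 : 'rV[R]_n) = 0.
Proof. by apply/eqP; rewrite enorm_eq0. Qed.

Lemma enormZ a x : enorm (a *: x) = `|a| * enorm x.
Proof.
by rewrite /enorm dotpZl dotpZr mulrA -expr2 sqrtrM ?sqr_ge0// sqrtr_sqr.
Qed.

Lemma enormN x : enorm (- x) = enorm x.
Proof. by rewrite -scaleN1r enormZ normrN1 mul1r. Qed.

Lemma enormB x y : enorm (x - y) = enorm (y - x).
Proof. by rewrite -enormN opprB. Qed.

Lemma cauchy_schwarz x y : dotp x y <= enorm x * enorm y.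
Proof.
have [->|y0] := eqVneq y 0; first by rewrite dotp0r enorm0 mulr0.
have [->|x0] := eqVneq x 0; first by rewrite dotpC dotp0r enorm0 mul0r.
have px : 0 < enorm x by rewrite lt_def enorm_eq0 x0 enorm_ge0.
have py : 0 < enorm y by rewrite lt_def enorm_eq0 y0 enorm_ge0.
have := dotp_ge0 (enorm y *: x - enorm x *: y).
rewrite dotpBr !dotpDl !dotpNl !dotpZl !dotpZr -!enorm_sqr (dotpC y x).
move=> h; have {}h : 0 <= enorm x * enorm y * (enorm x * enorm y - dotp x y) *+ 2.
  by move: h; congr (0 <= _); ring.
rewrite pmulrn_lge0// in h; move: h.
by rewrite pmulr_rge0 ?mulr_gt0// subr_ge0.
Qed.

Lemma cauchy_schwarz_norm x y : `|dotp x y| <= enorm x * enorm y.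
Proof.
rewrite ler_norml cauchy_schwarz andbT lerNl -dotpNl (le_trans (cauchy_schwarz _ _))//.
by rewrite enormN.
Qed.

Lemma enormD x y : enorm (x + y) <= enorm x + enorm y.
Proof.
rewrite -(@ler_pXn2r _ 2)// ?nnegrE ?addr_ge0 ?enorm_ge0//.
rewrite enorm_sqr dotpDr !dotpDl sqrrD -!enorm_sqr (dotpC y x).
by have := cauchy_schwarz x y; lra.
Qed.

Lemma enorm_triangle y x z : enorm (x - z) <= enorm (x - y) + enorm (y - z).
Proof. by rewrite (le_trans _ (enormD _ _))// addrA subrK. Qed.

Lemma coord_le_norm x i : `|x 0 i| <= `|x|.
Proof.
rewrite [leRHS]/Num.norm/= mx_normrE.
exact: (le_bigmax _ (fun ij : 'I_1 * 'I_n => `|x ij.1 ij.2|) (0, i)).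
Qed.

Lemma norm_leP x r : 0 <= r -> (forall i, `|x 0 i| <= r) -> `|x| <= r.
Proof.
move=> r0 h; rewrite [leLHS]/Num.norm/= mx_normrE.
by apply: bigmax_le => // -[i j] _ /=; rewrite ord1.
Qed.

Lemma coord_le_enorm x i : `|x 0 i| <= enorm x.
Proof.
rewrite -sqrtr_sqr ler_wsqrtr// /dotp (bigD1 i)//= -expr2 lerDl.
by apply: sumr_ge0 => j _; rewrite -expr2 sqr_ge0.
Qed.

Lemma norm_le_enorm x : `|x| <= enorm x.
Proof. by apply: norm_leP => [|i]; [exact: enorm_ge0|exact: coord_le_enorm]. Qed.

(** Together with [norm_le_enorm] this identifies the Euclidean topology with
    that of the sup norm. *)
Lemma enorm_le_norm x : enorm x <= n.+1%:R * `|x|.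
Proof.
rewrite -(@ler_pXn2r _ 2)// ?nnegrE ?mulr_ge0 ?enorm_ge0//.
rewrite enorm_sqr /dotp.
apply: (@le_trans _ _ (\sum_(i < n) `|x| ^+ 2)).
  apply: ler_sum => i _; rewrite -expr2 -(real_normK (num_real (x 0 i))).
  by rewrite ler_pXn2r ?nnegrE// coord_le_norm.
rewrite sumr_const card_ord -[leLHS]mulr_natl exprMn ler_wpM2r ?sqr_ge0//.
by rewrite -natrX ler_nat (leq_trans (leqnSn n))// -mulnn leq_pmulr.
Qed.

Lemma nbhs_eballP x (A : set 'rV[R]_n) :
  nbhs x A <-> exists2 r : R, 0 < r & eball x r `<=` A.
Proof.
split=> [/nbhs_ballP[r /= r0 rA]|[r r0 rA]].
  exists r => // y yr; apply: rA; rewrite -ball_normE/=.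
  by rewrite (le_lt_trans (norm_le_enorm _))// enormB.
apply/nbhs_ballP; exists (r / n.+1%:R) => /=; first by rewrite divr_gt0.
move=> y; rewrite -ball_normE/= => xy; apply: rA; rewrite /eball/= enormB.
by rewrite (le_lt_trans (enorm_le_norm _))// mulrC -ltr_pdivlMr.
Qed.

Lemma enorm_lipschitz x y : `|enorm x - enorm y| <= enorm (x - y).
Proof.
rewrite ler_norml lerBlDr lerBrDl; apply/andP; split; last first.
  by rewrite (le_trans _ (enormD _ _))// subrK.
rewrite lerBlDr enormB; apply: le_trans (enormD _ _).
by rewrite addrC subrK.
Qed.

Lemma continuous_enorm : continuous (@enorm R n).
Proof.
move=> x; apply/(@cvgrPdist_lt R R _ (nbhs x) (nbhs_filter x)) => /= e e0; apply/nbhs_eballP; exists e => // y xy.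
by rewrite /= (le_lt_trans (enorm_lipschitz _ _))// enormB.
Qed.

Lemma open_eball x r : open (eball x r).
Proof.
rewrite openE => y /= yr; apply/nbhs_eballP; exists (r - enorm (y - x)).
  by rewrite subr_gt0.
move=> z /=; rewrite /eball/= ltrBrDr; apply: le_lt_trans.
exact: enorm_triangle.
Qed.

Lemma eball_center x r : 0 < r -> eball x r x.
Proof. by move=> r0; rewrite /eball/= subrr enorm0. Qed.

End euclidean_norm.

(** * Calculus of maps of class C1 *)

Section C1_calculus.
Context {R : realType} {n : nat}.
Implicit Types (x v : 'rV[R]_n) (U : set 'rV[R]_n).

Lemma C1_onI {W : normedModType R} U (f : 'rV[R]_n -> W) (df : 'rV[R]_n -> 'rV[R]_n -> W) :
  open U -> (forall x, U x -> differentiable f x) ->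
  (forall x v, U x -> 'D_v f x = df v x) ->
  (forall x v, U x -> {for x, continuous (df v)}) -> C1_on U f.
Proof.
move=> oU f' fdf cdf x Ux; split; first exact: f'.
move=> v; suff : 'D_v f y @[y --> x] --> df v x by rewrite -(fdf x v Ux).
apply: cvg_trans (cdf x v Ux); apply: (@near_eq_cvg _ _ (nbhs x)).
near=> y; rewrite fdf//; near: y; exact: open_nbhs_nbhs.
Unshelve. all: by end_near. Qed.

Lemma C1_on_sub {W : normedModType R} U V (f : 'rV[R]_n -> W) :
  V `<=` U -> C1_on U f -> C1_on V f.
Proof. by move=> VU f1 x /VU /f1. Qed.

Lemma C1_on_continuous {W : normedModType R} U (f : 'rV[R]_n -> W) x :
  C1_on U f -> U x -> {for x, continuous f}.
Proof. by move=> f1 /f1[/differentiable_continuous]. Qed.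

Lemma C1_on_cst {W : normedModType R} U (c : W) : C1_on U (fun=> c).
Proof.
move=> x _; split; first exact: differentiable_cst.
by move=> v; rewrite (_ : 'D_v _ = fun=> 0); [exact: cst_continuous|apply/funext => y; exact: derive_cst].
Qed.

Lemma C1_onD {W : normedModType R} U (f g : 'rV[R]_n -> W) : open U ->
  C1_on U f -> C1_on U g -> C1_on U (fun x => f x + g x).
Proof.
move=> oU f1 g1; apply: (@C1_onI _ _ _ (fun v x => 'D_v f x + 'D_v g x)) => //.
- by move=> x Ux; apply: differentiableD; [apply: (f1 _ Ux).1|apply: (g1 _ Ux).1].
- by move=> x v Ux; apply: deriveD; apply: diff_derivable; [apply: (f1 _ Ux).1|apply: (g1 _ Ux).1].
- by move=> x v Ux; apply: continuousD; [apply: (f1 _ Ux).2|apply: (g1 _ Ux).2].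
Qed.

Lemma C1_onN {W : normedModType R} U (f : 'rV[R]_n -> W) : open U ->
  C1_on U f -> C1_on U (fun x => - f x).
Proof.
move=> oU f1; apply: (@C1_onI _ _ _ (fun v x => - 'D_v f x)) => //.
- by move=> x Ux; apply: differentiableN; apply: (f1 _ Ux).1.
- by move=> x v Ux; apply: deriveN; apply: diff_derivable; apply: (f1 _ Ux).1.
- by move=> x v Ux; apply: continuousN; apply: (f1 _ Ux).2.
Qed.

Lemma C1_onB {W : normedModType R} U (f g : 'rV[R]_n -> W) : open U ->
  C1_on U f -> C1_on U g -> C1_on U (fun x => f x - g x).
Proof. by move=> oU f1 g1; apply: C1_onD => //; exact: C1_onN. Qed.

Lemma C1_on_sum {W : normedModType R} I (r : seq I) (P : pred I) U
    (f : I -> 'rV[R]_n -> W) : open U ->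
  (forall i, P i -> C1_on U (f i)) -> C1_on U (fun x => \sum_(i <- r | P i) f i x).
Proof.
move=> oU f1; elim: r => [|i r ih].
  by rewrite (_ : (fun x => _) = fun=> 0); [exact: C1_on_cst|apply/funext => x; rewrite big_nil].
case Pi : (P i); last first.
  by rewrite (_ : (fun x => _) = fun x => \sum_(i <- r | P i) f i x)//; apply/funext => x; rewrite big_cons Pi.
rewrite (_ : (fun x => _) = fun x => f i x + \sum_(i <- r | P i) f i x).
  by apply: C1_onD => //; exact: f1.
by apply/funext => x; rewrite big_cons Pi.
Qed.

Lemma C1_onM U (f g : 'rV[R]_n -> R) : open U ->
  C1_on U f -> C1_on U g -> C1_on U (fun x => f x * g x).
Proof.
move=> oU f1 g1; apply: (@C1_onI _ _ _ (fun v x => f x * 'D_v g x + g x * 'D_v f x)) => //.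
- by move=> x Ux; apply: differentiableM; [apply: (f1 _ Ux).1|apply: (g1 _ Ux).1].
- by move=> x v Ux; apply: deriveM; apply: diff_derivable; [apply: (f1 _ Ux).1|apply: (g1 _ Ux).1].
- move=> x v Ux; apply: continuousD; apply: continuousM.
  + exact: C1_on_continuous f1 Ux.
  + by apply: (g1 _ Ux).2.
  + exact: C1_on_continuous g1 Ux.
  + by apply: (f1 _ Ux).2.
Qed.

Lemma derive_comp1 (phi : R -> R) (f : 'rV[R]_n -> R) x v :
  differentiable f x -> derivable phi (f x) 1 ->
  differentiable (phi \o f) x /\ 'D_v (phi \o f) x = derive1 phi (f x) * 'D_v f x.
Proof.
move=> df dphi; have dphi' := (derivable1_diffP _ _).1 dphi.
split; first exact: differentiable_comp.
rewrite !deriveE//; last exact: differentiable_comp.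
by rewrite diff_comp//= deriv1E//= mulrC.
Qed.

Lemma C1_on_comp U (phi : R -> R) (f : 'rV[R]_n -> R) : open U -> C1_on U f ->
  (forall x, U x -> derivable phi (f x) 1 /\ {for f x, continuous (derive1 phi)}) ->
  C1_on U (fun x => phi (f x)).
Proof.
move=> oU f1 phi1.
apply: (@C1_onI _ _ _ (fun v x => derive1 phi (f x) * 'D_v f x)) => //.
- by move=> x Ux; have [] := derive_comp1 0 (f1 _ Ux).1 (phi1 _ Ux).1.
- by move=> x v Ux; have [] := derive_comp1 v (f1 _ Ux).1 (phi1 _ Ux).1.
- move=> x v Ux; apply: continuousM; last by apply: (f1 _ Ux).2.
  by apply: continuous_comp; [exact: C1_on_continuous f1 Ux|exact: (phi1 _ Ux).2].
Qed.

Lemma C1_onZl {W : normedModType R} U (f : 'rV[R]_n -> R) (w : W) : open U ->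
  C1_on U f -> C1_on U (fun x => f x *: w).
Proof.
move=> oU f1; apply: (@C1_onI _ _ _ (fun v x => 'D_v f x *: w)) => //.
- by move=> x Ux; apply: differentiableZl; apply: (f1 _ Ux).1.
- move=> x v Ux; rewrite !deriveE; [|exact: (f1 _ Ux).1|].
    by rewrite diffZl//; exact: (f1 _ Ux).1.
  by apply: differentiableZl; apply: (f1 _ Ux).1.
- by move=> x v Ux; apply: continuousZr_tmp; apply: (f1 _ Ux).2.
Qed.

Lemma derive_coord {m} (xi : 'rV[R]_n -> 'rV[R]_m) x v i : differentiable xi x ->
  'D_v (fun y => xi y 0 i) x = ('D_v xi x) 0 i.
Proof. by move=> dxi; rewrite derive_mx ?mxE//; exact: diff_derivable. Qed.

Lemma C1_on_coord {m} U (xi : 'rV[R]_n -> 'rV[R]_m) i : open U ->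
  C1_on U xi -> C1_on U (fun x => xi x 0 i).
Proof.
move=> oU xi1; apply: (@C1_onI _ _ _ (fun v x => ('D_v xi x) 0 i)) => //.
- move=> x Ux; apply: (@differentiable_comp _ _ _ _ xi (fun M : 'rV[R]_m => M 0 i)).
    exact: (xi1 _ Ux).1.
  exact: differentiable_coord.
- by move=> x v Ux; rewrite derive_coord//; exact: (xi1 _ Ux).1.
- move=> x v Ux; apply: (@continuous_comp _ _ _ ('D_v xi) (fun M : 'rV[R]_m => M 0 i)).
    exact: (xi1 _ Ux).2.
  exact: coord_continuous.
Qed.

Lemma C1_on_row {m} U (xi : 'rV[R]_n -> 'rV[R]_m) : open U ->
  (forall i, C1_on U (fun x => xi x 0 i)) -> C1_on U xi.
Proof.
move=> oU xi1; rewrite (_ : xi = fun x => \sum_(i < m) xi x 0 i *: delta_mx 0 i).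
  by refine (C1_on_sum _ oU _) => i _; exact: (C1_onZl _ oU (xi1 i)).
by apply/funext => x; exact: row_sum_delta.
Qed.

Lemma C1_onZ {m} U (f : 'rV[R]_n -> R) (xi : 'rV[R]_n -> 'rV[R]_m) : open U ->
  C1_on U f -> C1_on U xi -> C1_on U (fun x => f x *: xi x).
Proof.
move=> oU f1 xi1; refine (C1_on_row oU _) => i.
rewrite (_ : (fun x => _) = fun x => f x * xi x 0 i).
  exact: (C1_onM oU f1 (C1_on_coord i oU xi1)).
by apply/funext => x; rewrite mxE.
Qed.

Lemma C1_on_proj U i : open U -> C1_on U (fun x => x 0 i).
Proof.
move=> oU; refine (@C1_on_coord n U id i oU _) => x _; split.
  by have [] := is_diff_id x.
move=> v; rewrite (_ : 'D_v _ = fun=> v); first exact: cst_continuous.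
by apply/funext => y; rewrite derive_id.
Qed.

Lemma C1_on_dotp {m} U (f g : 'rV[R]_n -> 'rV[R]_m) : open U ->
  C1_on U f -> C1_on U g -> C1_on U (fun x => dotp (f x) (g x)).
Proof.
move=> oU f1 g1; refine (C1_on_sum _ oU _) => i _.
exact: (C1_onM oU (C1_on_coord i oU f1) (C1_on_coord i oU g1)).
Qed.

Lemma derive_grad (f : 'rV[R]_n -> R) x v : differentiable f x ->
  'D_v f x = dotp v (grad f x).
Proof.
move=> df; rewrite deriveE// [X in 'd f x X](row_sum_delta v) linear_sum/=.
by apply: eq_bigr => i _; rewrite linearZ/= mxE deriveE.
Qed.

Lemma C1_on_grad U (f : 'rV[R]_n -> R) : open U -> C2_on U f -> C1_on U (grad f).
Proof.
move=> oU f2; apply: C1_on_row => // i.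
by rewrite (_ : (fun x => _) = 'D_(delta_mx 0 i) f)//; [exact: f2.2|apply/funext => x; rewrite mxE].
Qed.

Lemma divergenceE (xi : 'rV[R]_n -> 'rV[R]_n) x : differentiable xi x ->
  divergence xi x = \sum_(i < n) 'D_(delta_mx 0 i) (fun y => xi y 0 i) x.
Proof. by move=> dxi; apply: eq_bigr => i _; rewrite derive_coord. Qed.

Lemma divergenceD (xi eta : 'rV[R]_n -> 'rV[R]_n) x :
  differentiable xi x -> differentiable eta x ->
  divergence (fun y => xi y + eta y) x = divergence xi x + divergence eta x.
Proof.
move=> dxi deta; rewrite /divergence -big_split/=; apply: eq_bigr => i _.
by rewrite deriveD ?mxE//; exact: diff_derivable.
Qed.

Lemma divergenceN (xi : 'rV[R]_n -> 'rV[R]_n) x : differentiable xi x ->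
  divergence (fun y => - xi y) x = - divergence xi x.
Proof.
move=> dxi; rewrite /divergence -sumrN; apply: eq_bigr => i _.
by rewrite deriveN ?mxE//; exact: diff_derivable.
Qed.

Lemma divergence_cst (c x : 'rV[R]_n) : divergence (fun=> c) x = 0.
Proof. by rewrite /divergence big1// => i _; rewrite derive_cst mxE. Qed.

Lemma divergenceZ (f : 'rV[R]_n -> R) (xi : 'rV[R]_n -> 'rV[R]_n) x :
  differentiable f x -> differentiable xi x ->
  differentiable (fun y => f y *: xi y) x ->
  divergence (fun y => f y *: xi y) x =
  f x * divergence xi x + dotp (grad f x) (xi x).
Proof.
move=> df dxi dfxi; rewrite !divergenceE// mulr_sumr /dotp -big_split/=.
apply: eq_bigr => i _; rewrite (_ : (fun y => _) = f * (fun y => xi y 0 i)).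
  rewrite deriveM; [by rewrite mxE [X in _ + X]mulrC|exact: diff_derivable|].
  apply: diff_derivable.
  apply: (@differentiable_comp _ _ _ _ xi (fun M : 'rV[R]_n => M 0 i)) => //.
  exact: differentiable_coord.
by apply/funext => y; rewrite mxE.
Qed.

Lemma continuous_sum {T : topologicalType} I (r : seq I) (f : I -> T -> R) (x : T) :
  (forall i, {for x, continuous (f i)}) ->
  {for x, continuous (fun y => \sum_(i <- r) f i y)}.
Proof.
move=> cf; elim: r => [|i r ih].
  by rewrite (_ : (fun y => _) = fun=> 0); [exact: cst_continuous|apply/funext => y; rewrite big_nil].
rewrite (_ : (fun y => _) = fun y => f i y + \sum_(i <- r) f i y); last first.
  by apply/funext => y; rewrite big_cons.
exact: (@continuousD _ _ _ (f i) _ x (cf i) ih).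
Qed.

Lemma C1_on_divergence_continuous U (xi : 'rV[R]_n -> 'rV[R]_n) x :
  C1_on U xi -> U x -> {for x, continuous (divergence xi)}.
Proof.
move=> xi1 Ux.
refine (@continuous_sum _ _ _ (fun i y => ('D_(delta_mx 0 i) xi y) 0 i) x _) => i.
apply: (@continuous_comp _ _ _ ('D_(delta_mx 0 i) xi) (fun M : 'rV[R]_n => M 0 i)).
  exact: (xi1 _ Ux).2.
exact: coord_continuous.
Qed.

Lemma C1_on_shift {W : normedModType R} (f : 'rV[R]_n -> W) (z : 'rV[R]_n) : C1_on setT f ->
  C1_on setT (fun x => f (x + z)) /\
  forall x v, 'D_v (fun x => f (x + z)) x = 'D_v f (x + z).
Proof.
move=> f1.
have dshift x v : 'D_v (fun x => f (x + z)) x = 'D_v f (x + z).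
  rewrite /derive (_ : (fun h : R => _) =
    (fun h : R => h^-1 *: ((f \o shift (x + z)) (h *: v) - f (x + z))))//.
  by apply/funext => t /=; rewrite addrA.
have diffid x : differentiable (fun y : 'rV[R]_n => y + z) x.
  apply: differentiableD; last exact: differentiable_cst.
  by have [] := is_diff_id x.
split=> //; apply: (@C1_onI _ _ _ (fun v x => 'D_v f (x + z))) => //.
- exact: openT.
- by move=> x _; apply: (@differentiable_comp _ _ _ _ (fun y => y + z) f) => //; apply: (f1 _ _).1.
- move=> x v _.
  refine (@continuous_comp _ _ _ (fun y : 'rV[R]_n => y + z) ('D_v f) x _ _).
    exact: differentiable_continuous.
  by apply: (f1 _ _).2.
Qed.

(** A remainder of second order identifies the differential. The continuity of
    the candidate is a hypothesis because linear maps out of an arbitrary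
    normed space need not be continuous. *)
Lemma differentiable_quadratic (V : normedModType R) (f : V -> R)
    (L : {linear V -> R}) (x : V) (C : R) : continuous L ->
  (forall h, `|h| <= 1 -> `|f (h + x) - f x - L h| <= C * `|h| ^+ 2) ->
  differentiable f x /\ 'd f x = L :> (V -> R).
Proof.
move=> cL h.
have fL : f \o shift x = cst (f x) + L +o_ 0 id.
  apply/eqaddoP => _/posnumP[e].
  apply/nbhs_norm0P; exists (Num.min 1 (e%:num / (`|C| + 1))) => /=.
    by rewrite lt_min ltr01/= divr_gt0// ltr_wpDl.
  move=> y /=; rewrite lt_min => /andP[y1 ye].
  rewrite !fctE /= opprD addrA; apply: le_trans (h y (ltW y1)) _.
  rewrite expr2 mulrA ler_wpM2r//.
  apply: le_trans (_ : (`|C| + 1) * `|y| <= _).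
    by rewrite ler_wpM2r// (le_trans (ler_norm C))// lerDl.
  by rewrite mulrC -ler_pdivlMr ?ltr_wpDl// ltW.
have dfL : 'd f x = L :> (V -> R) by apply: diff_unique.
by split=> //; apply/diff_locallyP; rewrite dfL.
Qed.

End C1_calculus.

(** * Profile functions *)

Section profiles.
Context {R : realType}.
Implicit Types s t : R.

(** The square of the positive part: the simplest nonnegative profile of class
    C1 that vanishes on a half line. All cutoffs and kernels are built from it. *)
Definition sqpos s : R := (Num.max 0 s) ^+ 2.

Lemma sqpos_ge0 s : 0 <= sqpos s. Proof. exact: sqr_ge0. Qed.

Lemma sqpos_eq0 s : s <= 0 -> sqpos s = 0.
Proof. by move=> s0; rewrite /sqpos (max_idPl s0) expr0n. Qed.

Lemma sqpos_taylor s t : `|sqpos (t + s) - sqpos s - 2 * Num.max 0 s * t| <= t ^+ 2.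
Proof.
by rewrite /sqpos /Num.max; case: ifPn; case: ifPn; rewrite -?leNgt => h1 h2;
  rewrite ler_norml; apply/andP; split; nra.
Qed.

Lemma sqpos_derive s : derivable sqpos s 1 /\ derive1 sqpos s = 2 * Num.max 0 s.
Proof.
have [] := @differentiable_quadratic R R^o sqpos ( *:%R (2 * Num.max 0 s) : {linear R^o -> R^o}) s 1.
- exact: scaler_continuous.
- by move=> t _ ; rewrite mul1r real_normK ?num_real// sqpos_taylor.
- move=> df dfE; split; first exact/derivable1_diffP.
  by rewrite derive1E deriveE// dfE; exact: mulr1.
Qed.

Lemma continuous_pos : continuous (fun s : R => Num.max 0 s).
Proof.
move=> s; apply: (@continuous_max R R (cst 0) id s).
  exact: cst_continuous.
by move=> A; exact.
Qed.

Lemma continuous_derive_sqpos : continuous (derive1 sqpos).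
Proof.
rewrite (_ : derive1 sqpos = fun s => 2 * Num.max 0 s).
  by move=> s; apply: (@continuousM _ _ (cst 2)); [exact: cst_continuous|exact: continuous_pos].
by apply/funext => s; rewrite (sqpos_derive s).2.
Qed.

Context {n : nat}.

Lemma C1_on_sqpos (U : set 'rV[R]_n) (f : 'rV[R]_n -> R) : open U -> C1_on U f ->
  C1_on U (fun x => sqpos (f x)).
Proof.
move=> oU f1; refine (C1_on_comp oU f1 _) => x Ux.
by split; [exact: (sqpos_derive _).1|exact: continuous_derive_sqpos].
Qed.

Lemma C1_onV (U : set 'rV[R]_n) (f : 'rV[R]_n -> R) : open U -> C1_on U f ->
  (forall x, U x -> f x != 0) -> C1_on U (fun x => (f x)^-1).
Proof.
move=> oU f1 f0.
have h x v : U x -> 'D_v (fun x => (f x)^-1) x = - (f x) ^- 2 *: 'D_v f x.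
  move=> Ux; apply: (@deriveV _ _ f) => //; first exact: f0.
  by apply: diff_derivable; exact: (f1 _ Ux).1.
apply: (@C1_onI _ _ _ _ _ (fun v x => - (f x) ^- 2 *: 'D_v f x)) => //.
- by move=> x Ux; apply: (@differentiableV _ _ f); [exact: (f1 _ Ux).1|exact: f0].
- move=> x v Ux; apply: (@continuousM _ _ (fun x => - (f x) ^- 2)); last exact: (f1 _ Ux).2.
  apply: (@continuousN R R _ (fun x => (f x)^-2)).
  apply: (@continuousV _ _ (fun x => f x ^+ 2)); first by rewrite sqrf_eq0 f0.
  have := C1_on_continuous f1 Ux => cf.
  by rewrite (_ : (fun x => _) = fun x => f x * f x)//; exact: continuousM.
Qed.

Lemma C1_on_sqrt (U : set 'rV[R]_n) (f : 'rV[R]_n -> R) : open U -> C1_on U f ->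
  (forall x, U x -> 0 < f x) -> C1_on U (fun x => Num.sqrt (f x)).
Proof.
move=> oU f1 f0; refine (C1_on_comp oU f1 _) => x Ux.
have fx0 := f0 _ Ux.
split; first by have [] := is_derive1_sqrt fx0.
suff : derive1 (@Num.sqrt R) s @[s --> f x] --> (2 * Num.sqrt (f x))^-1.
  rewrite (_ : (2 * Num.sqrt (f x))^-1 = derive1 (@Num.sqrt R) (f x))//.
  by rewrite derive1E; have [_ ->] := is_derive1_sqrt fx0.
have c : (2 * Num.sqrt s)^-1 @[s --> f x] --> (2 * Num.sqrt (f x))^-1.
  apply: (@cvgV R _ _ _ (fun s : R => 2 * Num.sqrt s)).
    by rewrite mulf_neq0// lt0r_neq0// sqrtr_gt0.
  by apply: cvgM; [exact: cvg_cst|exact: sqrt_continuous].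
apply: cvg_trans c; apply: near_eq_cvg; near=> s.
rewrite derive1E.
have s0 : 0 < s by near: s; apply: (@open_nbhs_nbhs _ (f x) [set s | 0 < s]); split => //; exact: open_gt.
by have [_ ->] := is_derive1_sqrt s0.
Unshelve. all: by end_near. Qed.

End profiles.

(** * Compactly supported maps *)

Section compact_support.
Context {R : realType} {n : nat}.
Implicit Types (x v : 'rV[R]_n) (U : set 'rV[R]_n) (xi : 'rV[R]_n -> 'rV[R]_n).

Lemma compact_bounded_rV (A : set 'rV[R]_n) : compact A ->
  exists2 M : R, 0 < M & forall x, A x -> enorm x <= M.
Proof.
move=> /compact_bounded[M [_ hM]].
pose M' : R := `|M| + 1.
have MM' : M < M' by rewrite (le_lt_trans (ler_norm M))// ltrDl.
exists (n.+1%:R * M'); first by rewrite mulr_gt0// ltr_wpDl.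
move=> x Ax; rewrite (le_trans (enorm_le_norm x))// ler_wpM2l//.
exact: (hM _ MM' _ Ax).
Qed.

Lemma compact_closed_ball (M : R) : compact [set x : 'rV[R]_n | enorm x <= M].
Proof.
apply: bounded_closed_compact.
  exists M; split; first exact: num_real.
  move=> M' MM' x /= xM; rewrite (le_trans (norm_le_enorm x))//.
  exact: le_trans xM (ltW MM').
have := closed_comp (f := @enorm R n) (D := [set s | s <= M]).
apply; last exact: closed_le.
by move=> x _; exact: continuous_enorm.
Qed.

Lemma C1cP xi : C1c xi <->
  C1_on setT xi /\ exists M : R, forall x, M < enorm x -> xi x = 0.
Proof.
split=> [[xi1 /compact_bounded_rV[M _ hM]]|[xi1 [M hM]]]; split => //.
  exists M => x Mx; apply/eqP; apply: contraTT Mx => xix; rewrite -leNgt.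
  by apply: hM; exact: subset_closure.
apply: (@subclosed_compact _ _ [set x | enorm x <= M]).
- exact: closed_closure.
- exact: compact_closed_ball.
- rewrite [X in _ `<=` X](closure_id _).1; last first.
    by apply: compact_closed; [exact: norm_hausdorff|exact: compact_closed_ball].
  apply: closureS => x /= /negP h; rewrite leNgt; apply/negP => Mx; apply: h.
  by apply/eqP; exact: hM.
Qed.

(** Compact support is expressed by a radius, which passes to products, sums
    and translates without any topological argument. *)
Definition Cc (f : 'rV[R]_n -> R) :=
  continuous f /\ exists M : R, forall x, M < enorm x -> f x = 0.

Lemma Cc_bounded f : Cc f -> exists2 C : R, 0 <= C & forall x, `|f x| <= C.
Proof.
move=> [cf [M hM]]; pose A := [set x : 'rV[R]_n | enorm x <= Num.max 0 M].
have A0 : A 0 by rewrite /A/= enorm0 le_max lexx.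
have cA : compact A by exact: compact_closed_ball.
have [||c cA' hc] := @EVT_max_rV R n (fun x => `|f x|) A _ cA.
- by exists 0.
- apply: continuous_subspaceT => x.
  by apply: (@continuous_comp _ _ _ f (fun y : R => `|y|)); [exact: cf|exact: norm_continuous].
exists `|f c| => // x; have [xA|xA] := leP (enorm x) (Num.max 0 M).
  by apply: hc; rewrite inE.
by rewrite hM ?normr0//; move: xA; rewrite gt_max => /andP[].
Qed.

Lemma CcM (f g : 'rV[R]_n -> R) : continuous f -> Cc g -> Cc (fun x => f x * g x).
Proof.
move=> cf [cg [M hM]]; split; first by move=> x; apply: continuousM; [exact: cf|exact: cg].
by exists M => x /hM ->; rewrite mulr0.
Qed.

Lemma CcD f g : Cc f -> Cc g -> Cc (fun x => f x + g x).
Proof.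
move=> [cf [M hM]] [cg [N hN]]; split.
  by move=> x; apply: (@continuousD _ R); [exact: cf|exact: cg].
by exists (Num.max M N) => x; rewrite gt_max => /andP[/hM -> /hN ->]; rewrite addr0.
Qed.

Lemma CcN f : Cc f -> Cc (fun x => - f x).
Proof.
move=> [cf [M hM]]; split.
  by move=> x; apply: (@continuousN R R); exact: cf.
by exists M => x /hM ->; rewrite oppr0.
Qed.

Lemma open_norm_gt (M : R) : open [set x : 'rV[R]_n | M < enorm x].
Proof.
have := open_comp (f := @enorm R n) (D := [set s | M < s]); apply.
  by move=> x _; exact: continuous_enorm.
exact: open_gt.
Qed.

Lemma Cc_derive {W : normedModType R} (f : 'rV[R]_n -> W) (M : R) x v :
  (forall x, M < enorm x -> f x = 0) -> M < enorm x -> 'D_v f x = 0.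
Proof.
move=> hM Mx; rewrite (@near_eq_derive _ _ _ f (cst 0)) ?derive_cst//.
near=> y; apply: hM; near: y; apply: open_nbhs_nbhs; split => //.
exact: open_norm_gt.
Unshelve. all: by end_near. Qed.

Lemma Cc_divergence xi : C1c xi -> Cc (divergence xi).
Proof.
move=> /C1cP[xi1 [M hM]]; split.
  by move=> x; exact: (C1_on_divergence_continuous xi1).
by exists M => x Mx; rewrite /divergence big1// => i _; rewrite (Cc_derive _ hM Mx) mxE.
Qed.

Lemma C1cZ (f : 'rV[R]_n -> R) xi : C1_on setT f -> C1c xi -> C1c (fun x => f x *: xi x).
Proof.
move=> f1 /C1cP[xi1 [M hM]]; apply/C1cP; split; first exact: (C1_onZ openT f1 xi1).
by exists M => x /hM ->; rewrite scaler0.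
Qed.

Lemma C1cZr (f : 'rV[R]_n -> R) xi (M : R) : (forall x, M < enorm x -> f x = 0) ->
  C1_on setT f -> C1_on setT xi -> C1c (fun x => f x *: xi x).
Proof.
move=> hM f1 xi1; apply/C1cP; split; first exact: (C1_onZ openT f1 xi1).
by exists M => x /hM ->; rewrite scale0r.
Qed.

Lemma C1cD xi eta : C1c xi -> C1c eta -> C1c (fun x => xi x + eta x).
Proof.
move=> /C1cP[xi1 [M hM]] /C1cP[eta1 [N hN]]; apply/C1cP; split; first exact: (C1_onD openT xi1 eta1).
by exists (Num.max M N) => x; rewrite gt_max => /andP[/hM -> /hN ->]; rewrite addr0.
Qed.

Lemma C1c0 : C1c (fun=> 0 : 'rV[R]_n).
Proof. by apply/C1cP; split; [exact: C1_on_cst|exists 0]. Qed.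

Lemma C1cN xi : C1c xi -> C1c (fun x => - xi x).
Proof.
move=> /C1cP[xi1 [M hM]]; apply/C1cP; split; first exact: (C1_onN openT xi1).
by exists M => x /hM ->; rewrite oppr0.
Qed.

Lemma C1c_sum I (r : seq I) (xi : I -> 'rV[R]_n -> 'rV[R]_n) :
  (forall i, C1c (xi i)) -> C1c (fun x => \sum_(i <- r) xi i x).
Proof.
move=> xi1; elim: r => [|i r ih].
  by rewrite (_ : (fun x => _) = fun=> 0); [exact: C1c0|apply/funext => x; rewrite big_nil].
rewrite (_ : (fun x => _) = fun x => xi i x + \sum_(i <- r) xi i x).
  exact: C1cD.
by apply/funext => x; rewrite big_cons.
Qed.

Lemma C1c_shift xi z : C1c xi -> C1c (fun x => xi (x + z)) /\
  forall x, divergence (fun x => xi (x + z)) x = divergence xi (x + z).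
Proof.
move=> /C1cP[xi1 [M hM]]; have [s1 s2] := C1_on_shift z xi1.
split; last by move=> x; apply: eq_bigr => i _; rewrite s2.
apply/C1cP; split => //; exists (M + enorm z) => x Mx; apply: hM.
move: Mx; rewrite -ltrBrDr => /lt_le_trans; apply.
by rewrite lerBlDr -{1}(addrK z x) (le_trans (enormD _ _))// enormN.
Qed.

(** A polynomial in the squared distance, cut off at 0: it is positive exactly
    on the Euclidean ball, and of class C1 although the distance is not. *)
Definition ebump (c : 'rV[R]_n) (r : R) x : R :=
  sqpos (r ^+ 2 - dotp (x - c) (x - c)).

Lemma C1_on_bump c (r : R) : C1_on setT (ebump c r).
Proof.
have h : C1_on setT (fun x => x - c).
  refine (C1_on_row openT _) => i.
  rewrite (_ : (fun x => _) = fun x => x 0 i - c 0 i).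
    exact: (C1_onB openT (C1_on_proj i openT) (C1_on_cst _)).
  by apply/funext => x; rewrite !mxE.
exact: (C1_on_sqpos openT (C1_onB openT (C1_on_cst _) (C1_on_dotp openT h h))).
Qed.

Lemma bump_eq0 c (r : R) x : 0 <= r -> r <= enorm (x - c) -> ebump c r x = 0.
Proof.
move=> r0 xr; apply: sqpos_eq0; rewrite subr_le0 -enorm_sqr ler_pXn2r// ?nnegrE//.
exact: enorm_ge0.
Qed.

Lemma bump_supp c (r : R) : 0 <= r -> forall x, r + enorm c < enorm x -> ebump c r x = 0.
Proof.
move=> r0 x rx; apply: bump_eq0 => //; rewrite -(lerD2r (enorm c)).
by rewrite (le_trans (ltW rx))// (le_trans _ (enormD _ _))// subrK.
Qed.

End compact_support.

(** * Measurability of vector-valued maps *)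

Section borel.
Context {R : realType} {n : nat} {d : measure_display} {S : measurableType d}.
Implicit Types (f : S -> 'rV[R]_n).

Let rational_box (c : 'rV[rat]_n) (k : nat) : set 'rV[R]_n :=
  [set x | forall i, `|x 0 i - ratr (c 0 i)| <= k.+1%:R^-1].

(** Open sets of [R^n] are countable unions of rational boxes, so that
    measurability of a vector-valued map can be checked on coordinates. *)
Lemma measurable_preimage_open f (O : set 'rV[R]_n) :
  (forall i, measurable_fun setT (fun s => f s 0 i)) -> open O ->
  measurable (f @^-1` O).
Proof.
move=> mf oO.
pose P (ck : 'rV[rat]_n * nat) := rational_box ck.1 ck.2 `<=` O.
have -> : f @^-1` O = \bigcup_ck
    (if `[< P ck >] then f @^-1` rational_box ck.1 ck.2 else set0).
  apply/seteqP; split => [s /= Os|s [ck _]]; last first.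
    by case: asboolP => // h; exact: h.
  have /nbhs_ballP[e /= e0 eO] : nbhs (f s) O by exact: open_nbhs_nbhs.
  have [k ke] : exists k, (k.+1%:R^-1 : R) < e / 2.
    have e2 : 0 < e / 2 by rewrite divr_gt0.
    have [N _ hN] := near_infty_natSinv_lt (PosNum e2).
    by exists N; exact: (hN N (leqnn N)).
  have /choice[c hc] : forall i, exists q : rat, `|f s 0 i - ratr q| <= k.+1%:R^-1.
    move=> i; have [|q] := @rat_in_itvoo R (f s 0 i) (f s 0 i + k.+1%:R^-1).
      by rewrite ltrDl invr_gt0.
    rewrite in_itv/= => /andP[q1 q2]; exists q.
    by rewrite distrC gtr0_norm ?subr_gt0// lerBlDl ltW.
  exists ((\row_i c i : 'rV[rat]_n), k) => //.
  have h : P ((\row_i c i : 'rV[rat]_n), k).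
    move=> x /= hx; apply: eO; rewrite -ball_normE/=.
    apply: (@le_lt_trans _ _ (k.+1%:R^-1 + k.+1%:R^-1)); last by rewrite [ltRHS]splitr ltrD.
    apply: norm_leP => [|i]; first by rewrite addr_ge0.
    rewrite !mxE (_ : _ - _ = (f s 0 i - ratr (c i)) - (x 0 i - ratr (c i))); last by ring.
    apply: le_trans (ler_normB _ _) _; apply: lerD; first exact: hc.
    by have := hx i; rewrite mxE.
  by rewrite (asboolT h) => /= i; rewrite mxE.
apply: countable_bigcupT_measurable => // -[c k].
case: asboolP => // _.
rewrite (_ : _ @^-1` _ = \bigcap_(i in [set: 'I_n])
    [set s | `|f s 0 i - ratr (c 0 i)| <= k.+1%:R^-1]).
  apply: fin_bigcap_measurable; first exact: finite_finset.
  move=> i _.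
  rewrite -[X in measurable X]setTI.
  apply: (@measurable_fun_le _ _ R setT (fun s => `|f s 0 i - ratr (c 0 i)|) (cst k.+1%:R^-1)) => //.
  apply: measurableT_comp => //; apply: measurable_funB => //; exact: mf.
by apply/seteqP; split => s /= h => [i _|i]; exact: h.
Qed.

Lemma measurable_preimage_borel f (B : set (borel_rV R n)) :
  (forall i, measurable_fun setT (fun s => f s 0 i)) -> measurable B ->
  measurable (f @^-1` B).
Proof.
move=> mf mB.
have h : @measurable_fun _ _ S (borel_rV R n) setT f.
  apply: (@measurability _ _ S (borel_rV R n) setT f (@open 'rV[R]_n) (erefl _)).
  by move=> _ [V oV <-]; rewrite setTI; exact: measurable_preimage_open.
by rewrite -[X in measurable X]setTI; exact: h.
Qed.

Lemma measurable_continuous_comp (g : 'rV[R]_n -> R) f : continuous g ->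
  (forall i, measurable_fun setT (fun s => f s 0 i)) ->
  measurable_fun setT (fun s => g (f s)).
Proof.
move=> cg mf; apply: (measurability _ (measurable_realfun.RGenOpens.measurableE R)) => _ [_ [x [y ->] <-]].
rewrite setTI (_ : _ @^-1` _ = f @^-1` (g @^-1` `]x, y[%classic))//.
by apply: measurable_preimage_open => //; apply: open_comp.
Qed.

End borel.

(** * Lebesgue measure of boxes, translates and hulls *)

Section lebesgue_basics.
Context {R : realType} {n : nat}.
Implicit Types (x v : 'rV[R]_n) (A : set 'rV[R]_n).
Local Notation T := (lebesgue_rV R n).
Local Notation mu := (@lebesgue R n).
Local Open Scope ereal_scope.

Definition shift_set A v : set 'rV[R]_n := [set x | A (x + v)%R].

Lemma shift_setK A v : shift_set (shift_set A v) (- v)%R = A.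
Proof. by apply/seteqP; split => x; rewrite /shift_set/= subrK. Qed.

Lemma shift_setNK A v : shift_set (shift_set A (- v)%R) v = A.
Proof. by apply/seteqP; split => x; rewrite /shift_set/= addrK. Qed.

Lemma lebesgue_shift A v : mu (shift_set A v) = mu A.
Proof.
have le B w : mu (shift_set B w) <= mu B.
  apply: le_ereal_inf_tmp => _ [F BF <-].
  pose G k : option ('rV[R]_n * 'rV[R]_n) :=
    if F k is Some ab then Some (ab.1 - w, ab.2 - w)%R else None.
  have -> : \sum_(k <oo) box_vol (F k) = \sum_(k <oo) box_vol (G k).
    apply: eq_eseriesr => k _; rewrite /G; case: (F k) => //= -[a b] /=.
    by congr (_%:E); apply: eq_bigr => i _; rewrite !mxE; congr Num.max; ring.
  apply: ereal_inf_lbound; exists G => // x /BF[k _]; rewrite /box => xk.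
  exists k => //; rewrite /box /G; case: (F k) xk => // -[a b] /= h i.
  by have := h i; rewrite !mxE lerBlDr lerBrDr.
by apply/eqP; rewrite eq_le le/= -{1}(shift_setK A v) le.
Qed.

Lemma lebesgue_measurable_shift A v : lebesgue_measurable A ->
  lebesgue_measurable (shift_set A v).
Proof.
move=> mA.
suff h : (@lebesgue_outer R n).-caratheodory (shift_set A v) by [].
have {}mA : (@lebesgue_outer R n).-caratheodory A by [].
move=> X.
have -> : lebesgue_outer X = lebesgue_outer (shift_set X (- v)%R).
  exact: esym (lebesgue_shift _ _).
rewrite mA; congr (_ + _).
  rewrite -[RHS](lebesgue_shift _ (- v)%R); congr lebesgue_outer.
  by apply/seteqP; split => x []; rewrite /shift_set/= subrK.
rewrite -[RHS](lebesgue_shift _ (- v)%R); congr lebesgue_outer.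
by apply/seteqP; split => x []; rewrite /shift_set/= subrK.
Qed.

Let set_coord (a : 'rV[R]_n) (i : 'I_n) (c : R) : 'rV[R]_n :=
  (\row_j if j == i then c else a 0 j)%R.

(** Half spaces are measurable because a hyperplane cuts a box into two boxes
    whose volumes add up. *)
Lemma measurable_halfspace i (c : R) :
  lebesgue_measurable [set x : 'rV[R]_n | (x 0 i <= c)%R].
Proof.
apply: le_caratheodory_measurable => X.
apply: le_ereal_inf_tmp => _ [F XF <-].
pose G1 k := if F k is Some ab
  then Some (ab.1, set_coord ab.2 i (Num.min (ab.2 0%R i) c)) else None.
pose G2 k := if F k is Some ab
  then Some (set_coord ab.1 i (Num.max (ab.1 0%R i) c), ab.2) else None.
have -> : \sum_(k <oo) box_vol (F k) =
    \sum_(k <oo) box_vol (G1 k) + \sum_(k <oo) box_vol (G2 k).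
  rewrite -nneseriesD; [|by move=> *; exact: box_vol_ge0..].
  apply: eq_eseriesr => k _; rewrite /G1 /G2; case: (F k) => [[a b]|] /=; last by rewrite adde0.
  rewrite -EFinD; congr (_%:E).
  rewrite (bigD1 i)//= [in RHS](bigD1 i)//= [X in (_ = _ + X)%R](bigD1 i)//=.
  rewrite !mxE eqxx.
  set P := (\prod_(j < n | j != i) _)%R.
  rewrite (eq_bigr (fun j => Num.max 0 (b 0 j - a 0 j)))%R; last first.
    by move=> j ji; rewrite mxE (negbTE ji).
  rewrite [X in (_ = _ + _ * X)%R](eq_bigr (fun j => Num.max 0 (b 0 j - a 0 j)))%R; last first.
    by move=> j ji; rewrite mxE (negbTE ji).
  rewrite -/P -mulrDl; congr (_ * _)%R.
  by rewrite /Num.max /Num.min; do ![case: ifPn]; rewrite -?leNgt => *; lra.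
apply: leeD.
- apply: ereal_inf_lbound; exists G1 => // x [/XF[k _ xk] xc]; exists k => //.
  move: xk; rewrite /box /G1; case: (F k) => // -[a b] /= h j.
  have := h j; rewrite mxE; case: eqP => // -> /andP[-> ?] /=.
  by rewrite le_min xc andbT.
- apply: ereal_inf_lbound; exists G2 => // x [/XF[k _ xk] /= /negP xc]; exists k => //.
  move: xk; rewrite /box /G2; case: (F k) => // -[a b] /= h j.
  have := h j; rewrite mxE; case: eqP => // -> /andP[? ->]; rewrite andbT.
  by rewrite ge_max; apply/andP; split => //; move: xc; rewrite -ltNge => /ltW.
Qed.

Lemma measurable_coord i : measurable_fun setT (fun x : T => x 0%R i).
Proof.
apply: (measurability _ (measurable_realfun.RGenOInfty.measurableE R)) => // _ [_ [c ->] <-].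
rewrite setTI (_ : _ @^-1` _ = ~` [set x : T | (x 0 i <= c)%R]); last first.
  by apply/seteqP; split => x /=; rewrite in_itv/= andbT ltNge => /negP.
by apply: measurableC; exact: measurable_halfspace.
Qed.

Lemma lebesgue_measurable_open A : open A -> measurable (A : set T).
Proof. by move=> oA; exact: (@measurable_preimage_open R n _ T id A measurable_coord oA). Qed.

Lemma lebesgue_measurable_closed A : closed A -> measurable (A : set T).
Proof.
move=> cA; rewrite -[A]setCK; apply: measurableC; apply: lebesgue_measurable_open.
exact: closed_openC.
Qed.

Lemma measurable_borel A : measurable (A : set (borel_rV R n)) -> measurable (A : set T).
Proof. by move=> mA; exact: (@measurable_preimage_borel R n _ T id A measurable_coord mA). Qed.

Lemma measurable_continuous (g : 'rV[R]_n -> R) : continuous g ->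
  measurable_fun setT (g : T -> R).
Proof.
move=> cg; apply: (@measurable_continuous_comp R n _ T g id cg) => i.
exact: measurable_coord.
Qed.

Lemma closed_coord_box c : closed (@box R n c).
Proof.
case: c => [[a b]|]; last exact: closed0.
rewrite (_ : box _ = \bigcap_(i in [set: 'I_n])
  ([set x | (a 0 i <= x 0 i)%R] `&` [set x | (x 0 i <= b 0 i)%R])); last first.
  by apply/seteqP; split => x /= h i => [_|]; [apply/andP|apply/andP]; exact: h.
apply: closed_bigI => i _; apply: closedI.
- apply: (@preimage_closed _ _ (fun x : 'rV[R]_n => x 0%R i) [set t | (a 0 i <= t)%R]).
    by move=> x _; exact: coord_continuous.
  exact: closed_ge.
- apply: (@preimage_closed _ _ (fun x : 'rV[R]_n => x 0%R i) [set t | (t <= b 0 i)%R]).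
    by move=> x _; exact: coord_continuous.
  exact: closed_le.
Qed.

Lemma lebesgue_box_le c : mu (box c) <= box_vol c.
Proof.
rewrite -[leRHS](_ : \sum_(k <oo) box_vol (if k == 0%N then c else None) = _).
  by apply: ereal_inf_lbound; exists (fun k => if k == 0%N then c else None) => // x xc; exists 0%N.
rewrite (@nneseries_split _ _ 0 1)//; last by move=> k _; exact: box_vol_ge0.
rewrite add0n big_nat1/= eseries0 ?adde0// => k k1 _.
by case: k k1.
Qed.

Lemma lebesgue_bounded_lty A (M : R) : (forall x, A x -> (enorm x <= M)%R) -> mu A < +oo.
Proof.
move=> hM; have : mu (box (Some (const_mx (- M), const_mx M)%R)) < +oo.
  by rewrite (le_lt_trans (lebesgue_box_le _))// ltry.
apply: le_lt_trans; apply: le_lebesgue_outer => x /hM xM i.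
by rewrite !mxE -ler_norml (le_trans (coord_le_enorm x i)).
Qed.

Lemma sigma_finite_lebesgue : sigma_finite [set: T] mu.
Proof.
exists (fun k : nat => [set x : T | (enorm x <= k%:R)%R]).
  apply/seteqP; split => // x _.
  exists (Num.truncn (enorm x)).+1 => //=.
  by rewrite ltW// truncnS_gt.
move=> k; split; last by apply: (@lebesgue_bounded_lty _ k%:R).
apply: lebesgue_measurable_closed.
apply: (@preimage_closed _ _ (@enorm R n) [set t | (t <= k%:R)%R]).
  by move=> x _; exact: continuous_enorm.
exact: closed_le.
Qed.

(** Every set has a Borel hull of the same outer measure: the union of the
    boxes of an almost optimal covering, intersected over finer coverings. *)
Lemma borel_hull A : exists G, [/\ measurable (G : set (borel_rV R n)),
  A `<=` G & mu G = mu A].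
Proof.
have [Aoo|Aoo] := eqVneq (mu A) +oo.
  exists setT; split => //; apply/eqP; rewrite eq_le {1}Aoo leey/=.
  exact: le_lebesgue_outer.
have Afin : mu A \is a fin_num by rewrite ge0_fin_numE ?lt_neqAle ?Aoo ?leey ?lebesgue_outer_ge0.
have /choice[F hF] : forall m : nat, exists F : nat -> option ('rV[R]_n * 'rV[R]_n),
    A `<=` \bigcup_k box (F k) /\ \sum_(k <oo) box_vol (F k) <= mu A + (m.+1%:R^-1)%:E.
  move=> m; have m0 : (0 < m.+1%:R^-1 :> R)%R by rewrite invr_gt0.
  have [_ [F AF <-] /ltW hF] := lb_ereal_inf_adherent m0 Afin.
  by exists F.
pose G := \bigcap_m \bigcup_k box (F m k).
have mbox c : measurable (box c : set (borel_rV R n)).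
  rewrite -[box c]setCK; apply: measurableC; apply: sub_sigma_algebra.
  exact/closed_openC/closed_coord_box.
have AG : A `<=` G by move=> x Ax m _; exact: (hF m).1.
exists G; split => //.
  by apply: bigcapT_measurable => m; apply: bigcupT_measurable => k.
apply/eqP; rewrite eq_le; apply/andP; split; last exact: le_lebesgue_outer.
apply/lee_addgt0Pr => e e0.
have [N _ hN] := near_infty_natSinv_lt (PosNum e0).
apply: (@le_trans _ _ (\sum_(k <oo) box_vol (F N k))).
  by apply: ereal_inf_lbound; exists (F N) => // x; exact.
rewrite (le_trans (hF N).2)// leeD2l// lee_fin ltW//.
exact: (hN N (leqnn N)).
Qed.

End lebesgue_basics.

HB.instance Definition _ (R : realType) (n : nat) :=
  Measure_isSigmaFinite.Build _ (lebesgue_rV R n) R (@lebesgue R n) (@sigma_finite_lebesgue R n).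

(** * Integration of bounded functions with bounded support *)

Section bounded_compact_support.
Context {R : realType} {n : nat}.
Implicit Types (x v : 'rV[R]_n) (A D : set 'rV[R]_n) (f g : 'rV[R]_n -> R).
Local Notation T := (lebesgue_rV R n).
Local Notation mu := (@lebesgue R n).

Lemma measurable_eball c (r : R) : measurable (eball c r : set T).
Proof. exact/lebesgue_measurable_open/open_eball. Qed.

Lemma measurable_cball (M : R) : measurable ([set x | enorm x <= M] : set T).
Proof.
apply: lebesgue_measurable_closed.
apply: compact_closed; [exact: norm_hausdorff|exact: compact_closed_ball].
Qed.

(** Bounded measurable functions with bounded support: a class of integrable
    functions that is stable under products, unlike the class of integrable
    functions, and contains the restrictions of [Cc] functions to measurable
    sets. *)
Definition Bc f := measurable_fun setT (f : T -> R) /\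
  exists C M : R, forall x, `|f x| <= C /\ (M < enorm x -> f x = 0).

Lemma Cc_Bc f : Cc f -> Bc f.
Proof.
move=> fc; have [C _ hC] := Cc_bounded fc; have [cf [M hM]] := fc.
split; first exact: measurable_continuous.
by exists C, M => x; split; [exact: hC|exact: hM].
Qed.

Lemma BcM f g (C : R) : measurable_fun setT (f : T -> R) -> (forall x, `|f x| <= C) ->
  Bc g -> Bc (fun x => f x * g x).
Proof.
move=> mf hC [mg [D [M hD]]]; split; first exact: measurable_funM.
exists (C * D), M => x; split; last by move=> /(hD x).2 ->; rewrite mulr0.
by rewrite normrM ler_pM//; exact: (hD x).1.
Qed.

Lemma Bc_indic A g : measurable (A : set T) -> Bc g -> Bc (fun x => \1_A x * g x).
Proof.
move=> mA; apply: (@BcM _ _ 1); first exact: measurable_indic.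
by move=> x; rewrite indicE; case: (_ \in _); rewrite ?normr1 ?normr0.
Qed.

Lemma BcD f g : Bc f -> Bc g -> Bc (fun x => f x + g x).
Proof.
move=> [mf [C [M hC]]] [mg [D [N hD]]]; split; first exact: measurable_funD.
exists (C + D), (Num.max M N) => x; split.
  by rewrite (le_trans (ler_normD _ _))// lerD//; [exact: (hC x).1|exact: (hD x).1].
by rewrite gt_max => /andP[/(hC x).2 -> /(hD x).2 ->]; rewrite addr0.
Qed.

Lemma BcN f : Bc f -> Bc (fun x => - f x).
Proof.
move=> [mf [C [M hC]]]; split; first exact: measurable_funN.
exists C, M => x; split; first by rewrite normrN; exact: (hC x).1.
by move=> /(hC x).2 ->; rewrite oppr0.
Qed.

Lemma BcB f g : Bc f -> Bc g -> Bc (fun x => f x - g x).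
Proof. by move=> bf bg; exact: (BcD bf (BcN bg)). Qed.

Lemma Bc_norm f : Bc f -> Bc (fun x => `|f x|).
Proof.
move=> [mf [C [M hC]]]; split; first exact: measurableT_comp.
exists C, M => x; split; first by rewrite normr_id; exact: (hC x).1.
by move=> /(hC x).2 ->; rewrite normr0.
Qed.

Lemma Bc_shift f v : Bc f -> Bc (fun x => f (x + v)).
Proof.
move=> [mf [C [M hC]]]; split.
  move=> _ Y mY; rewrite setTI.
  have := mf measurableT Y mY; rewrite setTI => m.
  exact: (@lebesgue_measurable_shift _ _ _ v m).
exists C, (M + enorm v) => x; split; first exact: (hC _).1.
move=> Mx; apply: (hC _).2; move: Mx; rewrite -ltrBrDr => /lt_le_trans; apply.
by rewrite lerBlDr -{1}(addrK v x) (le_trans (enormD _ _))// enormN.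
Qed.

Lemma Bc_integrable D f : measurable (D : set T) -> Bc f ->
  mu.-integrable D (EFin \o f).
Proof.
move=> mD [mf [C [M hC]]].
apply: (@integrableS _ _ _ _ setT) => //.
have -> : EFin \o f = (EFin \o f) \_ [set x | enorm x <= M].
  apply/funext => x; rewrite patchE; case: ifPn => //; rewrite notin_setE/= => /negP.
  by rewrite -ltNge => /(hC x).2 /= ->.
apply/(integrable_mkcond _ (measurable_cball M)).
apply: measurable_bounded_integrable.
- exact: measurable_cball.
- exact: (@lebesgue_bounded_lty _ _ _ M).
- exact: measurable_funS mf.
- exists C; split; first exact: num_real.
  by move=> y Cy x _ /=; rewrite (le_trans (hC x).1)// ltW.
Qed.

Lemma Bc_int_fin D f : measurable (D : set T) -> Bc f ->
  (\int[mu]_(x in D) (f x)%:E = (\int[mu]_(x in D) f x)%R%:E)%E.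
Proof.
move=> mD bf; rewrite /Rintegral fineK//.
exact: (integrable_fin_num mD (Bc_integrable mD bf)).
Qed.

Lemma Bc_intD D f g : measurable (D : set T) -> Bc f -> Bc g ->
  \int[mu]_(x in D) (f x + g x) = \int[mu]_(x in D) f x + \int[mu]_(x in D) g x.
Proof. by move=> mD bf bg; apply: RintegralD => //; exact: Bc_integrable. Qed.

Lemma Bc_intB D f g : measurable (D : set T) -> Bc f -> Bc g ->
  \int[mu]_(x in D) (f x - g x) = \int[mu]_(x in D) f x - \int[mu]_(x in D) g x.
Proof. by move=> mD bf bg; apply: RintegralB => //; exact: Bc_integrable. Qed.

Lemma Bc_intZ D f c : measurable (D : set T) -> Bc f ->
  \int[mu]_(x in D) (c * f x) = c * \int[mu]_(x in D) f x.
Proof. by move=> mD bf; apply: RintegralZl => //; exact: Bc_integrable. Qed.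

Lemma Bc_int_indic A D f :
  \int[mu]_(x in D `&` A) f x = \int[mu]_(x in D) (\1_A x * f x).
Proof.
rewrite Rintegral_mkcondr; apply: eq_Rintegral => x _.
by rewrite patchE indicE; case: ifPn; rewrite ?mul1r ?mul0r.
Qed.

Lemma le_Bc_int D f g : measurable (D : set T) -> Bc f -> Bc g ->
  (forall x, D x -> f x <= g x) -> \int[mu]_(x in D) f x <= \int[mu]_(x in D) g x.
Proof. by move=> mD bf bg fg; apply: le_Rintegral => //; exact: Bc_integrable. Qed.

Lemma le_norm_Bc_int D f : measurable (D : set T) -> Bc f ->
  `|\int[mu]_(x in D) f x| <= \int[mu]_(x in D) `|f x|.
Proof. by move=> mD bf; apply: le_normr_Rintegral => //; exact: Bc_integrable. Qed.

(** Dominated convergence, in the form in which it is used throughout: uniform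
    bounds, a common bounded support and pointwise convergence. *)
Lemma bounded_convergence D (F : nat -> 'rV[R]_n -> R) f (C M : R) :
  measurable (D : set T) ->
  (forall k, measurable_fun setT (F k : T -> R)) ->
  (forall k x, `|F k x| <= C) -> (forall k x, M < enorm x -> F k x = 0) ->
  (forall x, F k x @[k --> \oo] --> f x) ->
  Bc f /\ \int[mu]_(x in D) F k x @[k --> \oo] --> \int[mu]_(x in D) f x.
Proof.
move=> mD mF FC FM Ff.
have bF k : Bc (F k) by split => //; exists C, M => x; split => //; exact: FM.
have bf : Bc f.
  split; first by apply: (measurable_fun_cvg mF) => x _; exact: Ff.
  exists C, M => x; split; last first.
    move=> Mx; rewrite -(cvg_lim _ (Ff x))//.
    rewrite (_ : (fun k => _) = fun=> 0); first exact: lim_cst.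
    by apply/funext => k; exact: FM.
  rewrite -(cvg_lim _ (Ff x))// -lim_norm//; last by apply/cvg_ex; exists (f x); exact: Ff.
  apply: limr_le; last by near=> k; exact: FC.
  by apply: is_cvg_norm; apply/cvg_ex; exists (f x); exact: Ff.
split => //.
pose G x : R := C * \1_[set x | enorm x <= M] x.
have bG : Bc G.
  split.
    apply: measurable_funM; first exact: measurable_cst.
    apply: measurable_indic; exact: measurable_cball.
  exists `|C|, M => x; rewrite /G indicE; split.
    by case: (_ \in _); rewrite ?mulr1// mulr0 normr0.
  by move=> Mx; rewrite memNset ?mulr0//= leNgt Mx.
have [|||||_ _ h] := @dominated_convergence _ T R mu D mD (fun k => EFin \o F k)
    (EFin \o f) (EFin \o G).
- by move=> k; apply/measurable_EFinP; exact: measurable_funS (mF k).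
- by apply/measurable_EFinP; exact: measurable_funS bf.1.
- apply: aeW => x _; apply: cvg_EFin; first exact: nearW.
  exact: Ff.
- exact: Bc_integrable.
- apply: aeW => x k _ /=; rewrite lee_fin /G indicE.
  have [xM|Mx] := leP (enorm x) M; first by rewrite mem_set// mulr1.
  by rewrite memNset ?mulr0 ?FM ?normr0//= leNgt Mx.
have : (\int[mu]_(x in D) (F k x)%:E)%E @[k --> \oo] --> (\int[mu]_(x in D) (f x)%:E)%E by [].
rewrite Bc_int_fin// => /fine_cvgP[_].
by apply: cvg_trans; apply: near_eq_cvg; near=> k.
Unshelve. all: by end_near. Qed.

End bounded_compact_support.

(** * Translations and the divergence theorem *)

Section translation_integral.
Context {R : realType} {n : nat}.
Implicit Types (x v : 'rV[R]_n) (A D : set 'rV[R]_n) (f g : 'rV[R]_n -> R).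
Local Notation T := (lebesgue_rV R n).
Local Notation mu := (@lebesgue R n).

Let shiftf v : T -> T := fun x : 'rV[R]_n => x + v.

Let measurable_shiftf v : measurable_fun setT (shiftf v).
Proof. by move=> _ Y mY; rewrite setTI; exact: lebesgue_measurable_shift. Qed.

Lemma ge0_integral_shift (A : set T) (f : T -> \bar R) v :
  measurable A -> measurable_fun setT f -> (forall x, 0 <= f x)%E ->
  (\int[mu]_(x in shift_set A v) f ((x : 'rV[R]_n) + v)%R = \int[mu]_(x in A) f x)%E.
Proof.
move=> mA mf f0.
have -> : (\int[mu]_(x in A) f x = \int[pushforward mu (shiftf v)]_(x in A) f x)%E.
  by apply: eq_measure_integral => B mB _; rewrite /pushforward; exact: esym (lebesgue_shift _ _).
by rewrite (ge0_integral_pushforward (measurable_shiftf v))//; exact: measurable_funS mf.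
Qed.

Lemma Bc_int_shift A f v : measurable (A : set T) -> Bc f ->
  \int[mu]_(x in shift_set A v) f (x + v) = \int[mu]_(x in A) f x.
Proof.
move=> mA bf; rewrite /Rintegral; congr fine.
have -> : (\int[mu]_(x in A) (f x)%:E = \int[pushforward mu (shiftf v)]_(x in A) (f x)%:E)%E.
  by apply: eq_measure_integral => B mB _; rewrite /pushforward; exact: esym (lebesgue_shift _ _).
rewrite (integral_pushforward (measurable_shiftf v))//.
- apply/measurable_EFinP; exact: bf.1.
- apply: Bc_integrable; last exact: (Bc_shift v bf).
  exact: lebesgue_measurable_shift.
Qed.

Lemma Bc_intT_shift f v : Bc f -> \int[mu]_x f (x + v) = \int[mu]_x f x.
Proof. by move=> bf; rewrite -(Bc_int_shift v measurableT bf). Qed.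

Lemma derive_line (w : 'rV[R]_n -> R) x v (s : R) : differentiable w (x + s *: v) ->
  is_derive s 1 (fun s => w (x + s *: v)) ('D_v w (x + s *: v)).
Proof.
move=> dw.
have e : (fun h : R => h^-1 *: (((fun s => w (x + s *: v)) \o shift s) (h *: 1) - w (x + s *: v)))
  = (fun h : R => h^-1 *: ((w \o shift (x + s *: v)) (h *: v) - w (x + s *: v))).
  apply/funext => h /=; congr (_ *: (w _ - _)).
  by rewrite [h%:A]mulr1 scalerDl addrCA.
have dv := diff_derivable (v := v) dw.
by apply: DeriveDef; rewrite /derivable /derive e.
Qed.

Lemma C1_lipschitz (w : 'rV[R]_n -> R) v (C : R) : C1_on setT w ->
  (forall x, `|'D_v w x| <= C) ->
  forall x (t : R), 0 <= t -> `|w (x + t *: v) - w x| <= C * t.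
Proof.
move=> w1 wC x t t0.
have dl (s : R) : is_derive s (1 : R) (fun s : R => w (x + s *: v)) ('D_v w (x + s *: v)).
  by apply: derive_line; apply: (w1 _ _).1.
have [|c _] := @MVT_segment R (fun s => w (x + s *: v)) (fun s => 'D_v w (x + s *: v)) 0 t t0.
- apply: continuous_subspaceT => s; apply: differentiable_continuous.
  by apply/derivable1_diffP; have [] := dl s.
- rewrite scale0r addr0 subr0 => ->; rewrite normrM (ger0_norm t0).
  by rewrite ler_wpM2r.
Qed.

(** The divergence theorem for compactly supported fields needs no boundary
    analysis: the integral of a difference quotient vanishes by translation
    invariance, and difference quotients converge boundedly. *)
Lemma int_derive_eq0 (w : 'rV[R]_n -> R) v (M : R) : C1_on setT w ->
  (forall x, M < enorm x -> w x = 0) -> \int[mu]_x 'D_v w x = 0.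
Proof.
move=> w1 wM.
have Cw : Cc w by split; [move=> x; exact: (C1_on_continuous w1)|exists M].
have Cdw : Cc ('D_v w).
  split; first by move=> x; apply: (w1 x _).2.
  by exists M => x; exact: Cc_derive.
have [C C0 hC] := Cc_bounded Cdw.
have bw := Cc_Bc Cw.
pose q k x := k.+1%:R * (w (x + k.+1%:R^-1 *: v) - w x).
have bq k : Bc (fun x => w (x + k.+1%:R^-1 *: v) - w x) by exact: (BcB (Bc_shift _ bw) bw).
have [||||_ h] := @bounded_convergence R n setT q ('D_v w) C (M + enorm v) measurableT.
- move=> k; apply: measurable_funM; first exact: measurable_cst.
  exact: (bq k).1.
- move=> k x; rewrite /q normrM ger0_norm// -ler_pdivlMl// mulrC.
  by apply: C1_lipschitz => //; rewrite invr_ge0.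
- move=> k x Mx; rewrite /q wM ?wM ?subrr ?mulr0//.
    by rewrite (le_lt_trans _ Mx)// lerDl enorm_ge0.
  have kv : enorm (k.+1%:R^-1 *: v) <= enorm v.
    by rewrite enormZ ger0_norm// ler_piMl ?enorm_ge0// invf_le1// ler1n.
  rewrite -(ltrD2r (enorm (k.+1%:R^-1 *: v))).
  apply: (@le_lt_trans _ _ (M + enorm v)); first by rewrite lerD2l.
  by apply: lt_le_trans Mx _; rewrite -[in leLHS](addrK (k.+1%:R^-1 *: v) x) (le_trans (enormD _ _))// enormN.
- move=> x; have dw : derivable w x v by apply: diff_derivable; apply: (w1 x _).1.
  have h0 : k.+1%:R^-1 @[k --> \oo] --> (0 : R)^'.
    move=> P hP; have : \forall k \near \oo, (k.+1%:R^-1 : R) != 0 -> P k.+1%:R^-1.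
      exact: (cvg_harmonic hP).
    by apply: filterS => k /=; apply; rewrite invr_neq0.
  have := cvg_comp _ _ h0 dw; apply: cvg_trans; apply: near_eq_cvg; near=> k.
  by rewrite /q /= invrK [_ + x]addrC.
have e0 : (fun k => \int[mu]_x q k x) = fun=> 0.
  apply/funext => k; rewrite (Bc_intZ _ measurableT (bq k)) (Bc_intB measurableT (Bc_shift _ bw) bw).
  by rewrite Bc_intT_shift// subrr mulr0.
by rewrite e0 in h; rewrite -(cvg_lim _ h)// lim_cst.
Unshelve. all: by end_near. Qed.

Lemma int_divergence_eq0 (xi : 'rV[R]_n -> 'rV[R]_n) : C1c xi ->
  \int[mu]_x divergence xi x = 0.
Proof.
move=> /C1cP[xi1 [M hM]].
have h i : C1_on setT (fun x => xi x 0 i) := C1_on_coord i openT xi1.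
have hM' i x : M < enorm x -> xi x 0 i = 0 by move=> /hM ->; rewrite mxE.
have -> : divergence xi = fun x => \sum_(i < n) 'D_(delta_mx 0 i) (fun y => xi y 0 i) x.
  by apply/funext => x; rewrite divergenceE//; apply: (xi1 x _).1.
have bD i : Bc ('D_(delta_mx 0 i) (fun y => xi y 0 i)).
  apply: Cc_Bc; split; first by move=> x; apply: (h i x _).2.
  by exists M => x; apply: Cc_derive; exact: hM'.
suff h' : forall r : seq 'I_n, Bc (fun x => \sum_(i <- r) 'D_(delta_mx 0 i) (fun y => xi y 0 i) x) /\
   \int[mu]_x (\sum_(i <- r) 'D_(delta_mx 0 i) (fun y => xi y 0 i) x) = 0.
  exact: (h' _).2.
elim=> [|i r [ih1 ih2]].
  rewrite (_ : (fun x => _) = fun=> 0); last by apply/funext => x; rewrite big_nil.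
  split; last by rewrite Rintegral_cst// mul0r.
  by split; [exact: measurable_cst|exists 0, 0 => x; rewrite normr0].
rewrite (_ : (fun x => _) = fun x => 'D_(delta_mx 0 i) (fun y => xi y 0 i) x +
   \sum_(i <- r) 'D_(delta_mx 0 i) (fun y => xi y 0 i) x); last first.
  by apply/funext => x; rewrite big_cons.
split; first exact: BcD.
rewrite Bc_intD// ih2 addr0; exact: (int_derive_eq0 _ (h i) (hM' i)).
Qed.

End translation_integral.

(** * Convolution with an indicator *)

Section convolution.
Context {R : realType} {n : nat}.
Implicit Types (x y z v : 'rV[R]_n) (A D : set 'rV[R]_n) (f g : 'rV[R]_n -> R).
Local Notation T := (lebesgue_rV R n).
Local Notation mu := (@lebesgue R n).

Lemma Bc_Fubini (F : T * T -> R) (C M : R) : measurable_fun setT F ->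
  (forall p, `|F p| <= C) ->
  (forall x y, M < enorm x \/ M < enorm y -> F (x, y) = 0) ->
  [/\ Bc (fun x => \int[mu]_y F (x, y)), Bc (fun y => \int[mu]_x F (x, y)) &
    \int[mu]_x (\int[mu]_y F (x, y)) = \int[mu]_y (\int[mu]_x F (x, y))].
Proof.
move=> mF FC FM.
pose K : set T := [set x | enorm x <= M].
have mK : measurable K by exact: measurable_cball.
have Koo : (mu K < +oo)%E by exact: (@lebesgue_bounded_lty _ _ _ M).
have iF : (mu \x mu)%E.-integrable setT (EFin \o F).
  have -> : EFin \o F = (EFin \o F) \_ (K `*` K).
    apply/funext => -[x y]; rewrite patchE; case: ifPn => //; rewrite notin_setE/= => /not_andP h.
    rewrite FM//; case: h => /negP; rewrite -ltNge; [by left|by right].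
  have mKK : measurable (K `*` K) by exact: measurableX.
  apply/(integrable_mkcond _ mKK).
  apply: measurable_bounded_integrable => //.
  - have := @product_measure1E _ _ T T R mu mu K K mK mK => /= h.
    by rewrite [ltLHS]h lte_mul_pinfty// ge0_fin_numE.
  - exact: measurable_funS mF.
  - exists C; split; first exact: num_real.
    by move=> y Cy p _ /=; rewrite (le_trans (FC p))// ltW.
have bx x : Bc (fun y => F (x, y)).
  split; first by apply: (measurableT_comp mF); exact: pair1_measurable.
  by exists C, M => y; split; [exact: FC|move=> My; apply: FM; right].
have by_ y : Bc (fun x => F (x, y)).
  split; first by apply: (measurableT_comp mF); exact: pair2_measurable.
  by exists C, M => x; split; [exact: FC|move=> My; apply: FM; left].
have bK : Bc (fun x => C * \1_K x).
  split.
    by apply: measurable_funM; [exact: measurable_cst|exact: measurable_indic].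
  exists `|C|, M => x; split.
    by rewrite normrM indicE; case: (_ \in _); rewrite ?normr1 ?mulr1// normr0 mulr0.
  by move=> Mx; rewrite indicE memNset ?mulr0// /K/= leNgt Mx.
have bnd f : Bc f -> (forall x, `|f x| <= C * \1_K x) -> `|\int[mu]_x f x| <= \int[mu]_x (C * \1_K x).
  move=> bf fC; apply: le_trans (le_norm_Bc_int measurableT bf) _.
  exact: (le_Bc_int measurableT (Bc_norm bf) bK).
have FK1 x y : `|F (x, y)| <= C * \1_K y.
  have [yM|yM] := leP (enorm y) M; first by rewrite indicE mem_set// mulr1.
  by rewrite FM ?normr0 ?indicE ?memNset ?mulr0//; [rewrite /K/= leNgt yM|right].
have FK2 x y : `|F (x, y)| <= C * \1_K x.
  have [xM|xM] := leP (enorm x) M; first by rewrite indicE mem_set// mulr1.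
  by rewrite FM ?normr0 ?indicE ?memNset ?mulr0//; [rewrite /K/= leNgt xM|left].
split.
- split; first exact: (measurableT_comp (@fine_measurable R setT measurableT) (measurable_fubini_F iF)).
  exists (\int[mu]_x (C * \1_K x)), M => x; split; first by apply: bnd => // y; exact: FK1.
  move=> Mx; rewrite (@eq_Rintegral _ _ _ mu _ (fun=> 0)) ?Rintegral_cst ?mul0r// => y _.
  by apply: FM; left.
- split; first exact: (measurableT_comp (@fine_measurable R setT measurableT) (measurable_fubini_G iF)).
  exists (\int[mu]_x (C * \1_K x)), M => y; split; first by apply: bnd => // x; exact: FK2.
  move=> My; rewrite (@eq_Rintegral _ _ _ mu _ (fun=> 0)) ?Rintegral_cst ?mul0r// => x _.
  by apply: FM; right.
have := Fubini iF; rewrite /Rintegral => h; congr fine.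
transitivity (\int[mu]_x \int[mu]_y (EFin \o F) (x, y))%E.
  by apply: eq_integral => x _; rewrite fineK// (integrable_fin_num measurableT (Bc_integrable measurableT (bx x))).
rewrite h; apply: eq_integral => y _.
by rewrite fineK// (integrable_fin_num measurableT (Bc_integrable measurableT (by_ y))).
Qed.

Lemma measurable_prod_coordB i :
  measurable_fun setT (fun p : T * T => ((p.1 : 'rV[R]_n) - p.2) 0 i).
Proof.
rewrite (_ : (fun p => _) = fun p : T * T => (p.1 : 'rV[R]_n) 0 i - (p.2 : 'rV[R]_n) 0 i); last first.
  by apply/funext => p; rewrite !mxE.
apply: measurable_funB; apply: (measurableT_comp (measurable_coord i)).
  exact: measurable_fst.
exact: measurable_snd.
Qed.

Lemma measurable_prod_coordD i :
  measurable_fun setT (fun p : T * T => ((p.1 : 'rV[R]_n) + p.2) 0 i).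
Proof.
rewrite (_ : (fun p => _) = fun p : T * T => (p.1 : 'rV[R]_n) 0 i + (p.2 : 'rV[R]_n) 0 i); last first.
  by apply/funext => p; rewrite !mxE.
apply: measurable_funD; apply: (measurableT_comp (measurable_coord i)).
  exact: measurable_fst.
exact: measurable_snd.
Qed.

Definition conv (rho : 'rV[R]_n -> R) A x : R := \int[mu]_y (\1_A y * rho (x - y)).

Lemma Cc_reflect f x : Cc f -> Cc (fun y => f (x - y)).
Proof.
move=> [cf [M hM]]; split.
  move=> y; apply: (@continuous_comp _ _ _ (fun y => x - y) f); last exact: cf.
  by apply: (@continuousB R 'rV[R]_n _ (cst x) id); [exact: cst_continuous|by move=> B; exact].
exists (M + enorm x) => y My; apply: hM.
move: My; rewrite -ltrBrDr => /lt_le_trans; apply.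
by rewrite enormB (le_trans _ (enorm_lipschitz _ _))// ler_norm.
Qed.

Lemma Bc_conv_integrand rho A x : measurable (A : set T) -> Cc rho ->
  Bc (fun y => \1_A y * rho (x - y)).
Proof. by move=> mA rhoc; exact: (Bc_indic mA (Cc_Bc (Cc_reflect x rhoc))). Qed.

Lemma conv_ge0 rho A x : (forall x, 0 <= rho x) -> 0 <= conv rho A x.
Proof.
move=> rho0; apply: Rintegral_ge0 => y _; by rewrite mulr_ge0.
Qed.

End convolution.

(** * Regularity of mollified indicators *)

Section bump_kernel.
Context {R : realType} {n : nat}.
Implicit Types (a h x y z v : 'rV[R]_n) (A D : set 'rV[R]_n) (f g : 'rV[R]_n -> R).
Local Notation T := (lebesgue_rV R n).
Local Notation mu := (@lebesgue R n).

Lemma Bc_sum I (r : seq I) (f : I -> 'rV[R]_n -> R) : (forall i, Bc (f i)) ->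
  Bc (fun x => \sum_(i <- r) f i x) /\
  \int[mu]_x (\sum_(i <- r) f i x) = \sum_(i <- r) \int[mu]_x f i x.
Proof.
move=> bf; elim: r => [|i r [ih1 ih2]].
  rewrite (_ : (fun x => _) = fun=> 0); last by apply/funext => x; rewrite big_nil.
  split; last by rewrite big_nil Rintegral_cst// mul0r.
  by split; [exact: measurable_cst|exists 0, 0 => x; rewrite normr0].
rewrite (_ : (fun x => _) = fun x => f i x + \sum_(i <- r) f i x); last first.
  by apply/funext => x; rewrite big_cons.
split; first exact: (BcD (bf i) ih1).
by rewrite (Bc_intD measurableT (bf i) ih1) ih2 big_cons.
Qed.

Lemma BcZ c f : Bc f -> Bc (fun x => c * f x).
Proof.
move=> [mf [C [M hC]]]; split; first exact: (measurable_funM (measurable_cst c) mf).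
exists (`|c| * C), M => x; split; first by rewrite normrM ler_wpM2l//; exact: (hC x).1.
by move=> /(hC x).2 ->; rewrite mulr0.
Qed.

Let posB (s t : R) : `|Num.max 0 s - Num.max 0 t| <= `|s - t|.
Proof.
rewrite /Num.max; do ![case: ifPn]; rewrite -?leNgt => h1 h2; rewrite ler_norml;
  apply/andP; split; case: (ger0P (s - t)) => h3; lra.
Qed.

Let N : R := n.+1%:R.
Let N1 : 1 <= N. Proof. by rewrite ler1n. Qed.
Let N0 : 0 <= N. Proof. exact: le_trans N1. Qed.

Let lipschitz_continuous_at f x (K : R) :
  (forall h, `|h| <= 1 -> `|f (h + x) - f x| <= K * `|h|) -> {for x, continuous f}.
Proof.
move=> fK; apply/(@cvgrPdist_lt R R _ (nbhs x) (nbhs_filter x)) => e e0.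
apply/nbhs_ballP; exists (Num.min 1 (e / (`|K| + 1))) => /=.
  by rewrite lt_min ltr01 divr_gt0// ltr_wpDl.
move=> y; rewrite -ball_normE/= lt_min distrC => /andP[y1 ye].
rewrite distrC; have := fK (y - x) (ltW y1); rewrite subrK => /le_lt_trans; apply.
apply: (@le_lt_trans _ _ ((`|K| + 1) * `|y - x|)).
  by rewrite ler_wpM2r// (le_trans (ler_norm K))// lerDl.
by rewrite mulrC -ltr_pdivlMr// ltr_wpDl.
Qed.

(** The gradient at [a] of the bump centered at 0, in closed form. *)
Definition bump_grad (r : R) a : 'rV[R]_n := (- 4 * Num.max 0 (r ^+ 2 - dotp a a)) *: a.

Let bump_incr (r : R) a h : `|h| <= 1 -> enorm a <= r + N ->
  `|(r ^+ 2 - dotp (h + a) (h + a)) - (r ^+ 2 - dotp a a)| <= (2 * (r + N) + N) * enorm h.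
Proof.
move=> h1 aM; have hN : enorm h <= N.
  by rewrite (le_trans (enorm_le_norm h))// ler_piMr.
have -> : (r ^+ 2 - dotp (h + a) (h + a)) - (r ^+ 2 - dotp a a) =
    - (2 * dotp a h + dotp h h).
  by rewrite dotpDr !dotpDl (dotpC h a); ring.
rewrite normrN (le_trans (ler_normD _ _))// -enorm_sqr normrX (ger0_norm (enorm_ge0 h)).
rewrite normrM (ger0_norm (ler0n _ 2)) [leRHS]mulrDl lerD//.
  rewrite -mulrA ler_wpM2l// (le_trans (cauchy_schwarz_norm a h))//.
  by rewrite ler_wpM2r ?enorm_ge0.
by rewrite expr2 ler_wpM2r ?enorm_ge0.
Qed.

Let bump_out (r : R) a h : 0 <= r -> `|h| <= 1 -> r + N < enorm a ->
  [/\ ebump 0 r a = 0, ebump 0 r (h + a) = 0, bump_grad r a = 0 & bump_grad r (h + a) = 0].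
Proof.
move=> r0 h1 aM; have hN : enorm h <= N.
  by rewrite (le_trans (enorm_le_norm h))// ler_piMr.
have ra : r <= enorm a by rewrite (le_trans _ (ltW aM))// lerDl.
have rah : r <= enorm (h + a).
  rewrite -(lerD2r N) (le_trans (ltW aM))//.
  rewrite -{1}(addKr h a) (le_trans (enormD _ _))// enormN addrC lerD2l//.
have z b : r <= enorm b -> bump_grad r b = 0.
  move=> rb; rewrite /bump_grad (max_idPl _) ?mulr0 ?scale0r//.
  by rewrite subr_le0 -enorm_sqr ler_pXn2r// nnegrE// enorm_ge0.
by split; [apply: bump_eq0; rewrite ?subr0|apply: bump_eq0; rewrite ?subr0|exact: z|exact: z].
Qed.

(** Second order Taylor expansion with constants that do not depend on the
    point: off a ball everything vanishes, and on it the bump is the square of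
    the positive part of a polynomial. *)
Lemma bump_taylor (r : R) : 0 <= r -> exists K : R,
  forall a h, `|h| <= 1 ->
    `|ebump 0 r (h + a) - ebump 0 r a - dotp (bump_grad r a) h| <= K * `|h| ^+ 2 /\
    forall i, `|bump_grad r (h + a) 0 i - bump_grad r a 0 i| <= K * `|h|.
Proof.
move=> r0; pose M := r + N; have M0 : 0 <= M by rewrite addr_ge0.
pose K1 := ((2 * M + N) ^+ 2 + 2 * r ^+ 2) * N ^+ 2.
pose K2 := 4 * ((2 * M + N) * (M + N) + r ^+ 2) * N.
have MN0 : 0 <= 2 * M + N by rewrite addr_ge0// mulr_ge0.
have MN1 : 0 <= M + N by rewrite addr_ge0.
have K10 : 0 <= K1.
  by apply: mulr_ge0; [apply: addr_ge0; [|apply: mulr_ge0 => //]|]; exact: sqr_ge0.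
have K20 : 0 <= K2.
  apply: mulr_ge0 => //; apply: mulr_ge0 => //; apply: addr_ge0; last exact: sqr_ge0.
  exact: mulr_ge0.
exists (K1 + K2) => a h h1.
have [aM|aM] := leP (enorm a) M; last first.
  have [-> -> -> ->] := bump_out r0 h1 aM.
  rewrite dotpC dotp0r !subrr normr0; split; first by rewrite mulr_ge0 ?sqr_ge0 ?addr_ge0.
  by move=> i; rewrite subrr normr0 mulr_ge0 ?addr_ge0.
have eN : enorm h <= N * `|h| by exact: enorm_le_norm.
have hN : enorm h <= N by rewrite (le_trans eN)// ler_piMr.
have e0 := enorm_ge0 h.
set s := r ^+ 2 - dotp a a; set s' := r ^+ 2 - dotp (h + a) (h + a).
have st : `|s' - s| <= (2 * M + N) * enorm h by exact: bump_incr.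
have m0 : 0 <= Num.max 0 s by rewrite le_max lexx.
have mr : Num.max 0 s <= r ^+ 2.
  by rewrite ge_max sqr_ge0/= gerBl dotp_ge0.
split.
  have -> : ebump 0 r (h + a) - ebump 0 r a - dotp (bump_grad r a) h =
     (sqpos (s' - s + s) - sqpos s - 2 * Num.max 0 s * (s' - s)) -
     2 * Num.max 0 s * enorm h ^+ 2.
    rewrite subrK /ebump !subr0 -/s -/s' /bump_grad -/s dotpZl enorm_sqr.
    have -> : s' - s = - (2 * dotp a h + dotp h h).
      by rewrite /s /s' dotpDr !dotpDl (dotpC h a); ring.
    by ring.
  apply: le_trans (ler_normB _ _) _.
  have t1 := sqpos_taylor s (s' - s).
  have t2 : (s' - s) ^+ 2 <= (2 * M + N) ^+ 2 * enorm h ^+ 2.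
    rewrite -exprMn -(real_normK (num_real (s' - s))) ler_pXn2r// nnegrE//.
    by rewrite (le_trans _ st).
  have t3 : `|2 * Num.max 0 s * enorm h ^+ 2| <= 2 * r ^+ 2 * enorm h ^+ 2.
    by rewrite ger0_norm ?mulr_ge0 ?sqr_ge0// ler_wpM2r ?sqr_ge0// ler_wpM2l.
  apply: (@le_trans _ _ (((2 * M + N) ^+ 2 + 2 * r ^+ 2) * enorm h ^+ 2)).
    by rewrite [leRHS]mulrDl lerD// (le_trans t1).
  apply: (@le_trans _ _ (K1 * `|h| ^+ 2)); last by rewrite ler_wpM2r ?sqr_ge0// lerDl.
  rewrite /K1 -mulrA ler_wpM2l ?addr_ge0 ?mulr_ge0 ?sqr_ge0// -exprMn.
  by rewrite ler_pXn2r// nnegrE ?mulr_ge0.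
move=> i; rewrite !mxE -/s -/s'.
have -> : -4 * Num.max 0 s' * (h 0 i + a 0 i) - -4 * Num.max 0 s * a 0 i =
    - 4 * ((Num.max 0 s' - Num.max 0 s) * (h 0 i + a 0 i) + Num.max 0 s * h 0 i) by ring.
rewrite normrM normrN (ger0_norm (ler0n _ 4)).
apply: (@le_trans _ _ (K2 * `|h|)); last by rewrite ler_wpM2r// lerDr.
rewrite /K2 -!mulrA ler_wpM2l//.
apply: (@le_trans _ _ (((2 * M + N) * (M + N) + r ^+ 2) * enorm h)); last first.
  by rewrite ler_wpM2l// ?addr_ge0 ?mulr_ge0 ?addr_ge0 ?mulr_ge0 ?sqr_ge0.
rewrite (le_trans (ler_normD _ _))// [leRHS]mulrDl !normrM lerD//.
  rewrite mulrAC; apply: ler_pM => //; first exact: le_trans (posB _ _) st.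
  rewrite (le_trans (ler_normD _ _))// addrC lerD//.
    by rewrite (le_trans (coord_le_enorm a i)).
  by rewrite (le_trans (coord_le_enorm h i)).
by rewrite (ger0_norm m0) ler_pM// coord_le_enorm.
Qed.

Let dotp_linear a : linear (dotp a : 'rV[R]_n -> R^o).
Proof. by move=> c x y; rewrite dotpDr dotpZr. Qed.

HB.instance Definition _ a := GRing.isLinear.Build R 'rV[R]_n R^o _ (dotp a) (dotp_linear a).

Lemma continuous_dotp a : continuous (dotp a).
Proof.
move=> x; rewrite (_ : dotp a = fun x => \sum_(i < n) a 0 i * x 0 i)//.
apply: continuous_sum => i.
by apply: (@continuousM _ _ (cst (a 0 i))); [exact: cst_continuous|exact: coord_continuous].
Qed.

(** Mollifying an indicator with a kernel of class C1 yields a function of class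
    C1: the second order Taylor bound of the kernel is integrated. *)
Lemma C1_on_conv_bump A (r : R) : measurable (A : set T) -> 0 <= r ->
  C1_on setT (conv (ebump 0 r) A).
Proof.
move=> mA r0; have [K hK] := bump_taylor r0.
have cb : Cc (ebump (0 : 'rV[R]_n) r).
  split; last by exists (r + enorm (0 : 'rV[R]_n)) => x; exact: bump_supp.
  by move=> x; exact: (C1_on_continuous (C1_on_bump 0 r)).
have cG i : Cc (fun a => bump_grad r a 0 i).
  split; last first.
    exists (r + N) => x rx; have h0 : `|0 : 'rV[R]_n| <= 1 by rewrite normr0.
    by have [_ _ -> _] := bump_out r0 h0 rx; rewrite mxE.
  move=> x; apply: (@lipschitz_continuous_at _ _ K) => h h1.
  by have [_ /(_ i)] := hK x h h1.
pose Gb x : 'rV[R]_n := \row_i conv (fun a => bump_grad r a 0 i) A x.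
pose chi x y : R := \1_[set y | enorm (x - y) <= r + N] y.
have bchi x : Bc (chi x).
  rewrite /chi; split.
    apply: measurable_indic; apply: lebesgue_measurable_closed.
    apply: (@preimage_closed _ _ (fun y => enorm (x - y)) [set t | t <= r + N]).
      move=> y _; apply: (@continuous_comp _ _ _ (fun y => x - y) (@enorm R n)); last exact: continuous_enorm.
      by apply: (@continuousB R 'rV[R]_n _ (cst x) id); [exact: cst_continuous|by move=> B; exact].
    exact: closed_le.
  exists 1, (r + N + enorm x) => y; split.
    by rewrite indicE; case: (_ \in _); rewrite ?normr1 ?normr0.
  move=> hy; rewrite indicE memNset//= => hy'.
  suff : enorm y <= r + N + enorm x by rewrite leNgt hy.
  rewrite -lerBlDr (le_trans (ler_norm _))// (le_trans (enorm_lipschitz _ _))//.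
  by rewrite enormB.
pose m x := \int[mu]_y chi x y.
have m0 x : 0 <= m x by apply: Rintegral_ge0 => y _; rewrite /chi indicE ler0n.
(* a pointwise bound that vanishes off the ball of radius r + N integrates *)
have key x (g : 'rV[R]_n -> R) (c : R) : Bc g -> 0 <= c ->
    (forall y, `|g y| <= c) -> (forall y, r + N < enorm (x - y) -> g y = 0) ->
    `|\int[mu]_y (\1_A y * g y)| <= c * m x.
  move=> bg c0 gc gz; have bAg := Bc_indic mA bg.
  rewrite (le_trans (le_norm_Bc_int measurableT bAg))// /m -(Bc_intZ _ measurableT (bchi x)).
  apply: (le_Bc_int measurableT (Bc_norm bAg) (BcZ c (bchi x))) => y _.
  rewrite normrM /chi !indicE.
  have [xy|xy] := leP (enorm (x - y)) (r + N).
    have -> : (y \in [set y0 | enorm (x - y0) <= r + N]) = true by exact: mem_set.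
    rewrite mulr1; apply: le_trans (gc y).
    by case: (_ \in _); rewrite ?normr1 ?normr0 ?mul1r// mul0r.
  by rewrite gz// normr0 mulr0 mulr_ge0.
have uE x h : `|h| <= 1 -> `|conv (ebump 0 r) A (h + x) - conv (ebump 0 r) A x - dotp (Gb x) h| <=
    `|K| * m x * `|h| ^+ 2.
  move=> h1.
  have b1 x' : Bc (fun y => ebump 0 r (x' - y)) := Cc_Bc (Cc_reflect x' cb).
  have b2 i : Bc (fun y => h 0 i * bump_grad r (x - y) 0 i).
    exact: (BcZ _ (Cc_Bc (Cc_reflect x (cG i)))).
  have [b3 _] := Bc_sum (index_enum 'I_n) b2.
  have -> : conv (ebump 0 r) A (h + x) - conv (ebump 0 r) A x - dotp (Gb x) h =
    \int[mu]_y (\1_A y * (ebump 0 r (h + x - y) - ebump 0 r (x - y) -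
                 \sum_(i < n) h 0 i * bump_grad r (x - y) 0 i)).
    have -> : dotp (Gb x) h = \int[mu]_y (\1_A y * \sum_(i < n) h 0 i * bump_grad r (x - y) 0 i).
      under [RHS]eq_Rintegral do rewrite mulr_sumr.
      rewrite (Bc_sum _ (fun i => Bc_indic mA (b2 i))).2.
      apply: eq_bigr => i _; rewrite mxE mulrC /conv -(Bc_intZ _ measurableT); last first.
        exact: (Bc_conv_integrand _ mA (cG i)).
      by apply: eq_Rintegral => y _; rewrite mulrCA.
    rewrite /conv -(Bc_intB measurableT (Bc_indic mA (b1 _)) (Bc_indic mA (b1 _))).
    rewrite -(Bc_intB measurableT (BcB (Bc_indic mA (b1 _)) (Bc_indic mA (b1 _))) (Bc_indic mA b3)).
    by apply: eq_Rintegral => y _; rewrite !mulrBr.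
  rewrite mulrAC; apply: key.
  - exact: (BcB (BcB (b1 _) (b1 _)) b3).
  - by rewrite mulr_ge0 ?sqr_ge0.
  - move=> y; have [+ _] := hK (x - y) h h1; rewrite addrA => hy.
    rewrite (_ : \sum_(i < n) _ = dotp (bump_grad r (x - y)) h); last first.
      by apply: eq_bigr => i _; rewrite mulrC.
    by rewrite (le_trans hy)// ler_wpM2r ?sqr_ge0// ler_norm.
  - move=> y xy; have [z1 z2 z3 _] := bump_out r0 h1 xy.
    rewrite -(addrA h) z1 z2 z3 subrr sub0r big1 ?oppr0// => i _.
    by rewrite mxE mulr0.
have dE x : differentiable (conv (ebump 0 r) A) x /\ forall v, 'D_v (conv (ebump 0 r) A) x = dotp (Gb x) v.
  have [|h|d1 d2] := @differentiable_quadratic R 'rV[R]_n (conv (ebump 0 r) A) (dotp (Gb x) : {linear 'rV[R]_n -> R^o}) x (`|K| * m x).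
  - exact: continuous_dotp.
  - exact: uE.
  by split => // v; rewrite deriveE// d2.
apply: (@C1_onI _ _ _ _ _ (fun v x => dotp (Gb x) v)).
- exact: openT.
- by move=> x _; exact: (dE x).1.
- by move=> x v _; exact: (dE x).2.
move=> x v _; apply: continuous_sum => i.
apply: (@continuousM _ _ (fun x => Gb x 0 i)); last exact: cst_continuous.
rewrite (_ : (fun x => _) = conv (fun a => bump_grad r a 0 i) A); last by apply/funext => y; rewrite mxE.
apply: (@lipschitz_continuous_at _ _ (`|K| * m x)) => h h1.
have b1 x' : Bc (fun y => bump_grad r (x' - y) 0 i) := Cc_Bc (Cc_reflect x' (cG i)).
have -> : conv (fun a => bump_grad r a 0 i) A (h + x) - conv (fun a => bump_grad r a 0 i) A x =
   \int[mu]_z (\1_A z * (bump_grad r (h + x - z) 0 i - bump_grad r (x - z) 0 i)).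
  rewrite /conv -(Bc_intB measurableT (Bc_indic mA (b1 _)) (Bc_indic mA (b1 _))).
  by apply: eq_Rintegral => z _; rewrite mulrBr.
rewrite mulrAC; apply: key.
- exact: (BcB (b1 _) (b1 _)).
- by rewrite mulr_ge0.
- move=> z; have [_ /(_ i)] := hK (x - z) h h1; rewrite addrA => h'.
  by rewrite (le_trans h')// ler_wpM2r// ler_norm.
- move=> z xz; have [_ _ z3 z4] := bump_out r0 h1 xz.
  by rewrite z3; move: z4; rewrite addrA => ->; rewrite mxE subrr.
Qed.

End bump_kernel.

(** * Adjoint of the convolution and density of continuous functions *)

Section mollification.
Context {R : realType} {n : nat}.
Implicit Types (a h x y z v : 'rV[R]_n) (A B D : set 'rV[R]_n) (f g : 'rV[R]_n -> R).
Local Notation T := (lebesgue_rV R n).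
Local Notation mu := (@lebesgue R n).

Let measurable_comp_fst f : continuous f -> measurable_fun setT (fun p : T * T => f p.1).
Proof. by move=> cf; apply: (measurableT_comp (measurable_continuous cf)); exact: measurable_fst. Qed.

Let measurable_comp_snd f : continuous f -> measurable_fun setT (fun p : T * T => f p.2).
Proof. by move=> cf; apply: (measurableT_comp (measurable_continuous cf)); exact: measurable_snd. Qed.

Lemma measurable_indic_fst A : measurable (A : set T) ->
  measurable_fun setT (fun p : T * T => \1_A p.1 : R).
Proof.
move=> mA; apply: (@measurableT_comp _ _ _ _ _ _ (\1_A : T -> R)); last exact: measurable_fst.
exact: measurable_indic.
Qed.

Lemma measurable_indic_snd A : measurable (A : set T) ->
  measurable_fun setT (fun p : T * T => \1_A p.2 : R).
Proof.
move=> mA; apply: (@measurableT_comp _ _ _ _ _ _ (\1_A : T -> R)); last exact: measurable_snd.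
exact: measurable_indic.
Qed.

Lemma norm_indic_le1 A x : `|\1_A x : R| <= 1.
Proof. by rewrite indicE; case: (_ \in _); rewrite ?normr1 ?normr0. Qed.

Lemma Cc_shift f v : Cc f -> Cc (fun x => f (x + v)).
Proof.
move=> [cf [M hM]]; split.
  move=> x; apply: (@continuous_comp _ _ _ (fun x => x + v) f); last exact: cf.
  by apply: (@continuousD R 'rV[R]_n _ id (cst v)); [by move=> B; exact|exact: cst_continuous].
exists (M + enorm v) => x Mx; apply: hM.
move: Mx; rewrite -ltrBrDr => /lt_le_trans; apply.
by rewrite lerBlDr -{1}(addrK v x) (le_trans (enormD _ _))// enormN.
Qed.

(** The adjoint of convolution with a kernel, after the change of variable
    that moves the kernel away from the set. *)
Lemma conv_adjoint rho A f : measurable (A : set T) -> Cc rho -> Cc f ->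
  \int[mu]_x (conv rho A x * f x) =
  \int[mu]_y (\1_A y * \int[mu]_z (rho z * f (z + y))).
Proof.
move=> mA rhoc fc.
have [C1 C10 h1] := Cc_bounded rhoc; have [C2 C20 h2] := Cc_bounded fc.
have [crho [M1 M1h]] := rhoc; have [cf [M2 M2h]] := fc.
pose F (p : T * T) : R := f p.1 * (\1_A p.2 * rho ((p.1 : 'rV[R]_n) - p.2)).
have mF : measurable_fun setT F.
  apply: measurable_funM; first exact: measurable_comp_fst.
  apply: measurable_funM; first exact: measurable_indic_snd.
  exact: (measurable_continuous_comp crho measurable_prod_coordB).
have FC p : `|F p| <= C2 * (1 * C1).
  rewrite /F normrM; apply: ler_pM; [exact: normr_ge0|exact: normr_ge0|exact: h2|].
  by rewrite normrM; apply: ler_pM; [exact: normr_ge0|exact: normr_ge0|exact: norm_indic_le1|exact: h1].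
have FM x y : Num.max M2 (M1 + M2) < enorm x \/ Num.max M2 (M1 + M2) < enorm y -> F (x, y) = 0.
  move=> hxy; rewrite /F /=; have [xM|xM] := ltP M2 (enorm x); first by rewrite M2h ?mul0r.
  rewrite [rho _]M1h ?mulr0 ?mulr0 //; case: hxy; rewrite gt_max => /andP[h3 h4].
    by rewrite ltNge xM in h3.
  rewrite -(ltrD2r (enorm x)); apply: (@le_lt_trans _ _ (M1 + M2)); first by rewrite lerD2l.
  apply: (lt_le_trans h4).
  by rewrite -[in leLHS](subKr x y) (le_trans (enormD _ _))// enormN addrC.
transitivity (\int[mu]_x \int[mu]_y F (x, y)).
  apply: eq_Rintegral => x _.
  transitivity (\int[mu]_y (f x * (\1_A y * rho (x - y)))); last by [].
  by rewrite (Bc_intZ _ measurableT (Bc_conv_integrand x mA rhoc)) mulrC.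
have [_ _ ->] := Bc_Fubini mF FC FM; apply: eq_Rintegral => y _.
have bg : Bc (fun x => rho (x - y) * f x).
  by apply: Cc_Bc; apply: CcM fc => x; have [/(_ x)] := Cc_shift (- y) rhoc.
transitivity (\int[mu]_x (\1_A y * (rho (x - y) * f x))).
  by apply: eq_Rintegral => x _; rewrite /F/= mulrC -mulrA.
rewrite (Bc_intZ _ measurableT bg); congr (_ * _).
rewrite -(Bc_intT_shift y bg); apply: eq_Rintegral => z _.
by rewrite addrK.
Qed.

Lemma conv_adjoint_swap rho A f : measurable (A : set T) -> Cc rho -> Cc f ->
  [/\ Bc (fun y => \1_A y * \int[mu]_z (rho z * f (z + y))),
     Bc (fun z => rho z * \int[mu]_(y in A) f (y + z)) &
  \int[mu]_y (\1_A y * \int[mu]_z (rho z * f (z + y))) =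
  \int[mu]_z (rho z * \int[mu]_(y in A) f (y + z))].
Proof.
move=> mA rhoc fc.
have [C1 C10 h1] := Cc_bounded rhoc; have [C2 C20 h2] := Cc_bounded fc.
have [crho [M1 M1h]] := rhoc; have [cf [M2 M2h]] := fc.
pose F (p : T * T) : R := \1_A p.1 * (rho p.2 * f ((p.1 : 'rV[R]_n) + p.2)).
have mF : measurable_fun setT F.
  apply: measurable_funM; first exact: measurable_indic_fst.
  apply: measurable_funM; first exact: measurable_comp_snd.
  exact: (measurable_continuous_comp cf measurable_prod_coordD).
have FC p : `|F p| <= 1 * (C1 * C2).
  rewrite /F normrM; apply: ler_pM; [exact: normr_ge0|exact: normr_ge0|exact: norm_indic_le1|].
  by rewrite normrM; apply: ler_pM; [exact: normr_ge0|exact: normr_ge0|exact: h1|exact: h2].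
have FM y z : Num.max M1 (M1 + M2) < enorm y \/ Num.max M1 (M1 + M2) < enorm z -> F (y, z) = 0.
  move=> hyz; rewrite /F /=; have [zM|zM] := ltP M1 (enorm z); first by rewrite M1h ?mul0r ?mulr0.
  rewrite [f _]M2h ?mulr0//; case: hyz; rewrite gt_max => /andP[h3 h4]; last first.
    by rewrite ltNge zM in h3.
  rewrite -(ltrD2r (enorm z)); apply: (@le_lt_trans _ _ (M1 + M2)).
    by rewrite addrC lerD2r.
  apply: (lt_le_trans h4).
  by rewrite -{1}(addrK z y) (le_trans (enormD _ _))// enormN.
have e1 : (fun y => \1_A y * \int[mu]_z (rho z * f (z + y))) = fun y => \int[mu]_z F (y, z).
  apply/funext => y; rewrite -(Bc_intZ _ measurableT).
    by apply: eq_Rintegral => z _; rewrite (addrC z).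
  by apply: Cc_Bc; apply: CcM (Cc_shift y fc).
have e2 : (fun z => rho z * \int[mu]_(y in A) f (y + z)) = fun z => \int[mu]_y F (y, z).
  apply/funext => z.
  have bg : Bc (fun y => \1_A y * f (y + z)) := Bc_indic mA (Cc_Bc (Cc_shift z fc)).
  transitivity (\int[mu]_y (rho z * (\1_A y * f (y + z)))).
    by rewrite (Bc_intZ _ measurableT bg) -Bc_int_indic setTI.
  by apply: eq_Rintegral => y _; rewrite /F /= mulrCA.
by rewrite e1 e2; exact: (Bc_Fubini mF FC FM).
Qed.

(** The indicator of a measurable set is approximated in [L1] of a ball by
    continuous functions: cover by boxes, keep finitely many of them, and
    approximate the indicator of that closed set pointwise. *)
Lemma indic_dense A (M e : R) : measurable (A : set T) -> 0 < e ->
  exists w : 'rV[R]_n -> R, [/\ continuous w, forall x, 0 <= w x <= 1 &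
    \int[mu]_(x in [set x | enorm x <= M]) `|\1_A x - w x| <= e].
Proof.
move=> mA e0; pose K := [set x : 'rV[R]_n | enorm x <= M].
have mK : measurable (K : set T) := measurable_cball M.
pose A' := A `&` K.
have mA' : measurable (A' : set T) by exact: measurableI.
have A'oo : (mu A' < +oo)%E by apply: (@lebesgue_bounded_lty _ _ _ M) => x [].
have A'fin : mu A' \is a fin_num by rewrite ge0_fin_numE// lebesgue_outer_ge0.
have e3 : 0 < e / 3 by rewrite divr_gt0.
(* An almost optimal covering by boxes; below, [U] is its union and [S N] the
   union of its first [N] boxes. *)
have [_ [F A'F <-] hF] := lb_ereal_inf_adherent e3 A'fin.
rewrite -/(lebesgue_outer A') in hF.
have Fge0 k : (0 <= box_vol (F k))%E := box_vol_ge0 (F k).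
pose U := \bigcup_k box (F k).
have mbox k : measurable (box (F k) : set T) by exact: (lebesgue_measurable_closed (@closed_coord_box R n (F k))).
pose S N := \big[setU/set0]_(k < N) box (F k).
have mS N : measurable (S N : set T) by apply: bigsetU_measurable => k _; exact: mbox.
have muU : (mu U <= mu A' + (e / 3)%:E)%E.
  apply: le_trans (ltW hF); apply: ereal_inf_lbound; by exists F.
have [N hN] : exists N, (\sum_(N <= k <oo) box_vol (F k) <= (e / 3)%:E)%E.
  have Foo : (\sum_(0 <= k <oo) box_vol (F k) < +oo)%E.
    by rewrite (lt_le_trans hF)// leey.
  have /fine_cvgP[h1 h2] := nneseries_tail_cvg Foo (fun k _ => Fge0 k).
  have h3 : \forall N \near \oo, fine (\sum_(N <= k <oo) box_vol (F k))%E < e / 3.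
    exact: (cvgr_lt _ h2).
  near \oo => N; exists N; rewrite -[leLHS]fineK; last by near: N.
  by rewrite lee_fin ltW//; near: N.
(* [p1 k] vanishes exactly on the [k]-th box, so that the product [p] of the
   first [N] of them vanishes exactly on [S N]. *)
pose p1 k x : R := if F k is Some ab then
  \sum_(i < n) (Num.max 0 (ab.1 0 i - x 0 i) + Num.max 0 (x 0 i - ab.2 0 i)) else 1.
have p1_ge0 k x : 0 <= p1 k x.
  rewrite /p1; case: (F k) => [ab|//]; apply: sumr_ge0 => i _.
  by rewrite addr_ge0// le_max lexx.
have p1_eq0 k x : (p1 k x == 0) <-> box (F k) x.
  rewrite /p1 /box; case: (F k) => [ab|]; last by rewrite oner_eq0.
  have pos (s : R) : 0 <= Num.max 0 s by rewrite le_max lexx.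
  rewrite psumr_eq0; last by move=> i _; rewrite addr_ge0.
  split=> [/allP h i|h].
    have := h i (mem_index_enum _); rewrite paddr_eq0// => /andP[/eqP h1 /eqP h2].
    by rewrite -subr_le0 -[X in _ && X]subr_le0; apply/andP; split;
      [rewrite -h1|rewrite -h2]; rewrite le_max lexx orbT.
  apply/allP => i _ /=; have /andP[h1 h2] := h i.
  by rewrite !(max_idPl _) ?subr_le0// addr0.
have p1_cont k : continuous (p1 k).
  move=> x; rewrite /p1; case: (F k) => [ab|]; last exact: cst_continuous.
  apply: continuous_sum => i; apply: (@continuousD _ R).
    apply: (@continuous_comp _ _ _ (fun x : 'rV[R]_n => ab.1 0 i - x 0 i) (fun s : R => Num.max 0 s)); last exact: continuous_pos.
    by apply: (@continuousB R R _ (cst _)); [exact: cst_continuous|exact: coord_continuous].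
  apply: (@continuous_comp _ _ _ (fun x : 'rV[R]_n => x 0 i - ab.2 0 i) (fun s : R => Num.max 0 s)); last exact: continuous_pos.
  by apply: (@continuousB R R _ _ (cst _)); [exact: coord_continuous|exact: cst_continuous].
pose p x := \prod_(k < N) p1 k x.
have p_ge0 x : 0 <= p x by apply: prodr_ge0 => k _.
have SE : S N = \bigcup_(k < N) box (F k) := esym (bigcup_mkord N (fun k => box (F k))).
have p_eq0 x : (p x == 0) <-> S N x.
  rewrite SE /p; split => [/prodf_eq0[k _ /p1_eq0 h]|[k /= kN /p1_eq0 h]].
    by exists k => //=.
  by apply/prodf_eq0; exists (Ordinal kN).
have p_cont : continuous p.
  rewrite /p; elim: (N) => [|N' ih].
    by rewrite (_ : (fun x => _) = fun=> 1); [exact: cst_continuous|apply/funext => x; rewrite big_ord0].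
  rewrite (_ : (fun x => _) = fun x => \prod_(k < N') p1 k x * p1 N' x); last first.
    by apply/funext => x; rewrite big_ord_recr.
  by move=> x; apply: continuousM; [exact: ih|exact: p1_cont].
pose w m x : R := Num.max 0 (1 - m%:R * p x).
have w01 m x : 0 <= w m x <= 1.
  by rewrite /w le_max lexx/= ge_max ler01/= gerBl mulr_ge0.
have w_cont m : continuous (w m).
  move=> x; apply: (@continuous_comp _ _ _ (fun x => 1 - m%:R * p x) (fun s : R => Num.max 0 s)); last exact: continuous_pos.
  apply: (@continuousB R R _ (cst 1)); first exact: cst_continuous.
  by apply: (@continuousM _ _ (cst m%:R)); [exact: cst_continuous|exact: p_cont].
have w_cvg x : w m x @[m --> \oo] --> (\1_(S N) x : R).
  have [xS|xS] := pselect (S N x).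
    rewrite indicE mem_set// (_ : (fun m => _) = fun=> 1); first exact: cvg_cst.
    apply/funext => m; have /eqP := (p_eq0 x).2 xS.
    by rewrite /w => ->; rewrite mulr0 subr0; apply/max_idPr.
  have px : 0 < p x.
    by rewrite lt_def p_ge0 andbT; apply: contra_notN xS => /p_eq0.
  rewrite indicE memNset//; apply: cvg_near_cst; near=> m; apply/max_idPl.
  rewrite subr_le0 -ler_pdivrMr//; near: m; exact: nbhs_infty_ger.
pose G m x : R := \1_K x * `|\1_(S N) x - w m x|.
have mw m : measurable_fun setT (w m : T -> R) by exact: measurable_continuous.
have mi B : measurable (B : set T) -> measurable_fun setT (\1_B : T -> R).
  by move=> mB; exact: measurable_indic.
have mGw B m : measurable (B : set T) -> measurable_fun setT (fun x : T => `|\1_B x - w m x| : R).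
  by move=> mB; exact: (measurableT_comp (@normr_measurable R setT) (measurable_funB (mi _ mB) (mw m))).
have le1 B m x : `|\1_B x - w m x| <= 1.
  have := w01 m x; rewrite indicE; case: (_ \in _) => /andP[h1 h2]; rewrite ler_norml; apply/andP; split; rewrite /=; lra.
have bcG B m : measurable (B : set T) -> Bc (fun x => \1_K x * `|\1_B x - w m x|).
  move=> mB; split; first exact: (measurable_funM (mi _ mK) (mGw _ _ mB)).
  exists 1, M => x; split.
    rewrite normrM normr_id -[leRHS]mulr1; apply: ler_pM => //; exact: norm_indic_le1.
  by move=> Mx; rewrite [\1_K x]indicE memNset ?mul0r//= /K/= leNgt Mx.
have [m hm] : exists m, \int[mu]_x G m x <= e / 3.
  have [||||_ h] := @bounded_convergence R n setT G (fun=> 0) 1 M measurableT.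
  - by move=> m; exact: (bcG _ m (mS N)).1.
  - move=> m x; rewrite /G normrM normr_id -[leRHS]mulr1; apply: ler_pM => //; exact: norm_indic_le1.
  - by move=> m x Mx; rewrite /G [\1_K x]indicE memNset ?mul0r//= /K/= leNgt Mx.
  - move=> x; rewrite /G -[X in _ --> X](mulr0 (\1_K x)); apply: cvgM; first exact: cvg_cst.
    rewrite -[X in _ --> X](@normr0 _ R); apply: cvg_norm.
    by rewrite -(subrr (\1_(S N) x)); apply: cvgB; [exact: cvg_cst|exact: w_cvg].
  rewrite Rintegral_cst// mul0r in h.
  have [m _ /(_ m (leqnn m)) /ltW] := cvgr_lt _ h _ e3.
  by exists m.
exists (w m); split => //.
pose V := K `&` (U `\` A').
have mU : measurable (U : set T) by apply: bigcup_measurable => k _; exact: mbox.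
have mV : measurable (V : set T) by apply: measurableI => //; exact: measurableD.
have indE (B : set T) : measurable B -> (mu B < +oo)%E -> (forall x, B x -> K x) ->
    Bc (\1_B : 'rV[R]_n -> R) /\ \int[mu]_x (\1_B x : R) = fine (mu B).
  move=> mB Boo BK; split.
    split; first exact: mi.
    exists 1, M => x; split; first exact: norm_indic_le1.
    by move=> Mx; rewrite indicE memNset// => /BK; rewrite /K/= leNgt Mx.
  by rewrite /Rintegral integral_indic// setIT.
have mAS : measurable (A' `\` S N : set T) by exact: measurableD.
have Koo (B : set T) : (forall x, B x -> K x) -> (mu B < +oo)%E by exact: lebesgue_bounded_lty.
have ASK x : (A' `\` S N) x -> K x by move=> [[]].
have VK x : V x -> K x by move=> [].
have [b1 i1] := indE _ mAS (Koo _ ASK) ASK.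
have [b2 i2] := indE _ mV (Koo _ VK) VK.
have fin1 : (mu (A' `\` S N) <= (e / 3)%:E)%E.
  apply: le_trans hN; rewrite -(@nneseries_addn _ _ N)//.
  apply: ereal_inf_lbound; exists (fun k => F (k + N)%N) => //.
  move=> x [/A'F[k _ xk] xS]; exists (k - N)%N => //; rewrite subnK// leqNgt.
  by apply/negP => kN; apply: xS; rewrite SE; exists k.
have fin2 : (mu V <= (e / 3)%:E)%E.
  apply: (@le_trans _ _ (mu (U `\` A'))); first by apply: le_lebesgue_outer => x [].
  have A'U : A' `<=` U by [].
  have Uoo : (mu U < +oo)%E by rewrite (le_lt_trans muU)// -(fineK A'fin) ltry.
  rewrite measureD// (setIidr A'U) leeBlDr//.
  by rewrite addeC.
rewrite -[X in \int[mu]_(x in X) _](setTI K) Bc_int_indic.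
apply: (@le_trans _ _ (\int[mu]_x ((\1_(A' `\` S N) x + \1_V x) + G m x))).
  apply: (le_Bc_int measurableT (bcG A m mA) (BcD (BcD b1 b2) (bcG _ m (mS N)))) => x _.
  have [xK|xK] := pselect (K x); last first.
    rewrite [\1_K x]indicE (memNset xK) mul0r addr_ge0 ?addr_ge0// /G.
  rewrite /G !indicE (mem_set xK) !mul1r.
  have tri (a b c : R) : `|a - b| <= `|a - c| + `|c - b| by exact: ler_distD.
  apply: (le_trans (tri _ _ ((x \in S N)%:R))); rewrite lerD2r.
  have [xA|xA] := pselect (A x); have [xS|xS] := pselect (S N x).
  - by rewrite (mem_set xA) (mem_set xS) subrr normr0 addr_ge0.
  - have h : (A' `\` S N) x by [].
    by rewrite (mem_set xA) (memNset xS) (mem_set h) subr0 normr1 lerDl.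
  - have h : V x.
      split => //; split; last by move=> [].
      by move: xS; rewrite SE => -[k _ xk]; exists k.
    by rewrite (memNset xA) (mem_set xS) (mem_set h) sub0r normrN normr1 lerDr.
  - by rewrite (memNset xA) (memNset xS) subrr normr0 addr_ge0.
rewrite (Bc_intD measurableT (BcD b1 b2) (bcG _ m (mS N))) (Bc_intD measurableT b1 b2) i1 i2.
have -> : e = e / 3 + e / 3 + e / 3 by field.
apply: lerD => //; apply: lerD.
  by rewrite -lee_fin fineK// ge0_fin_numE ?lebesgue_outer_ge0//; exact: Koo.
by rewrite -lee_fin fineK// ge0_fin_numE ?lebesgue_outer_ge0//; exact: Koo.
Unshelve. all: by end_near. Qed.

End mollification.

(** * The perimeter *)

Section perimeter_basics.
Context {R : realType} {n : nat}.
Implicit Types (x y z v : 'rV[R]_n) (A B E F : set 'rV[R]_n) (xi : 'rV[R]_n -> 'rV[R]_n).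
Local Notation T := (lebesgue_rV R n).
Local Notation mu := (@lebesgue R n).

Lemma norm_convex (a : R) (u w : 'rV[R]_n) : 0 <= a <= 1 -> enorm u <= 1 -> enorm w <= 1 ->
  enorm ((1 - a) *: u + a *: w) <= 1.
Proof.
move=> /andP[a0 a1] u1 w1; rewrite (le_trans (enormD _ _))// !enormZ.
rewrite (ger0_norm a0) ger0_norm ?subr_ge0//.
rewrite [leRHS](_ : 1 = (1 - a) * 1 + a * 1); last by ring.
by rewrite lerD// ler_wpM2l// subr_ge0.
Qed.

Lemma gradM (u w : 'rV[R]_n -> R) x : differentiable u x -> differentiable w x ->
  grad (fun x => u x * w x) x = u x *: grad w x + w x *: grad u x.
Proof.
by move=> du dw; apply/rowP => i; rewrite !mxE (deriveM (diff_derivable du) (diff_derivable dw)).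
Qed.

Lemma Bc_intDDB f1 f2 f3 f4 : Bc f1 -> Bc f2 -> Bc f3 -> Bc f4 ->
  \int[mu]_x f1 x + \int[mu]_x f2 x + (\int[mu]_x f3 x - \int[mu]_x f4 x) =
  \int[mu]_x (f1 x + f2 x + (f3 x - f4 x)).
Proof.
move=> b1 b2 b3 b4; rewrite (Bc_intD measurableT (BcD b1 b2) (BcB b3 b4)).
by rewrite (Bc_intD measurableT b1 b2) (Bc_intB measurableT b3 b4).
Qed.

Definition admissible xi := C1c xi /\ forall x, enorm (xi x) <= 1.

Lemma Bc_div xi : C1c xi -> Bc (divergence xi).
Proof. by move=> xi1; apply: Cc_Bc; exact: Cc_divergence. Qed.

Lemma perimeter_ge E xi : measurable (E : set T) -> admissible xi ->
  ((\int[mu]_(x in E) divergence xi x)%:E <= perimeter E)%E.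
Proof.
move=> mE [xi1 xi2]; apply: ereal_sup_ubound; exists xi => //.
by rewrite (Bc_int_fin mE (Bc_div xi1)).
Qed.

Lemma perimeter_le E (c : \bar R) : measurable (E : set T) ->
  (forall xi, admissible xi -> ((\int[mu]_(x in E) divergence xi x)%:E <= c)%E) ->
  (perimeter E <= c)%E.
Proof.
move=> mE h; apply: ge_ereal_sup => _ [xi xia <-].
by rewrite (Bc_int_fin mE (Bc_div xia.1)); exact: h.
Qed.

Lemma admissible0 : admissible (fun=> 0).
Proof. by split; [exact: C1c0|move=> x; rewrite enorm0]. Qed.

Lemma perimeter_ge0 E : (0 <= perimeter E)%E.
Proof.
apply: ereal_sup_ubound; exists (fun=> 0); first exact: admissible0.
by rewrite integral0_eq// => x _; rewrite divergence_cst.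
Qed.

Lemma perimeter_fin_num E : (perimeter E < +oo)%E -> perimeter E \is a fin_num.
Proof. by move=> h; rewrite ge0_fin_numE// perimeter_ge0. Qed.

Lemma perimeter_shift E v : measurable (E : set T) -> perimeter (shift_set E v) = perimeter E.
Proof.
have le B w : measurable (B : set T) -> (perimeter (shift_set B w) <= perimeter B)%E.
  move=> mB; apply: perimeter_le; first exact: lebesgue_measurable_shift.
  move=> xi [xi1 xi2]; have [s1 s2] := C1c_shift (- w) xi1.
  have := perimeter_ge mB (conj s1 (fun x => xi2 (x - w))).
  rewrite (@eq_Rintegral _ _ _ mu _ (fun x => divergence xi (x - w))); last by move=> x _; rewrite s2.
  rewrite -(Bc_int_shift w mB (Bc_shift (- w) (Bc_div xi1))).
  by rewrite (@eq_Rintegral _ _ _ mu _ (divergence xi))// => x _; rewrite addrK.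
move=> mE; apply/eqP; rewrite eq_le le//= -{1}(shift_setK E v) le//.
exact: lebesgue_measurable_shift.
Qed.

Lemma perimeter_setT : perimeter [set: 'rV[R]_n] = 0%E.
Proof.
apply/eqP; rewrite eq_le perimeter_ge0 andbT; apply: (@perimeter_le setT 0%E measurableT) => xi [xi1 _].
by rewrite (int_divergence_eq0 xi1).
Qed.

Lemma int_setY A B f (C : R) : measurable (A : set T) -> measurable (B : set T) ->
  Bc f -> (forall x, `|f x| <= C) -> (mu (A `+` B) < +oo)%E ->
  `|\int[mu]_(x in A) f x - \int[mu]_(x in B) f x| <= C * fine (mu (A `+` B)).
Proof.
move=> mA mB bf fC ABoo; have [mf [C' [M hM]]] := bf.
have mAB : measurable (A `+` B : set T) by apply: measurableU; exact: measurableD.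
pose K := [set x : 'rV[R]_n | enorm x <= M].
pose V := (A `+` B) `&` K.
have mV : measurable (V : set T) by apply: measurableI => //; exact: measurable_cball.
have bA := Bc_indic mA bf; have bB := Bc_indic mB bf.
have intE D : \int[mu]_(x in D) f x = \int[mu]_x (\1_D x * f x) by rewrite -[in LHS](setTI D) Bc_int_indic.
rewrite !intE -(Bc_intB measurableT bA bB).
have bV : Bc (\1_V : 'rV[R]_n -> R).
  split; first exact: measurable_indic.
  exists 1, M => x; split; first by rewrite indicE; case: (_ \in _); rewrite ?normr1 ?normr0.
  by move=> Mx; rewrite indicE memNset// => -[_]; rewrite /K/= leNgt Mx.
have C0 : 0 <= C by exact: le_trans (normr_ge0 _) (fC 0).
have Voo : (mu V < +oo)%E by apply: le_lt_trans ABoo; apply: le_lebesgue_outer => x [].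
apply: (@le_trans _ _ (\int[mu]_x (C * \1_V x))).
  apply: le_trans (le_norm_Bc_int measurableT (BcB bA bB)) _.
  apply: (le_Bc_int measurableT (Bc_norm (BcB bA bB)) (BcZ C bV)) => x _.
  rewrite -mulrBl normrM.
  have [xK|xK] := pselect (K x); last first.
    by rewrite (hM x).2 ?normr0 ?mulr0 ?mulr_ge0// ltNge; apply/negP.
  have [xV|xV] := pselect (V x).
    rewrite [\1_V x]indicE (mem_set xV) mulr1 -[leRHS]mul1r; apply: ler_pM => //.
    by rewrite !indicE; case: (_ \in _); case: (_ \in _) => /=; rewrite ?subrr ?subr0 ?sub0r ?normrN ?normr1 ?normr0.
  rewrite [\1_V x]indicE (memNset xV) mulr0.
  suff -> : \1_A x = \1_B x :> R by rewrite subrr normr0 mul0r.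
  rewrite !indicE; have [xA|xA] := pselect (A x); have [xB|xB] := pselect (B x).
  - by rewrite !mem_set.
  - by exfalso; apply: xV; split => //; left.
  - by exfalso; apply: xV; split => //; right.
  - by rewrite !memNset.
rewrite (Bc_intZ _ measurableT bV) ler_wpM2l// /Rintegral integral_indic// setIT.
apply: fine_le; [by rewrite ge0_fin_numE ?lebesgue_outer_ge0|by rewrite ge0_fin_numE ?lebesgue_outer_ge0|].
by apply: le_lebesgue_outer => x [].
Qed.

(** Lower semicontinuity under convergence in measure: the test against a
    fixed field is continuous in the set, and the perimeter is the supremum of
    these tests. *)
Lemma perimeter_lsc E (c : \bar R) : measurable (E : set T) ->
  (forall e : R, 0 < e -> exists F, [/\ measurable (F : set T),
     (mu (F `+` E) <= e%:E)%E & (perimeter F <= c)%E]) -> (perimeter E <= c)%E.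
Proof.
move=> mE h; apply: perimeter_le => // xi xia.
have bd := Bc_div xia.1; have [C C0 hC] := Cc_bounded (Cc_divergence xia.1).
apply/lee_addgt0Pr => e e0.
have [|F [mF FE Fc]] := h (e / (C + 1)); first by rewrite divr_gt0// ltr_wpDl.
have FEoo : (mu (F `+` E) < +oo)%E by rewrite (le_lt_trans FE)// ltry.
have := int_setY mF mE bd hC FEoo; rewrite ler_norml => /andP[h1 _].
have h2 : C * fine (mu (F `+` E)) <= e.
  apply: (@le_trans _ _ ((C + 1) * (e / (C + 1)))).
    apply: ler_pM => //; [exact/fine_ge0/lebesgue_outer_ge0|by rewrite lerDl|].
    by rewrite -lee_fin fineK// ge0_fin_numE ?lebesgue_outer_ge0.
  by rewrite mulrC divfK// gt_eqF// ltr_wpDl.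
apply: (@le_trans _ _ ((\int[mu]_(x in F) divergence xi x)%:E + e%:E)%E).
  by rewrite -EFinD lee_fin; lra.
by rewrite leeD2r// (le_trans (perimeter_ge mF xia)).
Qed.

Lemma perimeter_ae A B : measurable (A : set T) -> measurable (B : set T) ->
  mu (A `+` B) = 0%E -> perimeter A = perimeter B.
Proof.
move=> mA mB AB; apply/eqP; rewrite eq_le; apply/andP; split; apply: perimeter_lsc => // e e0.
  by exists B; split => //; rewrite setYC AB lee_fin ltW.
by exists A; split => //; rewrite AB lee_fin ltW.
Qed.

Lemma perimeter_null : mu setT = 0%E -> forall E, measurable (E : set T) -> perimeter E = 0%E.
Proof.
move=> mu0 E mE; rewrite -perimeter_setT; apply: perimeter_ae => //.
apply/eqP; rewrite eq_le lebesgue_outer_ge0 andbT -mu0.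
exact: le_lebesgue_outer.
Qed.

End perimeter_basics.

(** * Submodularity of the perimeter *)

Section mollifier.
Context {R : realType} {n : nat}.
Implicit Types (x y z v : 'rV[R]_n) (A B E F : set 'rV[R]_n) (xi : 'rV[R]_n -> 'rV[R]_n).
Local Notation T := (lebesgue_rV R n).
Local Notation mu := (@lebesgue R n).

(** Balls have positive measure as soon as the whole space does, because
    countably many translates of a ball cover the space. The hypothesis
    replaces the computation of the measure of a box; when it fails, all
    perimeters vanish. *)
Lemma lebesgue_eball_gt0 x (r : R) : mu setT != 0%E -> 0 < r -> (0 < mu (eball x r))%E.
Proof.
move=> mu0 r0; rewrite lt_def lebesgue_outer_ge0 andbT; apply: contra_neq mu0 => xr0.
have ball0 c : mu (eball c r) = 0%E.
  rewrite -xr0 -(lebesgue_shift (eball c r) (c - x)); congr (mu _).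
  apply/seteqP; split => y; rewrite /eball /shift_set/= => h.
    by rewrite (_ : y - x = y + (c - x) - c)// addrA addrAC addrK.
  by rewrite (_ : y + (c - x) - c = y - x)// addrA addrAC addrK.
pose B k : set T := if unpickle k is Some c then eball (\row_i ratr ((c : 'rV[rat]_n) 0 i)) r else set0.
have : mu (\bigcup_k B k) = 0%E.
  apply/eqP; rewrite eq_le lebesgue_outer_ge0 andbT.
  apply: le_trans (lebesgue_outer_sigma_subadditive _) _.
  rewrite eseries0// => k _ _; rewrite /B; case: (unpickle k) => [c|]; first exact: ball0.
  exact: lebesgue_outer0.
suff -> : \bigcup_k B k = setT by [].
apply/seteqP; split => // y _.
pose d := r / n.+1%:R / 2.
have d0 : 0 < d by rewrite !divr_gt0.
have /choice[c hc] : forall i, exists q : rat, `|y 0 i - ratr q| <= d.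
  move=> i; have [|q] := @rat_in_itvoo R (y 0 i) (y 0 i + d); first by rewrite ltrDl.
  rewrite in_itv/= => /andP[q1 q2]; exists q.
  by rewrite distrC gtr0_norm ?subr_gt0// lerBlDl ltW.
exists (pickle (\row_i c i)) => //; rewrite /B pickleK /eball/=.
apply: le_lt_trans (enorm_le_norm _) _.
apply: (@le_lt_trans _ _ (n.+1%:R * d)).
  rewrite ler_wpM2l//; apply: norm_leP => [|i]; first exact: ltW.
  by rewrite !mxE.
have -> : n.+1%:R * d = r / 2 by rewrite /d [r / _]mulrC -mulrA mulVKf.
by rewrite ltr_pdivrMr// ltr_pMr// ltr1n.
Qed.

Definition kern_radius (k : nat) : R := k.+1%:R^-1.
Definition kern_mass (k : nat) : R := \int[mu]_x ebump 0 (kern_radius k) x.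
Definition kern (k : nat) x : R := (kern_mass k)^-1 * ebump 0 (kern_radius k) x.

Let kr0 k : 0 < kern_radius k. Proof. by rewrite invr_gt0. Qed.

Let Cc_ebump k : Cc (ebump (0 : 'rV[R]_n) (kern_radius k)).
Proof.
split; last by exists (kern_radius k + enorm (0 : 'rV[R]_n)) => x; exact/bump_supp/ltW.
by move=> x; exact: (C1_on_continuous (C1_on_bump 0 _)).
Qed.

Lemma kern_Cc k : Cc (kern k).
Proof. by apply: CcM (Cc_ebump k) => x; exact: cst_continuous. Qed.

Lemma kern_supp k x : kern_radius k <= enorm x -> kern k x = 0.
Proof. by move=> kx; rewrite /kern bump_eq0 ?mulr0 ?subr0// ltW. Qed.

Context (mu_neq0 : mu setT != 0%E).

Lemma kern_mass_gt0 k : 0 < kern_mass k.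
Proof.
set r := kern_radius k; pose B := eball (0 : 'rV[R]_n) (r / 2).
have mB : measurable (B : set T) by exact: measurable_eball.
have rr0 : 0 < r := kr0 k.
pose d : R := (r ^+ 2 - (r / 2) ^+ 2) ^+ 2.
have d1 : 0 < r ^+ 2 - (r / 2) ^+ 2.
  by rewrite subr_gt0 ltrXn2r// ?nnegrE ?divr_ge0 ?ltW// ltr_pdivrMr// ltr_pMr// ltr1n.
have d0 : 0 < d by rewrite exprn_gt0.
have bB : Bc (\1_B : 'rV[R]_n -> R).
  split; first exact: measurable_indic.
  exists 1, r => x; split; first by rewrite indicE; case: (_ \in _); rewrite ?normr1 ?normr0.
  move=> rx; rewrite indicE memNset// /B /eball/= subr0 => xr.
  have := lt_trans rx xr; rewrite ltNge ler_pdivrMr// ler_peMr// ?ler1n//; exact: ltW.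
have Boo : (mu B < +oo)%E.
  apply: (@lebesgue_bounded_lty _ _ _ (r / 2)) => x.
  by rewrite /B /eball/= subr0; exact: ltW.
apply: (@lt_le_trans _ _ (\int[mu]_x (d * \1_B x))).
  rewrite (Bc_intZ _ measurableT bB) mulr_gt0// /Rintegral integral_indic// setIT.
  by rewrite fine_gt0// lebesgue_eball_gt0//= divr_gt0.
apply: (le_Bc_int measurableT (BcZ d bB) (Cc_Bc (Cc_ebump k))) => x _.
rewrite indicE; case: (boolP (x \in B)) => [|_]; last by rewrite mulr0 sqpos_ge0.
rewrite inE /B /eball/= subr0 mulr1 => xr.
have h : r ^+ 2 - (r / 2) ^+ 2 <= r ^+ 2 - dotp x x.
  by rewrite lerD2l lerN2 -enorm_sqr ler_pXn2r ?nnegrE ?enorm_ge0 ?divr_ge0 ?ltW.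
rewrite /ebump subr0 /sqpos (max_idPr _) ?(le_trans (ltW d1))//.
by rewrite ler_pXn2r// nnegrE ?ltW// (lt_le_trans d1).
Qed.

Lemma kern_ge0 k x : 0 <= kern k x.
Proof. by rewrite mulr_ge0 ?sqpos_ge0// invr_ge0 ltW// kern_mass_gt0. Qed.

Lemma kern_int1 k : \int[mu]_x kern k x = 1.
Proof.
by rewrite (Bc_intZ _ measurableT (Cc_Bc (Cc_ebump k))) mulVf// gt_eqF// kern_mass_gt0.
Qed.

Let conv_kernE k A : measurable (A : set T) -> conv (kern k) A =
  fun x => (kern_mass k)^-1 * conv (ebump 0 (kern_radius k)) A x.
Proof.
move=> mA; apply/funext => x; rewrite /conv.
rewrite -(Bc_intZ _ measurableT (Bc_conv_integrand x mA (Cc_ebump k))).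
by apply: eq_Rintegral => y _; rewrite /kern mulrCA.
Qed.

Lemma C1_on_conv_kern k A : measurable (A : set T) -> C1_on setT (conv (kern k) A).
Proof.
move=> mA; rewrite (conv_kernE k mA).
exact: (C1_onM openT (C1_on_cst _) (C1_on_conv_bump mA (ltW (kr0 k)))).
Qed.

Lemma conv_kern01 k A x : measurable (A : set T) -> 0 <= conv (kern k) A x <= 1.
Proof.
move=> mA; rewrite conv_ge0 => [|y]; last exact: kern_ge0.
have bk : Bc (fun y => kern k (x - y)) := Cc_Bc (Cc_reflect x (kern_Cc k)).
have -> : 1 = \int[mu]_y kern k (x - y).
  rewrite -(kern_int1 k) -(Bc_intT_shift (- x) (Cc_Bc (kern_Cc k))).
  apply: eq_Rintegral => y _; congr (_ * sqpos (_ - _)).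
  by rewrite !subr0 -(opprB x y) dotpNl dotpNr opprK.
apply: (le_Bc_int measurableT (Bc_conv_integrand x mA (kern_Cc k)) bk) => y _.
by rewrite ler_piMl ?kern_ge0// indicE; case: (_ \in _).
Qed.

Lemma conv_kern_bounded k A f : measurable (A : set T) -> Bc f ->
  Bc (fun x => conv (kern k) A x * f x).
Proof.
move=> mA bf; apply: (@BcM _ _ _ _ 1) bf.
  apply: measurable_continuous => x.
  exact: (C1_on_continuous (C1_on_conv_kern k mA)).
by move=> x; rewrite ger0_norm; have /andP[] := conv_kern01 k x mA.
Qed.

Let conv_kern_cvg_Cc A f : measurable (A : set T) -> Cc f ->
  \int[mu]_x (conv (kern k) A x * f x) @[k --> \oo] --> \int[mu]_x (\1_A x * f x).
Proof.
move=> mA fc; have [C C0 hC] := Cc_bounded fc; have [cf [M hM]] := fc.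
have bfs k y : Bc (fun z => kern k z * f (z + y)).
  by apply: Cc_Bc; apply: CcM (Cc_shift y fc); have [] := kern_Cc k.
have bk k : Bc (kern k) := Cc_Bc (kern_Cc k).
have gC k y : `|\int[mu]_z (kern k z * f (z + y))| <= C.
  apply: le_trans (le_norm_Bc_int measurableT (bfs k y)) _.
  rewrite -[leRHS]mulr1 -(kern_int1 k) -(Bc_intZ _ measurableT (bk k)).
  apply: (le_Bc_int measurableT (Bc_norm (bfs k y)) (BcZ C (bk k))) => z _.
  by rewrite normrM mulrC (ger0_norm (kern_ge0 k z)) ler_wpM2r ?kern_ge0.
rewrite (_ : (fun k => \int[mu]_x (conv (kern k) A x * f x)) =
    fun k => \int[mu]_y (\1_A y * \int[mu]_z (kern k z * f (z + y)))); last first.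
  by apply/funext => k; rewrite (conv_adjoint mA (kern_Cc k) fc).
have kr1 k : kern_radius k <= 1 by rewrite invf_le1// ler1n.
have [||||_ h] := @bounded_convergence R n setT
    (fun k y => \1_A y * \int[mu]_z (kern k z * f (z + y))) (fun y => \1_A y * f y)
    C (M + 1) measurableT.
- by move=> k; have [[]] := conv_adjoint_swap mA (kern_Cc k) fc.
- move=> k y; rewrite normrM -[leRHS]mul1r; apply: ler_pM => //.
  by rewrite indicE; case: (_ \in _); rewrite ?normr1 ?normr0.
- move=> k y My; rewrite (@eq_Rintegral _ _ _ mu _ (fun=> 0)) ?Rintegral_cst ?mul0r ?mulr0// => z _.
  have [zk|zk] := leP (kern_radius k) (enorm z); first by rewrite kern_supp ?mul0r.
  rewrite hM ?mulr0// -(ltrD2r 1) (lt_le_trans My)//.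
  rewrite -{1}(addKr z y) (le_trans (enormD _ _))// enormN addrC lerD2l.
  by rewrite (le_trans (ltW zk)).
move=> y; apply: cvgM; first exact: cvg_cst.
apply/cvgrPdist_le => e e0.
have /nbhs_eballP[r r0 hr] : nbhs y [set z | `|f y - f z| <= e].
  by have /(_ y)/cvgrPdist_le/(_ e e0) := cf.
have [N _ hN] := near_infty_natSinv_lt (PosNum r0).
exists N => // k /= Nk.
have -> : f y = \int[mu]_z (f y * kern k z).
  by rewrite (Bc_intZ _ measurableT (bk k)) kern_int1 mulr1.
have bc : Bc (fun z => f y * kern k z) := BcZ _ (bk k).
rewrite -(Bc_intB measurableT bc (bfs k y)).
apply: le_trans (le_norm_Bc_int measurableT (BcB bc (bfs k y))) _.
rewrite -[leRHS]mulr1 -(kern_int1 k) -(Bc_intZ _ measurableT (bk k)).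
apply: (le_Bc_int measurableT (Bc_norm (BcB bc (bfs k y))) (BcZ e (bk k))) => z _.
have [zk|zk] := leP (kern_radius k) (enorm z).
  by rewrite kern_supp// !mulr0 mul0r subrr normr0.
rewrite [kern k z * _]mulrC -mulrBl normrM (ger0_norm (kern_ge0 k z)).
rewrite ler_wpM2r ?kern_ge0//; apply: hr; rewrite /eball/= addrK.
by apply: (lt_trans zk); apply: hN => /=.
exact: h.
Qed.

(** Weak convergence of the mollified indicators, tested against restrictions of
    [Cc] functions; the density of continuous functions takes care of the
    discontinuity of the test function. *)
Lemma conv_kern_cvg A B f : measurable (A : set T) -> measurable (B : set T) -> Cc f ->
  \int[mu]_x (conv (kern k) A x * (\1_B x * f x)) @[k --> \oo] -->
  \int[mu]_x (\1_A x * (\1_B x * f x)).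
Proof.
move=> mA mB fc; have [C C0 hC] := Cc_bounded fc; have [cf [M hM]] := fc.
apply/cvgrPdist_le => e e0.
have d0 : 0 < e / (3 * (C + 1)) by rewrite divr_gt0// mulr_gt0// ltr_wpDl.
have [w [cw w01 wd]] := indic_dense M mB d0.
have wfc : Cc (fun x => w x * f x) by exact: CcM.
have h := conv_kern_cvg_Cc mA wfc.
have e3 : 0 < e / 3 by rewrite divr_gt0.
have /cvgrPdist_le/(_ _ e3)[N _ hN] := h.
have bBf := Bc_indic mB (Cc_Bc fc); have bwf := Cc_Bc wfc.
have bD := BcB bBf bwf.
have small (u : 'rV[R]_n -> R) : (forall x, 0 <= u x <= 1) ->
    Bc (fun x => u x * (\1_B x * f x)) -> Bc (fun x => u x * (w x * f x)) ->
    `|\int[mu]_x (u x * (\1_B x * f x)) - \int[mu]_x (u x * (w x * f x))| <= e / 3.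
  move=> u01 b1 b2; rewrite -(Bc_intB measurableT b1 b2).
  apply: le_trans (le_norm_Bc_int measurableT (BcB b1 b2)) _.
  pose K := [set x : 'rV[R]_n | enorm x <= M].
  have bK : Bc (fun x => \1_K x * `|\1_B x - w x|).
    split.
      apply: measurable_funM; first exact/measurable_indic/measurable_cball.
      apply: (measurableT_comp (@normr_measurable R setT)).
      by apply: measurable_funB; [exact: measurable_indic|exact: measurable_continuous].
    exists 1, M => x; split; last first.
      by move=> Mx; rewrite [\1_K x]indicE memNset ?mul0r//= /K/= leNgt Mx.
    rewrite normrM normr_id -[leRHS]mulr1; apply: ler_pM => //.
      by rewrite indicE; case: (_ \in _); rewrite ?normr1 ?normr0.
    have := w01 x; rewrite indicE; case: (_ \in _) => /andP[h1 h2]; rewrite ler_norml; apply/andP; split; rewrite /=; lra.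
  apply: (@le_trans _ _ (\int[mu]_x ((C + 1) * (\1_K x * `|\1_B x - w x|)))).
    apply: (le_Bc_int measurableT (Bc_norm (BcB b1 b2)) (BcZ (C + 1) bK)) => x _.
    rewrite -mulrBr -mulrBl !normrM.
    have [xK|xK] := leP (enorm x) M; last first.
      rewrite hM// normr0 !mulr0 mulr_ge0 ?mulr_ge0// ?addr_ge0//.
    rewrite [\1_K x]indicE mem_set// mul1r.
    have /andP[u0 u1] := u01 x.
    rewrite (ger0_norm u0) mulrCA mulrC ler_wpM2r//.
    by rewrite (le_trans (ler_piMl _ u1))// (le_trans (hC x))// lerDl.
  rewrite (Bc_intZ _ measurableT bK).
  have -> : \int[mu]_x (\1_K x * `|\1_B x - w x|) = \int[mu]_(x in K) `|\1_B x - w x|.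
    by rewrite -[in RHS](setTI K) Bc_int_indic.
  apply: (@le_trans _ _ ((C + 1) * (e / (3 * (C + 1))))).
    by rewrite ler_wpM2l// addr_ge0.
  by rewrite [3 * _]mulrC invfM mulrCA mulVKf// gt_eqF// ltr_wpDl.
exists N => // k /= Nk; have hk := hN k Nk.
have s1 := small _ (fun x => conv_kern01 k x mA) (conv_kern_bounded k mA bBf) (conv_kern_bounded k mA bwf).
have i01 x : 0 <= (\1_A x : R) <= 1 by rewrite indicE; case: (_ \in _); rewrite /= ?lexx ler01.
have s2 := small _ i01 (Bc_indic mA bBf) (Bc_indic mA bwf).
move: s1 s2 hk; rewrite !ler_norml => /andP[? ?] /andP[? ?] /andP[? ?].
by apply/andP; split; lra.
Qed.

(** Testing a set against a field through a mollified indicator does not exceed the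
    perimeter: it averages tests against translates of the field. *)
Lemma int_conv_kern_div k A xi : measurable (A : set T) -> admissible xi ->
  (perimeter A < +oo)%E ->
  \int[mu]_x (conv (kern k) A x * divergence xi x) <= fine (perimeter A).
Proof.
move=> mA [xi1 xi2] PA; have fc := Cc_divergence xi1.
rewrite (conv_adjoint mA (kern_Cc k) fc).
have [_ b2 ->] := conv_adjoint_swap mA (kern_Cc k) fc.
have bk : Bc (kern k) := Cc_Bc (kern_Cc k).
rewrite -[leRHS]mulr1 -(kern_int1 k) -(Bc_intZ _ measurableT bk).
apply: (le_Bc_int measurableT b2 (BcZ _ bk)) => z _.
rewrite [leRHS]mulrC ler_wpM2l ?kern_ge0//.
have [s1 s2] := C1c_shift z xi1.
have := perimeter_ge mA (conj s1 (fun x => xi2 (x + z))).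
rewrite (@eq_Rintegral _ _ _ mu _ (fun x => divergence xi (x + z))); last by move=> x _; rewrite s2.
by rewrite -(fineK (perimeter_fin_num PA)) lee_fin.
Qed.

(** The inequality behind submodularity, for the mollified indicators [u] of
    [A] and [v] of [B]. The fields [(1 - v) xi1 + v xi2] and [(1 - u) xi1 + u
    xi2] are admissible and are tested against [u] and [v]; the terms that
    contain gradients are those of the divergence of [u v (xi1 - xi2)], whose
    integral vanishes. *)
Let smooth_submod k l A B xi1 xi2 : measurable (A : set T) -> measurable (B : set T) ->
  admissible xi1 -> admissible xi2 -> (perimeter A < +oo)%E -> (perimeter B < +oo)%E ->
  \int[mu]_x (conv (kern k) A x *
    ((1 - conv (kern l) B x) * divergence xi1 x + conv (kern l) B x * divergence xi2 x)) +
  \int[mu]_x (conv (kern l) B x * divergence xi1 x) <=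
  fine (perimeter A) + fine (perimeter B).
Proof.
move=> mA mB xi1a xi2a PA PB.
set u := conv (kern k) A; set v := conv (kern l) B.
set f1 := divergence xi1; set f2 := divergence xi2.
have u1 : C1_on setT u := C1_on_conv_kern k mA.
have v1 : C1_on setT v := C1_on_conv_kern l mB.
have z (w : 'rV[R]_n -> R) : C1_on setT w -> (forall x, 0 <= w x <= 1) ->
    admissible (fun x => (1 - w x) *: xi1 x + w x *: xi2 x).
  move=> w1 w01; split; last by move=> x; apply: norm_convex => //; [exact: xi1a.2|exact: xi2a.2].
  apply: C1cD; apply: C1cZ; [|exact: xi1a.1|exact: w1|exact: xi2a.1].
  exact: (C1_onB openT (C1_on_cst _) w1).
have za := z v v1 (fun x => conv_kern01 l x mB).
have zb := z u u1 (fun x => conv_kern01 k x mA).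
have := lerD (int_conv_kern_div k mA za PA) (int_conv_kern_div l mB zb PB).
apply: le_trans.
set ga := divergence _; set gb := divergence _.
pose W x := (u x * v x) *: (xi1 x - xi2 x).
have xiB : C1c (fun x => xi1 x - xi2 x) := C1cD xi1a.1 (C1cN xi2a.1).
have uv1 : C1_on setT (fun x => u x * v x) := C1_onM openT u1 v1.
have W1 : C1c W := C1cZ uv1 xiB.
have bga : Bc ga := Bc_div za.1; have bgb : Bc gb := Bc_div zb.1.
have bf1 : Bc f1 := Bc_div xi1a.1; have bf2 : Bc f2 := Bc_div xi2a.1.
have bu g : Bc g -> Bc (fun x => u x * g x) by move=> bg; exact: (conv_kern_bounded k mA bg).
have bv g : Bc g -> Bc (fun x => v x * g x) by move=> bg; exact: (conv_kern_bounded l mB bg).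
have b1 : Bc (fun x => (1 - v x) * f1 x).
  rewrite (_ : (fun x => _) = fun x => f1 x - v x * f1 x); first exact: (BcB bf1 (bv _ bf1)).
  by apply/funext => x; rewrite mulrBl mul1r.
have b2 := bu _ (BcD b1 (bv _ bf2)).
have bW : Bc (divergence W) := Bc_div W1.
rewrite -(Bc_intD measurableT b2 (bv _ bf1)) -(Bc_intD measurableT (bu _ bga) (bv _ bgb)).
rewrite -[leRHS]addr0 -(int_divergence_eq0 W1).
rewrite -(Bc_intD measurableT (BcD (bu _ bga) (bv _ bgb)) bW).
rewrite le_eqVlt; apply/orP; left; apply/eqP; apply: eq_Rintegral => x _.
have dC1 (m : nat) (g : 'rV[R]_n -> 'rV[R]_m) : C1_on setT g -> differentiable g x by move=> g1; apply: (g1 x _).1.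
have du : differentiable u x by apply: (u1 x _).1.
have dv : differentiable v x by apply: (v1 x _).1.
have d1v : C1_on setT (fun x => 1 - v x) := C1_onB openT (C1_on_cst _) v1.
have d1u : C1_on setT (fun x => 1 - u x) := C1_onB openT (C1_on_cst _) u1.
have x11 := xi1a.1.1; have x21 := xi2a.1.1.
have gradB (w : 'rV[R]_n -> R) : differentiable w x -> grad (fun x => 1 - w x) x = - grad w x.
  move=> dw; apply/rowP => i; rewrite !mxE deriveB ?derive_cst ?sub0r//; first exact: diff_derivable.
have gradMx : grad (fun x => u x * v x) x = u x *: grad v x + v x *: grad u x.
  exact: gradM.
have dB : differentiable (fun x => xi1 x - xi2 x) x by exact: (dC1 _ _ xiB.1).
have divC (w : 'rV[R]_n -> R) : C1_on setT w -> divergence (fun x => (1 - w x) *: xi1 x + w x *: xi2 x) x =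
    (1 - w x) * f1 x - dotp (grad w x) (xi1 x) + (w x * f2 x + dotp (grad w x) (xi2 x)).
  move=> w1; have dw : differentiable w x by apply: (w1 x _).1.
  have d1w : C1_on setT (fun x => 1 - w x) := C1_onB openT (C1_on_cst _) w1.
  rewrite divergenceD; [|exact: (dC1 _ _ (C1_onZ openT d1w x11))|exact: (dC1 _ _ (C1_onZ openT w1 x21))].
  have d1wx : differentiable (fun x => 1 - w x) x by apply: (d1w x _).1.
  rewrite (divergenceZ d1wx (dC1 _ _ x11) (dC1 _ _ (C1_onZ openT d1w x11))).
  by rewrite (divergenceZ dw (dC1 _ _ x21) (dC1 _ _ (C1_onZ openT w1 x21))) gradB// dotpNl.
have divW : divergence W x = u x * v x * (f1 x - f2 x) +
    dotp (u x *: grad v x + v x *: grad u x) (xi1 x - xi2 x).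
  have duv : differentiable (fun x => u x * v x) x by apply: (uv1 x _).1.
  rewrite (divergenceZ duv dB (dC1 _ _ W1.1)).
  rewrite gradMx divergenceD; [|exact: (dC1 _ _ x11)|exact: (dC1 _ _ (C1_onN openT x21))].
  by rewrite divergenceN//; exact: (dC1 _ _ x21).
have algebra (a b c1 c2 : R) (p q y1 y2 : 'rV[R]_n) :
    a * ((1 - b) * c1 + b * c2) + b * c1 =
    a * ((1 - b) * c1 - dotp q y1 + (b * c2 + dotp q y2)) +
    b * ((1 - a) * c1 - dotp p y1 + (a * c2 + dotp p y2)) +
    (a * b * (c1 - c2) + dotp (a *: q + b *: p) (y1 - y2)).
  by rewrite dotpDl !dotpZl !dotpBr; ring.
have ea := divC v v1; have eb := divC u u1.
by rewrite -/ga -/gb in ea eb; rewrite ea eb divW; exact: algebra.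
Qed.

(** Submodularity of the perimeter. On mollified indicators it is the pointwise
    fact that a convex combination of admissible fields is admissible, up to the
    divergence of a compactly supported field. *)
Lemma perimeter_submod A B : measurable (A : set T) -> measurable (B : set T) ->
  (perimeter (A `&` B) + perimeter (A `|` B) <= perimeter A + perimeter B)%E.
Proof.
move=> mA mB.
have [PA|] := ltP (perimeter A) +oo%E; last first.
  by rewrite leye_eq => /eqP ->; rewrite addye ?leey// gt_eqF// (lt_le_trans _ (perimeter_ge0 _)).
have [PB|] := ltP (perimeter B) +oo%E; last first.
  by rewrite leye_eq => /eqP ->; rewrite addey ?leey// gt_eqF// (lt_le_trans _ (perimeter_ge0 _)).
have mI : measurable (A `&` B : set T) by exact: measurableI.
have mU : measurable (A `|` B : set T) by exact: measurableU.
pose p := fine (perimeter A) + fine (perimeter B).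
have key xi1 xi2 : admissible xi1 -> admissible xi2 ->
    \int[mu]_(x in A `|` B) divergence xi1 x + \int[mu]_(x in A `&` B) divergence xi2 x <= p.
  move=> a1 a2; set f1 := divergence xi1; set f2 := divergence xi2.
  have c1 : Cc f1 := Cc_divergence a1.1; have c2 : Cc f2 := Cc_divergence a2.1.
  have bf1 := Cc_Bc c1; have bf2 := Cc_Bc c2.
  have bA f : Bc f -> Bc (fun x => \1_A x * f x) by exact: Bc_indic.
  have bB f : Bc f -> Bc (fun x => \1_B x * f x) by exact: Bc_indic.
  (* The mollification of [A] is removed first, while that of [B] is kept, so
     that the test function stays continuous. *)
  have step1 l : \int[mu]_x (\1_A x * f1 x) + \int[mu]_x (conv (kern l) B x * f1 x)
     + (\int[mu]_x (conv (kern l) B x * (\1_A x * f2 x)) -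
        \int[mu]_x (conv (kern l) B x * (\1_A x * f1 x))) <= p.
    have cv : continuous (conv (kern l) B) by move=> x; exact: (C1_on_continuous (C1_on_conv_kern l mB)).
    pose g x := (1 - conv (kern l) B x) * f1 x + conv (kern l) B x * f2 x.
    have gE : g = fun x => f1 x + (conv (kern l) B x * f2 x - conv (kern l) B x * f1 x).
      by apply/funext => x; rewrite /g mulrBl mul1r addrAC -addrA.
    have gc : Cc g by rewrite gE; apply: CcD => //; apply: CcD (CcM cv c2) (CcN (CcM cv c1)).
    have bg := Cc_Bc gc.
    have bvA f : Bc f -> Bc (fun x => conv (kern l) B x * (\1_A x * f x)).
      by move=> bf; exact: (conv_kern_bounded l mB (bA _ bf)).
    have h := conv_kern_cvg_Cc mA gc.
    have -> : \int[mu]_x (\1_A x * f1 x) + \int[mu]_x (conv (kern l) B x * f1 x)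
     + (\int[mu]_x (conv (kern l) B x * (\1_A x * f2 x)) -
        \int[mu]_x (conv (kern l) B x * (\1_A x * f1 x))) =
       \int[mu]_x (\1_A x * g x) + \int[mu]_x (conv (kern l) B x * f1 x).
      rewrite addrAC -(Bc_intB measurableT (bvA _ bf2) (bvA _ bf1)).
      rewrite -(Bc_intD measurableT (bA _ bf1) (BcB (bvA _ bf2) (bvA _ bf1))); congr (_ + _).
      by apply: eq_Rintegral => x _; rewrite gE mulrDr mulrBr ![\1_A x * (_ * _)]mulrCA.
    rewrite -(cvg_lim _ h)// -lerBrDr; apply: limr_le; first by apply/cvg_ex; eexists; exact: h.
    near=> k; rewrite lerBrDr; exact: (smooth_submod k l mA mB a1 a2 PA PB).
  have bfT f : Bc f -> \int[mu]_x (\1_setT x * f x) = \int[mu]_x f x.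
    by move=> _; apply: eq_Rintegral => x _; rewrite indicE mem_set// mul1r.
  have h1 := conv_kern_cvg_Cc mB c1.
  have h2 := conv_kern_cvg mB mA c2.
  have h3 := conv_kern_cvg mB mA c1.
  have h4 : \int[mu]_x (\1_A x * f1 x) + \int[mu]_x (conv (kern l) B x * f1 x)
     + (\int[mu]_x (conv (kern l) B x * (\1_A x * f2 x)) -
        \int[mu]_x (conv (kern l) B x * (\1_A x * f1 x))) @[l --> \oo] -->
     \int[mu]_x (\1_A x * f1 x) + \int[mu]_x (\1_B x * f1 x) +
     (\int[mu]_x (\1_B x * (\1_A x * f2 x)) - \int[mu]_x (\1_B x * (\1_A x * f1 x))).
    exact: (cvgD (cvgD (cvg_cst _) h1) (cvgB h2 h3)).
  have h5 : \int[mu]_x (\1_A x * f1 x) + \int[mu]_x (\1_B x * f1 x) +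
     (\int[mu]_x (\1_B x * (\1_A x * f2 x)) - \int[mu]_x (\1_B x * (\1_A x * f1 x))) <= p.
    rewrite -(cvg_lim _ h4)//; apply: limr_le; first by apply/cvg_ex; eexists; exact: h4.
    by near=> l; exact: step1.
  apply: le_trans h5.
  rewrite -[A `|` B](setTI (A `|` B)) -[A `&` B](setTI (A `&` B)) !Bc_int_indic.
  have bBA f : Bc f -> Bc (fun x => \1_B x * (\1_A x * f x)) by move=> bf; exact/bB/bA.
  rewrite [leRHS](Bc_intDDB (bA _ bf1) (bB _ bf1) (bBA _ bf2) (bBA _ bf1)).
  rewrite -(Bc_intD measurableT (Bc_indic mU bf1) (Bc_indic mI bf2)).
  rewrite le_eqVlt; apply/orP; left; apply/eqP; apply: eq_Rintegral => x _.
  rewrite !indicE in_setU in_setI; case: (x \in A); case: (x \in B); rewrite /=; ring.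
have fin : (perimeter A + perimeter B = p%:E)%E.
  by rewrite -(fineK (perimeter_fin_num PA)) -(fineK (perimeter_fin_num PB)).
rewrite fin.
have PU : (perimeter (A `|` B) <= p%:E)%E.
  apply: perimeter_le => // xi xia; rewrite lee_fin; have := key _ _ xia admissible0.
  rewrite [X in _ + X](@eq_Rintegral _ _ _ mu _ (fun=> 0)); last by move=> x _; rewrite divergence_cst.
  by rewrite Rintegral_cst// mul0r addr0.
have PUf : perimeter (A `|` B) \is a fin_num.
  by apply: perimeter_fin_num; rewrite (le_lt_trans PU)// ltry.
rewrite -leeBrDr//; apply: perimeter_le => // xi2 a2.
rewrite leeBrDr// addeC -leeBrDr//; apply: perimeter_le => // xi1 a1.
by rewrite leeBrDr// -EFinD lee_fin; exact: key.
Unshelve. all: by end_near. Qed.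

End mollifier.

(** * Local constructions of class C1 *)

Lemma near_eq_differentiable (K : numFieldType) (V W : normedModType K) (f g : V -> W) (x : V) :
  (\near x, f x = g x) -> differentiable f x -> differentiable g x.
Proof.
move=> fg df; have fgx : f x = g x := nbhs_singleton fg.
have [cf fL] := (diff_locallyP _ _).1 df.
have gL : g \o shift x = cst (g x) + 'd f x +o_ 0 id.
  apply/eqaddoP => e e0.
  move/eqaddoP : fL => /(_ e e0) h.
  have fg' : \forall y \near 0, f (y + x) = g (y + x).
    by move: fg; rewrite (near_shift 0 x); apply: filterS => y /=; rewrite subr0.
  near=> y.
  have : f (y + x) = g (y + x) by near: y.
  have : `|(f \o shift x - (cst (f x) + 'd f x)) y| <= e * `|id y| by near: y.
  by rewrite !fctE /= => + fgy; rewrite fgy fgx.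
have dgL : 'd g x = 'd f x :> (_ -> _) by apply: diff_unique.
by apply/diff_locallyP; rewrite dgL.
Unshelve. all: by end_near. Qed.

Section local_C1.
Context {R : realType} {n : nat}.
Implicit Types (x y v c : 'rV[R]_n) (U V : set 'rV[R]_n) (xi : 'rV[R]_n -> 'rV[R]_n).

Lemma C1_on_eq {W : normedModType R} U (f g : 'rV[R]_n -> W) : open U ->
  (forall x, U x -> f x = g x) -> C1_on U f -> C1_on U g.
Proof.
move=> oU fg f1.
have nfg x : U x -> \near x, f x = g x.
  by move=> Ux; near=> y; apply: fg; near: y; exact: open_nbhs_nbhs.
apply: (@C1_onI _ _ _ _ _ (fun v x => 'D_v f x)) => //.
- by move=> x Ux; apply: near_eq_differentiable (nfg x Ux) _; exact: (f1 _ Ux).1.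
- by move=> x v Ux; apply/esym/near_eq_derive/nfg.
- by move=> x v Ux; exact: (f1 _ Ux).2.
Unshelve. all: by end_near. Qed.

Lemma divergence_eq U xi eta x : open U -> U x -> (forall y, U y -> xi y = eta y) ->
  divergence xi x = divergence eta x.
Proof.
move=> oU Ux xe; apply: eq_bigr => i _; rewrite (@near_eq_derive _ _ _ xi eta)//.
near=> y; apply: xe; near: y; exact: open_nbhs_nbhs.
Unshelve. all: by end_near. Qed.

Lemma grad_eq U (f g : 'rV[R]_n -> R) x : open U -> U x -> (forall y, U y -> f y = g y) ->
  grad f x = grad g x.
Proof.
move=> oU Ux xe; apply/rowP => i; rewrite !mxE.
by apply: near_eq_derive; near=> y; apply: xe; near: y; exact: open_nbhs_nbhs.
Unshelve. all: by end_near. Qed.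

Lemma C1_on_cover {W : normedModType R} U V (f : 'rV[R]_n -> W) :
  (forall x, U x \/ V x) -> C1_on U f -> C1_on V f -> C1_on setT f.
Proof. by move=> UV fU fV x _; have [/fU|/fV] := UV x. Qed.

Lemma grad_cst (a : R) x : grad (fun=> a) x = 0.
Proof. by apply/rowP => i; rewrite !mxE derive_cst. Qed.

Lemma grad_sum (m : nat) (f : 'I_m -> 'rV[R]_n -> R) x : (forall i, differentiable (f i) x) ->
  grad (fun y => \sum_(i < m) f i y) x = \sum_(i < m) grad (f i) x.
Proof.
move=> df; apply/rowP => j; rewrite !mxE summxE.
have -> : (fun y => \sum_(i < m) f i y) = \sum_(i < m) f i.
  by apply/funext => y; rewrite fct_sumE.
rewrite derive_sum; last by move=> i; exact: diff_derivable.
by apply: eq_bigr => i _; rewrite mxE.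
Qed.

Lemma divergence_sum (m : nat) (xi : 'I_m -> 'rV[R]_n -> 'rV[R]_n) x :
  (forall i, C1_on setT (xi i)) ->
  divergence (fun y => \sum_(i < m) xi i y) x = \sum_(i < m) divergence (xi i) x.
Proof.
move=> d1; elim: m xi d1 => [|m ih] xi d1.
  rewrite big_ord0 (_ : (fun y => _) = fun=> 0) ?divergence_cst//.
  by apply/funext => y; rewrite big_ord0.
rewrite big_ord_recr/= -ih; last by move=> i; exact: d1.
rewrite -divergenceD; [|by apply: (C1_on_sum _ openT (fun i _ => d1 (widen_ord (leqnSn m) i)) (x := x) _).1|by apply: (d1 _ x _).1].
rewrite (_ : (fun y => \sum_(i < m.+1) xi i y) =
  (fun y => \sum_(i < m) xi (widen_ord (leqnSn m) i) y + xi ord_max y))//.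
by apply/funext => y; rewrite big_ord_recr.
Qed.

Lemma C1_on_prod (m : nat) U (f : 'I_m -> 'rV[R]_n -> R) : open U ->
  (forall i, C1_on U (f i)) -> C1_on U (fun x => \prod_(i < m) f i x).
Proof.
move=> oU; elim: m f => [|m ih] f f1.
  by rewrite (_ : (fun x => _) = fun=> 1); [exact: C1_on_cst|apply/funext => x; rewrite big_ord0].
rewrite (_ : (fun x => _) = fun x => (\prod_(i < m) f (widen_ord (leqnSn m) i) x) * f ord_max x).
  exact: (C1_onM oU (ih _ (fun i => f1 _)) (f1 _)).
by apply/funext => x; rewrite big_ord_recr.
Qed.

Lemma derive_sign (f : 'rV[R]_n -> R) x v : differentiable f x -> f x = 0 -> 0 < 'D_v f x ->
  \forall t \near 0^'+, 0 < f (t *: v + x).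
Proof.
move=> df fx0 dpos; have /cvg_ex[l hl] : derivable f x v by exact: diff_derivable.
have lE : 'D_v f x = l by apply: cvg_lim.
have l0 : 0 < l by rewrite -lE.
have h : \forall t \near 0^', 0 < t^-1 *: (f (t *: v + x) - f x).
  move/cvgrPdist_lt : hl => /(_ l l0); apply: filterS => t /=.
  by rewrite distrC ltr_distl subrr => /andP[].
have h' : \forall t \near 0^'+, 0 < t^-1 *: (f (t *: v + x) - f x).
  move: h; rewrite /dnbhs/= => /nbhs_ballP[e e0 he].
  by apply/nbhs_ballP; exists e => // t te t0; apply: he => //; rewrite gt_eqF.
near=> t.
have t0 : 0 < t by near: t; exact: nbhs_right_gt.
have : 0 < t^-1 *: (f (t *: v + x) - f x) by near: t.
by rewrite fx0 subr0 /GRing.scale/= pmulr_rgt0// invr_gt0.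
Unshelve. all: by end_near. Qed.

(** A decreasing cutoff of class C1, equal to 1 for nonpositive arguments and
    to 0 from 1 on. *)
Definition cutoff (s : R) : R := sqpos (1 - sqpos s).

Lemma cutoff01 s : 0 <= cutoff s <= 1.
Proof.
rewrite /cutoff sqpos_ge0/= {1}/sqpos expr_le1// ?le_max ?lexx//.
by rewrite ge_max ler01 gerBl sqpos_ge0.
Qed.

Lemma cutoff1 s : s <= 0 -> cutoff s = 1.
Proof. by move=> s0; rewrite /cutoff (sqpos_eq0 s0) subr0 /sqpos (max_idPr ler01) expr1n. Qed.

Lemma cutoff0 s : 1 <= s -> cutoff s = 0.
Proof.
move=> s1; rewrite /cutoff sqpos_eq0// subr_le0 /sqpos (max_idPr (le_trans ler01 s1)).
by rewrite expr_ge1// (le_trans ler01).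
Qed.

Lemma cutoff_derive s : [/\ derivable cutoff s 1, derive1 cutoff s <= 0 &
  {for s, continuous (derive1 cutoff)}].
Proof.
have d1 (t : R) : derivable sqpos t 1 := (sqpos_derive t).1.
have e1 (t : R) : derive1 sqpos t = 2 * Num.max 0 t := (sqpos_derive t).2.
have dm (t : R) : is_derive t 1 cutoff (- (2 * Num.max 0 (1 - sqpos t) * (2 * Num.max 0 t))).
  have hs : is_derive t 1 sqpos (2 * Num.max 0 t) by apply: DeriveDef; rewrite ?d1// -derive1E.
  have hs' : is_derive t 1 (fun s : R => 1 - sqpos s) (- (2 * Num.max 0 t)).
    have := is_deriveB (is_derive_cst (1 : R) t 1) hs; rewrite sub0r; exact.
  have ho : is_derive (1 - sqpos t) 1 sqpos (2 * Num.max 0 (1 - sqpos t)).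
    by apply: DeriveDef; rewrite ?d1// -derive1E.
  by have := @is_derive1_comp R sqpos (fun s : R => 1 - sqpos s) t _ _ ho hs'; rewrite /GRing.scale/= mulrN mulrC.
have dE : derive1 cutoff = fun t => - (2 * Num.max 0 (1 - sqpos t) * (2 * Num.max 0 t)).
  by apply/funext => t; rewrite derive1E; have [_ ->] := dm t.
have cp : continuous (fun s : R => 2 * Num.max 0 s).
  by move=> t; apply: (@continuousM _ _ (cst 2)); [exact: cst_continuous|exact: continuous_pos].
split; first by have [] := dm s.
  by rewrite dE oppr_le0 !mulr_ge0// le_max lexx.
rewrite dE; apply: (@continuousN R R^o).
apply: (@continuousM _ _ (fun t : R => 2 * Num.max 0 (1 - sqpos t)) (fun t : R => 2 * Num.max 0 t)); last exact: cp.
apply: (@continuous_comp _ _ _ (fun t : R => 1 - sqpos t) (fun s : R => 2 * Num.max 0 s)); last exact: cp.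
apply: (@cvgB R R^o _ (nbhs s) _ (cst 1) sqpos); first exact: cvg_cst.
by apply: differentiable_continuous; apply/derivable1_diffP; exact: d1.
Qed.

Lemma C1_on_cutoff U (f : 'rV[R]_n -> R) : open U -> C1_on U f ->
  C1_on U (fun x => cutoff (f x)).
Proof. by move=> oU f1; refine (C1_on_comp oU f1 _) => x Ux; have [] := cutoff_derive (f x). Qed.

(** Equal to 1 on the ball of radius [r / 2], and supported in a closed set that is
    contained in the open ball of radius [r]. *)
Definition plateau c (r : R) x : R := cutoff (4 * r ^- 2 * dotp (x - c) (x - c) - 1).

Lemma C1_on_dist c : C1_on setT (fun x => dotp (x - c) (x - c)).
Proof.
have h : C1_on setT (fun x => x - c).
  refine (C1_on_row openT _) => i.
  rewrite (_ : (fun x => _) = fun x => x 0 i - c 0 i).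
    exact: (C1_onB openT (C1_on_proj i openT) (C1_on_cst _)).
  by apply/funext => x; rewrite !mxE.
exact: (C1_on_dotp openT h h).
Qed.

Lemma C1_on_plateau c (r : R) : C1_on setT (plateau c r).
Proof.
apply: (C1_on_cutoff openT).
exact: (C1_onB openT (C1_onM openT (C1_on_cst _) (C1_on_dist c)) (C1_on_cst _)).
Qed.

Lemma plateau1 c (r : R) x : 0 < r -> enorm (x - c) < r / 2 -> plateau c r x = 1.
Proof.
move=> r0 xr; rewrite /plateau cutoff1// subr_le0 mulrAC ler_pdivrMr ?exprn_gt0// mul1r -enorm_sqr.
rewrite (_ : 4 * _ = (2 * enorm (x - c)) ^+ 2); last by rewrite exprMn; congr (_ * _); ring.
rewrite ler_pXn2r ?nnegrE ?mulr_ge0 ?enorm_ge0 ?(ltW r0)//.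
by rewrite mulrC -ler_pdivlMr// ltW.
Qed.

(** Complement of the support of [plateau c r]. *)
Definition off_plateau c (r : R) : set 'rV[R]_n := [set x | 1 < 2 * r ^- 2 * dotp (x - c) (x - c)].

Lemma open_off_plateau c (r : R) : open (off_plateau c r).
Proof.
have := open_comp (f := fun x => 2 * r ^- 2 * dotp (x - c) (x - c)) (D := [set s | 1 < s]).
apply; last exact: open_gt.
move=> x _; exact: (C1_on_continuous (C1_onM openT (C1_on_cst _) (C1_on_dist c))).
Qed.

Lemma off_plateau0 c (r : R) x : off_plateau c r x -> plateau c r x = 0.
Proof.
rewrite /off_plateau/= => h; rewrite /plateau cutoff0//.
by rewrite (_ : 4 * _ * _ = 2 * (2 * r ^- 2 * dotp (x - c) (x - c))); [lra|ring].
Qed.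

Lemma ball_or_off_plateau c (r : R) x : 0 < r -> eball c r x \/ off_plateau c r x.
Proof.
move=> r0; have [xr|xr] := ltP (enorm (x - c)) r; [by left|right].
rewrite /off_plateau/= mulrAC ltr_pdivlMr ?exprn_gt0// mul1r -enorm_sqr.
have : r ^+ 2 <= enorm (x - c) ^+ 2 by rewrite ler_pXn2r ?nnegrE ?enorm_ge0 ?(ltW r0).
have : 0 < r ^+ 2 by rewrite exprn_gt0.
lra.
Qed.

(** A product with a factor that is supported in a ball is of class C1
    everywhere, although the other factor is regular on that ball only: the
    complement of the support is open. *)
Lemma C1_onZ_supp c (r : R) (eta : 'rV[R]_n -> R) xi : 0 < r -> C1_on setT eta ->
  (forall x, off_plateau c r x -> eta x = 0) -> C1_on (eball c r) xi ->
  C1_on setT (fun x => eta x *: xi x).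
Proof.
move=> r0 e1 e0 xi1; apply: (C1_on_cover (fun x => ball_or_off_plateau c x r0)).
  exact: (C1_onZ (@open_eball _ _ c r) (C1_on_sub (@subsetT _ _) e1) xi1).
refine (@C1_on_eq 'rV[R]_n _ (fun=> 0) _ (@open_off_plateau c r) _ (C1_on_cst 0)) => x /e0 ->.
by rewrite scale0r.
Qed.

Lemma continuous_supp c (r : R) (f g : 'rV[R]_n -> R) : 0 < r ->
  (forall x, eball c r x -> {for x, continuous f}) ->
  (forall x, off_plateau c r x -> g x = 0) -> continuous g -> continuous (fun x => f x * g x).
Proof.
move=> r0 cf g0 cg x; have [xb|xo] := ball_or_off_plateau c x r0.
  by apply: continuousM; [exact: cf|exact: cg].
rewrite /continuous_at g0// mulr0; apply: (@cvg_trans _ ((fun=> 0 : R) @ nbhs x)); last exact: cvg_cst.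
apply: (@near_eq_cvg _ _ (nbhs x) (nbhs_filter x)); near=> y; rewrite g0 ?mulr0//; near: y.
by apply: open_nbhs_nbhs; split => //; exact: open_off_plateau.
Unshelve. all: by end_near. Qed.

End local_C1.

(** * Exterior normals *)

Section normals.
Context {R : realType} {n : nat}.
Implicit Types (x y v c : 'rV[R]_n) (E U V : set 'rV[R]_n) (xi : 'rV[R]_n -> 'rV[R]_n).
Implicit Types (psi phi : 'rV[R]_n -> R).

Lemma near_gt (f : 'rV[R]_n -> R) x (a : R) : {for x, continuous f} -> a < f x ->
  \forall y \near x, a < f y.
Proof.
by move=> cf h; have := cf [set s | a < s] (open_nbhs_nbhs (conj (@open_gt R a) h)).
Qed.

Lemma near_lt (f : 'rV[R]_n -> R) x (a : R) : {for x, continuous f} -> f x < a ->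
  \forall y \near x, f y < a.
Proof.
by move=> cf h; have := cf [set s | s < a] (open_nbhs_nbhs (conj (@open_lt R a) h)).
Qed.

Lemma enorm_gt0 x : (0 < enorm x) = (x != 0).
Proof. by rewrite lt_def enorm_eq0 enorm_ge0 andbT. Qed.

Lemma exterior_normal_unit psi x : grad psi x != 0 -> enorm (exterior_normal psi x) = 1.
Proof.
move=> g0; rewrite /exterior_normal enormZ ger0_norm ?invr_ge0 ?enorm_ge0//.
by rewrite mulVf// enorm_eq0.
Qed.

Lemma exterior_normal_le1 psi x : enorm (exterior_normal psi x) <= 1.
Proof.
have [g0|/exterior_normal_unit -> //] := eqVneq (grad psi x) 0.
by rewrite /exterior_normal g0 scaler0 enorm0.
Qed.

Lemma dotp_grad_normal psi x : dotp (grad psi x) (exterior_normal psi x) = enorm (grad psi x).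
Proof.
rewrite /exterior_normal dotpZr -enorm_sqr.
have [->|g0] := eqVneq (grad psi x) 0; first by rewrite enorm0 expr0n mulr0.
by rewrite expr2 mulKf// enorm_eq0.
Qed.

Lemma C1_on_exterior_normal U psi : open U -> C2_on U psi ->
  (forall y, U y -> grad psi y != 0) -> C1_on U (exterior_normal psi).
Proof.
move=> oU psi2 g0; have g1 := C1_on_grad oU psi2.
have gpos y : U y -> 0 < enorm (grad psi y) by move=> /g0; rewrite enorm_gt0.
apply: (C1_onZ oU _ g1); apply: (C1_onV oU) => [|y /gpos]; last exact: lt0r_neq0.
apply: (C1_on_sqrt oU (C1_on_dotp oU g1 g1)) => y /gpos; rewrite -enorm_sqr.
exact: exprn_gt0.
Qed.

Lemma derive_dotp_self xi x v : differentiable xi x ->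
  'D_v (fun y => dotp (xi y) (xi y)) x = 2 * dotp ('D_v xi x) (xi x).
Proof.
move=> dxi; have dc i : derivable (fun y => xi y 0 i) x v.
  apply: diff_derivable; apply: (@differentiable_comp _ _ _ _ xi (fun M : 'rV[R]_n => M 0 i)) => //.
  exact: differentiable_coord.
rewrite /dotp (_ : (fun y => _) = \sum_(i < n) (fun y => xi y 0 i * xi y 0 i)); last first.
  by apply/funext => y; rewrite fct_sumE.
rewrite derive_sum => [|i]; last exact: derivableM.
rewrite mulr_sumr; apply: eq_bigr => i _.
rewrite (deriveM (dc i) (dc i)) !derive_coord//.
by rewrite /GRing.scale/=; ring.
Qed.

Lemma derive_mulmx xi x v : differentiable xi x ->
  'D_v xi x = v *m (\matrix_(i < n) 'D_(delta_mx 0 i) xi x).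
Proof.
move=> dxi; rewrite deriveE// [X in 'd xi x X](row_sum_delta v) linear_sum/= mulmx_sum_row.
by apply: eq_bigr => i _; rewrite linearZ/= rowK deriveE.
Qed.

Lemma unit_dotp_lt1 (p q : 'rV[R]_n) : dotp p p = 1 -> dotp q q = 1 -> p != q -> dotp p q < 1.
Proof.
rewrite -subr_eq0 -dotp_eq0 => p1 q1 h.
have : 0 < dotp (p - q) (p - q) by rewrite lt_def h dotp_ge0.
by rewrite dotpBr !(dotpC (p - q)) !dotpBr (dotpC q p) p1 q1; lra.
Qed.

End normals.

(** * Charts of a boundary of class C2 *)

Section charts.
Context {R : realType} {n : nat}.
Implicit Types (x y v c : 'rV[R]_n) (E U V : set 'rV[R]_n) (xi : 'rV[R]_n -> 'rV[R]_n).
Implicit Types (psi phi : 'rV[R]_n -> R).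

(** The divergence of a unit field is the trace of its differential on the
    orthogonal complement of the field: differentiating the constant squared norm
    shows that the field itself does not contribute. *)
Lemma divergence_orthonormal xi x (e : 'I_n.-1 -> 'rV[R]_n) (kappa : 'I_n.-1 -> R) :
  (0 < n)%N -> differentiable xi x -> (\near x, enorm (xi x) = 1) ->
  (forall i, dotp (e i) (xi x) = 0) ->
  (forall i j, dotp (e i) (e j) = (i == j)%:R) ->
  (forall i, 'D_(e i) xi x = kappa i *: e i) ->
  divergence xi x = \sum_(i < n.-1) kappa i.
Proof.
case: n x xi e kappa => // k x xi e kappa _ /= dxi xi1 eN ee De.
pose A : 'M[R]_k.+1 := \matrix_(i < k.+1) 'D_(delta_mx 0 i) xi x.
have DA (v : 'rV[R]_k.+1) : 'D_v xi x = v *m A := derive_mulmx v dxi.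
have xix : dotp (xi x) (xi x) = 1 by rewrite -enorm_sqr (nbhs_singleton xi1) expr1n.
have Dxi (v : 'rV[R]_k.+1) : dotp ('D_v xi x) (xi x) = 0.
  have := derive_dotp_self v dxi.
  rewrite (@near_eq_derive R 'rV[R]_k.+1 R^o _ (cst 1)) ?derive_cst; last first.
    by apply: filterS xi1 => y yy; rewrite -enorm_sqr yy expr1n.
  by move=> /esym/eqP; rewrite mulf_eq0 pnatr_eq0/= => /eqP.
pose b (i : 'I_k.+1) := if unlift ord_max i is Some j then e j else xi x.
pose B : 'M[R]_k.+1 := \matrix_(i < k.+1) b i.
have dotpE (u w : 'rV[R]_k.+1) : u *m w^T = (dotp u w)%:M.
  by apply/matrixP => i j; rewrite !ord1 !mxE eqxx mulr1n; apply: eq_bigr => l _; rewrite mxE.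
have BE i j : (B *m A *m B^T) i j = dotp (b i *m A) (b j).
  have -> : (B *m A *m B^T) i j = (row i (B *m A) *m (row j B)^T) 0 0.
    by rewrite !mxE; apply: eq_bigr => l _; rewrite !mxE.
  by rewrite row_mul !rowK dotpE mxE eqxx mulr1n.
have BB : B *m B^T = 1%:M.
  apply/matrixP => i j; rewrite [RHS]mxE.
  have -> : (B *m B^T) i j = dotp (b i) (b j).
    rewrite /dotp mxE; apply: eq_bigr => l _; by rewrite !mxE.
  rewrite /b; case: (unliftP ord_max i) => [i'|] ->; case: (unliftP ord_max j) => [j'|] ->.
  - by rewrite ee (inj_eq lift_inj).
  - by rewrite eN eq_sym (negbTE (neq_lift _ _)).
  - by rewrite dotpC eN (negbTE (neq_lift _ _)).
  - by rewrite xix eqxx.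
have -> : divergence xi x = \tr A.
  by apply: eq_bigr => i _; rewrite mxE.
rewrite -[A]mulmx1 -(mulmx1C BB) mulmxA mxtrace_mulC mulmxA /mxtrace big_ord_recr/=.
rewrite BE /b (_ : unlift ord_max ord_max = None) ?unlift_none// -DA Dxi addr0.
apply: eq_bigr => i _.
rewrite BE /b (_ : widen_ord _ i = lift ord_max i) ?liftK; last first.
  by apply/val_inj; rewrite /= /bump leqNgt ltn_ord.
by rewrite -DA De dotpZl ee eqxx mulr1.
Qed.

Definition chart E c (r : R) psi := [/\ 0 < r, C2_on (eball c r) psi,
  forall y, eball c r y -> grad psi y != 0 &
  forall y, eball c r y -> (E y <-> psi y <= 0)].

Lemma C2_defining_chart E x U psi : C2_defining E x U psi ->
  exists2 r : R, chart E x r psi & eball x r `<=` U.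
Proof.
move=> [oU Ux psi2 g0 EU].
have /nbhs_eballP[r r0 rU] : nbhs x U by exact: open_nbhs_nbhs.
exists r => //; split => //.
- by split; [exact: C1_on_sub rU psi2.1|move=> v; exact: C1_on_sub rU (psi2.2 v)].
- by move=> y /rU; exact: g0.
- by move=> y /rU; exact: EU.
Qed.

(** At the point itself the divergence of the normal is the sum of the
    principal curvatures, and it is continuous. A positive mean curvature is
    not the default value of [xget], hence principal curvatures exist. *)
Lemma mean_convex_chart E x : 0 < mean_curvature E x ->
  exists (r : R) psi, chart E x r psi /\
    forall y, eball x r y -> 0 < divergence (exterior_normal psi) y.
Proof.
rewrite /mean_curvature; case: xgetP => [H _|_]; last by rewrite ltxx.
move=> [kappa [U [psi [e [Upsi eN ee De]]]] ->] Hpos.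
have [oU Ux psi2 g0 EU] := Upsi.
have X1 := C1_on_exterior_normal oU psi2 g0.
have n0 : (0 < n)%N.
  rewrite lt0n; apply: contraNneq (g0 x Ux) => n0; apply/eqP/rowP => i.
  by have := ltn_ord i; rewrite {2}n0.
have dE : divergence (exterior_normal psi) x = \sum_(i < n.-1) kappa i.
  apply: divergence_orthonormal eN ee De => //; first exact: (X1 _ Ux).1.
  by near=> y; apply/exterior_normal_unit/g0; near: y; exact: open_nbhs_nbhs.
have cD : {for x, continuous (divergence (exterior_normal psi))}.
  exact: C1_on_divergence_continuous X1 Ux.
have /nbhs_eballP[s s0 sD] : nbhs x [set y | 0 < divergence (exterior_normal psi) y].
  by apply: near_gt cD _; rewrite dE.
have [r [r0 c2 gr0 Er] rU] := C2_defining_chart Upsi.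
have sub (t : R) : Num.min r s <= t -> eball x (Num.min r s) `<=` eball x t.
  by move=> rt y /= yr; exact: lt_le_trans yr rt.
have hr := sub r; have hs := sub s; rewrite !ge_min !lexx ?orbT/= in hr hs.
exists (Num.min r s), psi; split; last by move=> y /(hs isT) /sD.
split.
- by rewrite lt_min r0.
- by split; [exact: C1_on_sub (hr isT) c2.1|move=> v; exact: C1_on_sub (hr isT) (c2.2 v)].
- by move=> y /(hr isT); exact: gr0.
- by move=> y /(hr isT); exact: Er.
Unshelve. all: by end_near. Qed.

Lemma near_eball_line c (r : R) y v : eball c r y -> \forall t \near 0^'+, eball c r (t *: v + y).
Proof.
move=> yb; suff : \forall t \near (0 : R), eball c r (t *: v + y) by exact: cvg_at_right_filter.
have cl : (t *: v + y) @[t --> (0 : R)] --> 0 *: v + y.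
  apply: cvgD; last exact: cvg_cst.
  by apply: cvgZl; exact: cvg_id.
by apply: cl; rewrite scale0r add0r; apply: open_nbhs_nbhs; split => //; exact: open_eball.
Qed.

Section chart_theory.
Variables (E : set 'rV[R]_n) (c : 'rV[R]_n) (r : R) (psi : 'rV[R]_n -> R).
Hypothesis ch : chart E c r psi.

Lemma chart_nbhs y : eball c r y -> \forall z \near y, eball c r z.
Proof. by move=> yb; apply: open_nbhs_nbhs; split => //; exact: open_eball. Qed.

Lemma chart_continuous y : eball c r y -> {for y, continuous psi}.
Proof. by have [_ [psi1 _] _ _] := ch; exact: C1_on_continuous psi1. Qed.

Lemma chart_boundary y : eball c r y -> boundary E y -> psi y = 0.
Proof.
have [r0 psi2 g0 EU] := ch => yb [yE yI]; have cy := chart_continuous yb.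
apply/eqP; rewrite eq_le; apply/andP; split; rewrite leNgt; apply/negP => h.
  have [z [zE]] := yE [set z | 0 < psi z /\ eball c r z] (filterI (near_gt cy h) (chart_nbhs yb)).
  by move=> /= [z0 /EU[/(_ zE)]]; rewrite leNgt z0.
apply: yI; rewrite /interior.
apply: filterS (filterI (near_lt cy h) (chart_nbhs yb)).
by move=> z [/= z0 /EU[_]]; apply; exact: ltW.
Qed.

Lemma chart_differentiable y : eball c r y -> differentiable psi y.
Proof. by have [_ [psi1 _] _ _] := ch => /psi1[]. Qed.

(** Moving away from a boundary point in a direction that makes an acute angle
    with the gradient leaves the set. *)
Lemma chart_outside y v : eball c r y -> boundary E y -> 0 < dotp v (grad psi y) ->
  \forall t \near 0^'+, ~ E (t *: v + y).
Proof.
move=> yb yE vg; have dy := chart_differentiable yb.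
have h := derive_sign dy (chart_boundary yb yE); have {}h := h v _.
have {}h := h (etrans (congr1 _ (derive_grad v dy)) vg).
have [_ _ _ EU] := ch.
have hb := near_eball_line v yb.
by apply: filterS (filterI h hb) => t [/= t0 /EU[+ _]] => /[apply]; rewrite leNgt t0.
Qed.

Lemma chart_inside y v : eball c r y -> boundary E y -> dotp v (grad psi y) < 0 ->
  \forall t \near 0^'+, E (t *: v + y) /\ psi (t *: v + y) < 0.
Proof.
move=> yb yE vg; have dy := chart_differentiable yb.
have psiy := chart_boundary yb yE.
have dN : 'D_v (fun y => - psi y) y = - 'D_v psi y by apply: deriveN; exact: diff_derivable.
have h : \forall t \near 0^'+, 0 < - psi (t *: v + y).
  apply: (@derive_sign R n (fun y => - psi y)).
  - exact: differentiableN.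
  - by rewrite psiy oppr0.
  - by rewrite dN (derive_grad v dy) oppr_gt0.
have [_ _ _ EU] := ch.
have hb := near_eball_line v yb.
apply: filterS (filterI h hb) => t [/=]; rewrite oppr_gt0 => t0 /EU[_ h2].
by split => //; apply/h2/ltW.
Qed.

End chart_theory.

(** If two charts had different normals at a boundary point, the difference of the
    normals would point inside the set according to one chart and outside
    according to the other. *)
Lemma chart_normal_unique E c r psi d s phi y : chart E c r psi -> chart E d s phi ->
  eball c r y -> eball d s y -> boundary E y ->
  exterior_normal psi y = exterior_normal phi y.
Proof.
move=> ch1 ch2 yb yd yE; apply/eqP; apply: contraTT isT => h.
pose p := exterior_normal psi y; pose q := exterior_normal phi y.
have [_ _ g1 _] := ch1; have [_ _ g2 _] := ch2.
have p1 : dotp p p = 1 by rewrite -enorm_sqr exterior_normal_unit ?expr1n//; exact: g1.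
have q1 : dotp q q = 1 by rewrite -enorm_sqr exterior_normal_unit ?expr1n//; exact: g2.
have pq : dotp p q < 1 := unit_dotp_lt1 p1 q1 h.
have gE phi' : grad phi' y = enorm (grad phi' y) *: exterior_normal phi' y.
  rewrite /exterior_normal scalerA; have [->|g0] := eqVneq (grad phi' y) 0; first by rewrite scaler0.
  by rewrite mulfV ?scale1r// enorm_eq0.
have n1 : 0 < enorm (grad psi y) by rewrite enorm_gt0; exact: g1.
have n2 : 0 < enorm (grad phi y) by rewrite enorm_gt0; exact: g2.
have o1 : 0 < dotp (p - q) (grad psi y).
  by rewrite gE dotpZr -/p (dotpC (p - q)) dotpBr p1 mulr_gt0// subr_gt0.
have o2 : dotp (p - q) (grad phi y) < 0.
  by rewrite gE dotpZr -/q (dotpC (p - q)) dotpBr q1 (dotpC q p) pmulr_rlt0// subr_lt0.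
have hf := @filterI _ (0^'+) (at_right_proper_filter 0) _ _ (chart_outside ch1 yb yE o1) (chart_inside ch2 yd yE o2).
have [t [h1 [h2 _]]] := filter_ex hf.
by have := h1 h2.
Qed.

End charts.

(** * Calibration by an extension of the exterior normal *)

Lemma cvg_sumR {R : realType} (m : nat) (f : 'I_m -> nat -> R) (l : 'I_m -> R) :
  (forall i, f i k @[k --> \oo] --> l i) ->
  \sum_(i < m) f i k @[k --> \oo] --> \sum_(i < m) l i.
Proof.
elim: m f l => [|m ih] f l fl.
  by rewrite big_ord0; under eq_fun do rewrite big_ord0; exact: cvg_cst.
rewrite big_ord_recr/=; under eq_fun do rewrite big_ord_recr/=.
exact: (cvgD (ih _ _ (fun i => fl _)) (fl _)).
Qed.

Section calibration.
Context {R : realType} {n : nat}.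
Implicit Types (x y v : 'rV[R]_n) (F U V : set 'rV[R]_n) (xi : 'rV[R]_n -> 'rV[R]_n).
Local Notation T := (lebesgue_rV R n).
Local Notation mu := (@lebesgue R n).

Variables (E : set 'rV[R]_n) (m : nat) (c : nat -> 'rV[R]_n) (rad : nat -> R)
  (psi : nat -> 'rV[R]_n -> R).
Hypothesis ch : forall i : 'I_m, chart E (c i) (rad i) (psi i).
Hypothesis cover : forall y, boundary E y -> exists i : 'I_m, eball (c i) (rad i / 2) y.

Let th (i : nat) x : R := plateau (c i) (rad i) x.

Definition pou_rest (k : nat) x : R := \prod_(i < k) (1 - th i x).

(** A partition of unity subordinate to the balls: the [i]-th function takes its
    share of what the previous ones left. *)
Definition pou (i : nat) x : R := th i x * pou_rest i x.

Let th01 i x : 0 <= th i x <= 1. Proof. exact: cutoff01. Qed.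

Lemma pou_rest01 k x : 0 <= pou_rest k x <= 1.
Proof.
elim: k => [|k /andP[h0 h1]]; first by rewrite /pou_rest big_ord0 ler01 lexx.
rewrite /pou_rest big_ord_recr/= -/(pou_rest k x).
have /andP[t0 t1] := th01 k x; rewrite mulr_ge0 ?subr_ge0//= -[leRHS]mulr1.
by apply: ler_pM => //; rewrite ?subr_ge0// gerBl.
Qed.

Lemma pou_ge0 i x : 0 <= pou i x.
Proof. by have /andP[? _] := th01 i x; have /andP[? _] := pou_rest01 i x; exact: mulr_ge0. Qed.

Lemma sum_pou k x : \sum_(i < k) pou i x + pou_rest k x = 1.
Proof.
elim: k => [|k ih]; first by rewrite /pou_rest !big_ord0 add0r.
rewrite big_ord_recr/= -[RHS]ih -addrA; congr (_ + _).
by rewrite /pou [pou_rest k.+1 x]big_ord_recr/= -/(pou_rest k x); ring.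
Qed.

Lemma C1_on_pou_rest k : C1_on setT (pou_rest k).
Proof.
apply: (C1_on_prod openT) => i.
exact: (C1_onB openT (C1_on_cst _) (C1_on_plateau _ _)).
Qed.

Lemma C1_on_pou i : C1_on setT (pou i).
Proof. exact: (C1_onM openT (C1_on_plateau _ _) (C1_on_pou_rest i)). Qed.

Lemma pou_off i x : off_plateau (c i) (rad i) x -> pou i x = 0.
Proof. by move=> /off_plateau0 h; rewrite /pou /th h mul0r. Qed.

Let rad0 (i : 'I_m) : 0 < rad i. Proof. by have [] := ch i. Qed.

Lemma pou_far (i : 'I_m) x : rad i + enorm (c i) < enorm x -> pou i x = 0.
Proof.
move=> h; apply: pou_off; have [xb|//] := ball_or_off_plateau (c i) x (rad0 i).
exfalso; move: xb; rewrite /eball/=; apply/negP; rewrite -leNgt.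
have := enormD (x - c i) (c i); rewrite subrK; lra.
Qed.

(** Near the boundary the functions of the partition add up to 1. *)
Lemma pou_rest_near y : boundary E y -> \forall x \near y, pou_rest m x = 0.
Proof.
move=> /cover[i yi]; near=> x.
have xi : eball (c i) (rad i / 2) x.
  by near: x; apply: open_nbhs_nbhs; split => //; exact: open_eball.
by rewrite /pou_rest (bigD1 i)//= /th plateau1// subrr mul0r.
Unshelve. all: by end_near. Qed.

Let nrm (i : nat) x : 'rV[R]_n := exterior_normal (psi i) x.

Let C1_on_nrm (i : 'I_m) : C1_on (eball (c i) (rad i)) (nrm i).
Proof. by have [_ p2 p0 _] := ch i; exact: (C1_on_exterior_normal (@open_eball _ _ _ _) p2 p0). Qed.

Let local_field (i : nat) x : 'rV[R]_n := pou i x *: nrm i x.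

Let C1c_local_field (i : 'I_m) : C1c (local_field i).
Proof.
apply/C1cP; split; last by exists (rad i + enorm (c i)) => x /pou_far; rewrite /local_field => ->; rewrite scale0r.
exact: (C1_onZ_supp (rad0 i) (C1_on_pou i) (@pou_off i) (@C1_on_nrm i)).
Qed.

(** The exterior normal, extended to a field on the whole space. *)
Definition normal_field x : 'rV[R]_n := \sum_(i < m) local_field i x.

Lemma C1c_normal_field : C1c normal_field.
Proof. by apply: C1c_sum => i; exact: C1c_local_field. Qed.

(** On the boundary the local normals agree, so that the gradients of the partition
    of unity drop out and the divergence is a convex combination of the divergences
    of the local normals. *)
Lemma normal_field_divergence_gt0 y :
  (forall (i : 'I_m) x, eball (c i) (rad i) x -> 0 < divergence (exterior_normal (psi i)) x) ->
  boundary E y -> 0 < divergence normal_field y.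
Proof.
move=> dpos yE; have [i0 yi0] := cover yE.
have yb0 : eball (c i0) (rad i0) y.
  by apply: lt_trans yi0 _; rewrite ltr_pdivrMr// ltr_pMr// ltr1n.
pose nu := nrm i0 y.
have dloc (i : 'I_m) : divergence (local_field i) y =
    pou i y * divergence (nrm i) y + dotp (grad (pou i) y) nu.
  have [yb|yo] := ball_or_off_plateau (c i) y (rad0 i); last first.
    rewrite (divergence_eq (@open_off_plateau _ _ _ _) yo (eta := fun=> 0)); last first.
      by move=> z /pou_off zo; rewrite /local_field zo scale0r.
    rewrite (grad_eq (@open_off_plateau _ _ _ _) yo (g := fun=> 0)); last by move=> z /pou_off.
    by rewrite divergence_cst grad_cst pou_off// mul0r dotpC dotp0r addr0.
  rewrite divergenceZ; [|by apply: (C1_on_pou i (x := y) _).1|exact: (@C1_on_nrm i y yb).1|by apply: ((C1c_local_field i).1 y _).1].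
  by rewrite /nu /nrm (chart_normal_unique (ch i) (ch i0) yb yb0 yE).
rewrite (divergence_sum _ (fun i => (C1c_local_field i).1)).
rewrite (eq_bigr _ (fun i _ => dloc i)) big_split/=.
have -> : \sum_(i < m) dotp (grad (pou i) y) nu = 0.
  have -> : \sum_(i < m) dotp (grad (pou i) y) nu = dotp (\sum_(i < m) grad (pou i) y) nu.
    by elim/big_rec2: _ => [|i a b _ ->]; rewrite ?dotpDl// dotpC dotp0r.
  rewrite -grad_sum; last by move=> i; apply: (C1_on_pou i (x := y) _).1.
  rewrite (_ : grad _ y = 0) ?[dotp 0 _]dotpC ?dotp0r//.
  apply/rowP => j; rewrite !mxE (@near_eq_derive R 'rV[R]_n R^o _ (cst 1)) ?derive_cst//.
  by apply: filterS (pou_rest_near yE) => z z0; rewrite -[RHS](sum_pou m z) z0 addr0.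
have term (i : 'I_m) : 0 <= pou i y * divergence (nrm i) y.
  have [yb|yo] := ball_or_off_plateau (c i) y (rad0 i); last by rewrite pou_off// mul0r.
  by rewrite mulr_ge0 ?pou_ge0// ltW// dpos.
rewrite addr0 lt_def sumr_ge0// andbT psumr_neq0//.
have : \sum_(i < m) pou i y != 0.
  by have := sum_pou m y; rewrite (nbhs_singleton (pou_rest_near yE)) addr0 => ->; exact: oner_neq0.
rewrite psumr_neq0; last by move=> i _; exact: pou_ge0.
move=> /hasP[i im /= hi]; apply/hasP; exists i => //=.
rewrite mulr_gt0//; have [yb|yo] := ball_or_off_plateau (c i) y (rad0 i); first exact: dpos.
by move: hi; rewrite /= pou_off// ltxx.
Qed.

Section test_field.
Variable xi : 'rV[R]_n -> 'rV[R]_n.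
Hypothesis xia : admissible xi.

(** What has to be added to the local part of the normal field in order to
    obtain that of [xi]. *)
Let dfield (i : nat) x : 'rV[R]_n := pou i x *: (xi x - nrm i x).

Let dfieldE i : dfield i = fun x => pou i x *: xi x - local_field i x.
Proof. by apply/funext => x; rewrite /dfield scalerBr. Qed.

Let C1c_dfield (i : 'I_m) : C1c (dfield i).
Proof.
rewrite dfieldE; exact: (C1cD (C1cZ (C1_on_pou i) xia.1) (C1cN (C1c_local_field i))).
Qed.

(** Equal to 1 on the set, and to 0 where the defining function exceeds [1 /
    (k + 1)]; it tends to the indicator of the set. *)
Let cut (k i : nat) x : R := cutoff (k.+1%:R * psi i x).

Let C1_on_cut k (i : 'I_m) : C1_on (eball (c i) (rad i)) (cut k i).
Proof.
apply: (C1_on_cutoff (@open_eball _ _ _ _)).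
have [_ [p1 _] _ _] := ch i.
exact: (C1_onM (@open_eball _ _ _ _) (C1_on_cst _) p1).
Qed.

Let C1_on_cut_dfield k (i : 'I_m) : C1_on setT (fun x => cut k i x *: dfield i x).
Proof.
rewrite (_ : (fun x => _) = fun x => pou i x *: (cut k i x *: (xi x - nrm i x))); last first.
  by apply/funext => x; rewrite /dfield !scalerA mulrC.
apply: (C1_onZ_supp (rad0 i) (C1_on_pou i) (@pou_off i)).
have ob := @open_eball R n (c i) (rad i).
exact: (C1_onZ ob (@C1_on_cut k i) (C1_onB ob (C1_on_sub (@subsetT _ _) xia.1.1) (@C1_on_nrm i))).
Qed.

Let dfield_off i x : off_plateau (c i) (rad i) x -> dfield i x = 0.
Proof. by move=> /pou_off h; rewrite /dfield h scale0r. Qed.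

Let div_dfield_off i x : off_plateau (c i) (rad i) x -> divergence (dfield i) x = 0.
Proof.
move=> xo; rewrite (divergence_eq (@open_off_plateau _ _ _ _) xo (eta := fun=> 0)) ?divergence_cst//.
by move=> z; exact: dfield_off.
Qed.

Let C1c_cut_dfield k (i : 'I_m) : C1c (fun x => cut k i x *: dfield i x).
Proof.
apply/C1cP; split; first exact: C1_on_cut_dfield.
by exists (rad i + enorm (c i)) => x /pou_far h; rewrite /dfield h scale0r scaler0.
Qed.

(** The cutoff decreases along the normal, and [xi] does not exceed the normal in
    that direction. *)
Let div_cut_dfield k (i : 'I_m) x :
  cut k i x * divergence (dfield i) x <= divergence (fun x => cut k i x *: dfield i x) x.
Proof.
have [xb|xo] := ball_or_off_plateau (c i) x (rad0 i); last first.
  rewrite (div_dfield_off xo) mulr0 (divergence_eq (@open_off_plateau _ _ _ _) xo (eta := fun=> 0)).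
    by rewrite divergence_cst.
  by move=> z /dfield_off ->; rewrite scaler0.
rewrite divergenceZ; [|exact: (@C1_on_cut k i x xb).1|by apply: ((C1c_dfield i).1 x _).1|by apply: (@C1_on_cut_dfield k i x _).1].
rewrite lerDl; have [_ [p1 _] _ _] := ch i.
have kp1 := C1_onM (@open_eball _ _ _ _) (C1_on_cst (k.+1%:R : R)) p1.
have -> : grad (cut k i) x = (derive1 (@cutoff R) (k.+1%:R * psi i x) * k.+1%:R) *: grad (psi i) x.
  apply/rowP => j; rewrite !mxE.
  have [cd _ _] := cutoff_derive (k.+1%:R * psi i x).
  have [_ ->] := derive_comp1 (delta_mx 0 j) (kp1 _ xb).1 cd.
  rewrite -mulrA; congr (_ * _).
  have dp := diff_derivable (v := delta_mx 0 j) (p1 _ xb).1.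
  by rewrite (deriveM (derivable_cst _ _ _) dp) derive_cst scaler0 addr0.
rewrite dotpZl /dfield dotpZr dotpBr dotp_grad_normal mulrCA mulr_ge0 ?pou_ge0//.
have [_ cd _] := cutoff_derive (k.+1%:R * psi i x).
rewrite mulr_le0// ?mulr_le0_ge0// subr_le0.
apply: le_trans (cauchy_schwarz _ _) _; rewrite -[leRHS]mulr1 ler_wpM2l ?enorm_ge0//.
exact: xia.2.
Qed.

Let rest_field x : 'rV[R]_n := pou_rest m x *: xi x.

Let C1c_rest_field : C1c rest_field := C1cZ (C1_on_pou_rest m) xia.1.

(* Off the boundary the indicator is locally constant; near it the remaining field
   vanishes. *)
Let indic_rest_field :
  C1c (fun x => \1_E x *: rest_field x) /\
  forall x, divergence (fun x => \1_E x *: rest_field x) x = \1_E x * divergence rest_field x.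
Proof.
have loc x : exists2 a : R, a = \1_E x \/ (\near x, rest_field x = 0) & \near x, \1_E x *: rest_field x = a *: rest_field x.
  have [xE|xE] := pselect (boundary E x).
    have xr : \near x, rest_field x = 0.
      by apply: filterS (pou_rest_near xE) => z z0; rewrite /rest_field z0 scale0r.
    by exists 0; [right|apply: filterS xr => z ->; rewrite !scaler0].
  exists (\1_E x); first by left.
  have [xI|xI] := pselect (interior E x).
    by apply: filterS (xI) => z zE; rewrite !indicE !mem_set//; exact: nbhs_singleton xI.
  have xC : ~ closure E x by move=> xC; apply: xE; split.
  have : \near x, ~ E x.
    apply: contrapT => h; apply: xC => V xV; apply: contrapT => hV; apply: h.
    by apply: filterS xV => z zV zE; apply: hV; exists z.
  move=> xN; apply: filterS (xN) => z zE.
  by rewrite !indicE !memNset//; exact: nbhs_singleton xN.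
have [r1 [M hM]] := (C1cP rest_field).1 C1c_rest_field.
have div x : divergence (fun x => \1_E x *: rest_field x) x = \1_E x * divergence rest_field x.
  have [a a1 a2] := loc x.
  have e1 : divergence (fun x => \1_E x *: rest_field x) x = a * divergence rest_field x.
    have : divergence (fun x => \1_E x *: rest_field x) x = divergence (fun x => a *: rest_field x) x.
      by apply: eq_bigr => i _; rewrite (near_eq_derive _ a2).
    move=> ->; rewrite divergenceZ; [|exact: differentiable_cst|by apply: (r1 x _).1|].
      by rewrite grad_cst dotpC dotp0r addr0.
    by apply: differentiableZ; apply: (r1 x _).1.
  case: a1 => [<-//|r0]; rewrite e1.
  rewrite (_ : divergence rest_field x = 0) ?mulr0//.
  have : divergence rest_field x = divergence (fun=> 0) x.
    by apply: eq_bigr => i _; rewrite (near_eq_derive _ r0).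
  by rewrite divergence_cst.
split; last exact: div.
apply/C1cP; split; last by exists M => x /hM ->; rewrite scaler0.
move=> x _; have [a _ /nbhs_eballP[r r0 hr]] := loc x.
have h1 : C1_on (eball x r) (fun x => a *: rest_field x).
  exact: (C1_onZ (@open_eball _ _ _ _) (C1_on_cst a) (C1_on_sub (@subsetT _ _) r1)).
apply: (C1_on_eq (@open_eball _ _ _ _) _ h1 (eball_center x r0)) => y yr.
by rewrite (hr y yr).
Qed.

(** The test fields: in the partition of unity they are convex combinations of
    the normal, far outside, and of [xi], inside. *)
Let test (k : nat) x : 'rV[R]_n := normal_field x + (\sum_(i < m) cut k i x *: dfield i x + \1_E x *: rest_field x).

Let C1c_test k : C1c (test k).
Proof.
apply: (C1cD C1c_normal_field); apply: (C1cD _ indic_rest_field.1).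
by apply: (@C1c_sum _ _ _ _ (fun (i : 'I_m) x => cut k i x *: dfield i x)) => i; exact: C1c_cut_dfield.
Qed.

Let test_admissible k : admissible (test k).
Proof.
split; first exact: C1c_test.
move=> x; rewrite /test /normal_field addrA -big_split/=.
rewrite -(sum_pou m x).
have step (i : 'I_m) : enorm (local_field i x + cut k i x *: dfield i x) <= pou i x.
  have -> : local_field i x + cut k i x *: dfield i x =
      pou i x *: ((1 - cut k i x) *: nrm i x + cut k i x *: xi x).
    have alg (a b : R) (u w : 'rV[R]_n) : a *: u + b *: (a *: (w - u)) = a *: ((1 - b) *: u + b *: w).
      by apply/rowP => j; rewrite !mxE; ring.
    exact: alg.
  rewrite enormZ (ger0_norm (pou_ge0 i x)) -[leRHS]mulr1 ler_wpM2l ?pou_ge0//.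
  exact: (norm_convex (cutoff01 _) (exterior_normal_le1 _ _) (xia.2 _)).
apply: le_trans (enormD _ _) _; apply: lerD.
  elim/big_rec2: _ => [|i a b _ ih]; first by rewrite enorm0.
  by rewrite (le_trans (enormD _ _))// lerD.
have /andP[w0 w1] := pou_rest01 m x.
rewrite enormZ -[leRHS]mul1r ler_pM ?normr_ge0 ?enorm_ge0//.
  by rewrite indicE; case: (_ \in _); rewrite ?normr1 ?normr0.
by rewrite /rest_field enormZ (ger0_norm w0) ler_piMr//; exact: xia.2.
Qed.

(** A lower bound of the divergence of the test fields, in which the
    derivatives of the cutoff have been dropped because of their sign. Unlike
    the divergences themselves it is bounded uniformly in [k]. *)
Let lower (k : nat) x : R := divergence normal_field x +
  (\sum_(i < m) cut k i x * divergence (dfield i) x + \1_E x * divergence rest_field x).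

Let lower_le k x : lower k x <= divergence (test k) x.
Proof.
have N1 := C1c_normal_field.1; have I1 := indic_rest_field.1.1.
have S1 : C1_on setT (fun x => \sum_(i < m) cut k i x *: dfield i x).
  exact: (C1_on_sum _ openT (fun i _ => @C1_on_cut_dfield k i)).
rewrite /test divergenceD; [|by apply: (N1 x _).1|by apply: (C1_onD openT S1 I1 (x := x) _).1].
rewrite divergenceD; [|by apply: (S1 x _).1|by apply: (I1 x _).1].
rewrite (divergence_sum _ (C1_on_cut_dfield k)) indic_rest_field.2.
by rewrite lerD2l lerD2r; apply: ler_sum => i _; exact: div_cut_dfield.
Qed.

Let cut_dfield_Cc k (i : 'I_m) : Cc (fun x => cut k i x * divergence (dfield i) x).
Proof.
split; last by have [_ [M hM]] := Cc_divergence (C1c_dfield i); exists M => x /hM ->; rewrite mulr0.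
apply: (@continuous_supp _ _ (c i) (rad i) (cut k i) _ (rad0 i)); last by have [] := Cc_divergence (C1c_dfield i).
  by move=> x xb; exact: (C1_on_continuous (@C1_on_cut k i) xb).
by move=> x; exact: div_dfield_off.
Qed.

Hypothesis mE : measurable (E : set T).

Let target x : R := \1_E x * divergence xi x + (1 - \1_E x) * divergence normal_field x.

Let targetE x : \1_E x * divergence xi x + (1 - \1_E x) * divergence normal_field x = divergence normal_field x +
  (\sum_(i < m) \1_E x * divergence (dfield i) x + \1_E x * divergence rest_field x).
Proof.
have -> : divergence xi x = divergence normal_field x +
    (\sum_(i < m) divergence (dfield i) x + divergence rest_field x).
  rewrite -(divergence_sum _ (fun i => (C1c_dfield i).1)).
  have S1 : C1_on setT (fun x => \sum_(i < m) dfield i x).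
    exact: (C1_on_sum _ openT (fun i _ => (C1c_dfield i).1)).
  have N1 := C1c_normal_field.1; have r1 := C1c_rest_field.1.
  rewrite -divergenceD; [|by apply: (S1 x _).1|by apply: (r1 x _).1].
  rewrite -divergenceD; [|by apply: (N1 x _).1|by apply: (C1_onD openT S1 r1 (x := x) _).1].
  congr (divergence _ x); apply/funext => z.
  rewrite /normal_field addrA -big_split/= (eq_bigr (fun i : 'I_m => pou i z *: xi z)); last first.
    by move=> i _; rewrite dfieldE addrC subrK.
  by rewrite -scaler_suml -scalerDl sum_pou scale1r.
by rewrite -mulr_sumr; ring.
Qed.

Let lower_cvg x : lower k x @[k --> \oo] --> target x.
Proof.
rewrite /target targetE; apply: cvgD; first exact: cvg_cst.
apply: cvgD; last exact: cvg_cst.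
apply: cvg_sumR => i.
have [xb|xo] := ball_or_off_plateau (c i) x (rad0 i); last first.
  by rewrite (div_dfield_off xo); under eq_fun do rewrite mulr0; rewrite mulr0; exact: cvg_cst.
apply: cvgM; last exact: cvg_cst.
have [_ _ _ /(_ x xb) Ex] := ch i.
apply: cvg_near_cst; rewrite indicE.
have [p0|p0] := leP (psi i x) 0.
  near=> k; rewrite mem_set; last exact/Ex.
  by rewrite /cut cutoff1// pmulr_rle0.
rewrite memNset; last by move=> /Ex; rewrite leNgt p0.
near=> k; rewrite /cut cutoff0// -ler_pdivrMr// div1r ltW//.
near: k.
have [N _ hN] := near_infty_natSinv_lt (PosNum p0).
exists N => // k /= Nk; have := hN k Nk => /=.
by rewrite invf_plt ?posrE.
Unshelve. all: by end_near. Qed.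

Let lower_Bc k : Bc (lower k).
Proof.
have bI : Bc (fun x => \1_E x * divergence rest_field x) := Bc_indic mE (Bc_div C1c_rest_field).
apply: (BcD (Bc_div C1c_normal_field) (BcD _ bI)).
exact: (Bc_sum _ (fun i : 'I_m => Cc_Bc (cut_dfield_Cc k i))).1.
Qed.

(** The perimeter of [F] is bounded from below by testing with [xi] inside [E]
    and with the normal field outside. The jump of this field across the
    boundary of [E] has a favourable sign, since [xi] does not exceed the
    normal in normal direction; the test fields above interpolate, and the
    limit is taken in their lower bounds. *)
Lemma calibration_test F : measurable (F : set T) ->
  ((\int[mu]_(x in F) target x)%:E <= perimeter F)%E.
Proof.
move=> mF.
have [Cn Cn0 hCn] := Cc_bounded (Cc_divergence C1c_normal_field).
have [Cr Cr0 hCr] := Cc_bounded (Cc_divergence C1c_rest_field).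
have [Mn hMn] := (Cc_divergence C1c_normal_field).2.
have [Mr hMr] := (Cc_divergence C1c_rest_field).2.
have /choice[Cd hCd] : forall i : 'I_m, exists C : R, forall x, `|divergence (dfield i) x| <= C.
  by move=> i; have [C _ hC] := Cc_bounded (Cc_divergence (C1c_dfield i)); exists C.
have /choice[Md hMd] : forall i : 'I_m, exists M : R, forall x, M < enorm x -> divergence (dfield i) x = 0.
  by move=> i; have [_ [M hM]] := Cc_divergence (C1c_dfield i); exists M.
have Cd0 i : 0 <= Cd i by exact: le_trans (normr_ge0 _) (hCd i 0).
pose M := Num.max (Num.max Mn Mr) (\big[Num.max/0]_(i < m) Md i).
have [||||_ h] := @bounded_convergence R n F lower target (Cn + (\sum_(i < m) Cd i + Cr)) M mF.
- by move=> k; have [] := lower_Bc k.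
- move=> k x; rewrite /lower; apply: le_trans (ler_normD _ _) _; apply: lerD => //.
  apply: le_trans (ler_normD _ _) _; apply: lerD.
    apply: le_trans (ler_norm_sum _ _ _) _; apply: ler_sum => i _.
    have /andP[c0 c1] := cutoff01 (k.+1%:R * psi i x).
    by rewrite normrM -[leRHS]mul1r ler_pM// ger0_norm.
  rewrite normrM -[leRHS]mul1r ler_pM//.
  by rewrite indicE; case: (_ \in _); rewrite ?normr1 ?normr0.
- move=> k x; rewrite /M !gt_max => /andP[/andP[xn xr] xd].
  rewrite /lower hMn// hMr// mulr0 addr0 add0r big1// => i _.
  rewrite hMd ?mulr0//; apply: le_lt_trans xd.
  exact: (le_bigmax _ Md i).
- exact: lower_cvg.
rewrite -(cvg_lim _ h)//.
have [Pfin|] := ltP (perimeter F) +oo%E; last by rewrite leye_eq => /eqP ->; rewrite leey.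
rewrite -(fineK (perimeter_fin_num Pfin)) lee_fin; apply: limr_le; first by apply/cvg_ex; eexists; exact: h.
near=> k.
apply: le_trans (le_Bc_int mF (lower_Bc k) (Bc_div (C1c_test k)) (fun x _ => lower_le k x)) _.
have := perimeter_ge mF (test_admissible k).
by rewrite -{1}(fineK (perimeter_fin_num Pfin)) lee_fin.
Unshelve. all: by end_near. Qed.

End test_field.

End calibration.

(** * Calibration of a mean convex set *)

Section mean_convex.
Context {R : realType} {n : nat}.
Implicit Types (x y z v : 'rV[R]_n) (E F : set 'rV[R]_n) (xi : 'rV[R]_n -> 'rV[R]_n).
Local Notation T := (lebesgue_rV R n).
Local Notation mu := (@lebesgue R n).

Lemma boundary_closed E : closed (boundary E).
Proof.
rewrite /boundary setDE; apply: closedI; first exact: closed_closure.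
by apply: open_closedC; exact: open_interior.
Qed.

Lemma compact_boundary E : compact E -> compact (boundary E).
Proof.
move=> cE; have sub : boundary E `<=` E.
  move=> x [xE _]; move: xE; rewrite -(closure_id E).1//.
  by apply: compact_closed cE; exact: norm_hausdorff.
by apply: (@subclosed_compact _ _ E); [exact: boundary_closed|exact: cE|exact: sub].
Qed.

(** The calibration is the divergence [g] of the extended exterior normal. It
    is positive on the boundary, which is compact, and therefore bounded from
    below by a positive constant on a neighbourhood of uniform size. *)
Lemma mean_convex_calibration E : measurable (E : set T) -> compact (boundary E) ->
  (forall x, boundary E x -> 0 < mean_curvature E x) ->
  exists (g : 'rV[R]_n -> R) (delta : R), [/\ 0 < delta, Cc g,
    forall x y, boundary E y -> enorm (x - y) < delta -> delta <= g x &
    forall F xi, measurable (F : set T) -> admissible xi ->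
      ((\int[mu]_(x in F `&` E) divergence xi x + \int[mu]_(x in F `\` E) g x)%:E <=
       perimeter F)%E].
Proof.
move=> mE cE mc.
have /choice[p hp] : forall x, exists p : R * ('rV[R]_n -> R), boundary E x ->
    chart E x p.1 p.2 /\ forall y, eball x p.1 y -> 0 < divergence (exterior_normal p.2) y.
  move=> x; have [xE|xE] := pselect (boundary E x); last by exists (0, cst 0).
  by have [r [psi h]] := mean_convex_chart (mc x xE); exists (r, psi).
have := cE; rewrite compact_cover => /(_ 'rV[R]_n (boundary E) (fun x => eball x ((p x).1 / 2))).
have r0 x : boundary E x -> 0 < (p x).1 by move=> /hp[[]].
move=> /(_ (fun x _ => @open_eball _ _ x _)) []; first by move=> x xE; exists x => //; apply: eball_center; rewrite divr_gt0 ?r0.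
move=> D DE Dcover.
pose s := finmap.enum_fset D; pose m := size s.
pose c i := nth 0 s i.
have cE' (i : 'I_m) : boundary E (c i).
  by have := DE (c i); rewrite inE; apply; exact: mem_nth.
have ch (i : 'I_m) : chart E (c i) (p (c i)).1 (p (c i)).2 by have [] := hp _ (cE' i).
have cov y : boundary E y -> exists i : 'I_m, eball (c i) ((p (c i)).1 / 2) y.
  move=> /Dcover[d /= dD yd]; have ds : d \in s by [].
  by exists (Ordinal (eqbRL (index_mem d s) ds)); rewrite /c/= nth_index.
pose X := normal_field m c (fun i => (p (c i)).1) (fun i => (p (c i)).2).
have X1 : C1c X := C1c_normal_field ch.
have g0 y : boundary E y -> 0 < divergence X y.
  move=> yE; apply: (normal_field_divergence_gt0 ch cov) => // i x.
  by have [_] := hp _ (cE' i); exact.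
have gc := Cc_divergence X1.
(* The same [delta] serves as the size of the neighbourhood and as the lower
   bound. *)
have near_cov := (compact_near_coveringP _).1 cE.
have : \forall t \near 0^'+, boundary E `<=` (fun y => forall x, enorm (x - y) < t -> t <= divergence X x).
  apply: near_cov => y yE; have gy := g0 y yE.
  pose a := divergence X y / 2.
  have a0 : 0 < a by rewrite divr_gt0.
  have ag : a < divergence X y by rewrite /a ltr_pdivrMr// ltr_pMr// ltr1n.
  have /nbhs_eballP[r rr0 hr] := near_gt (gc.1 y) ag.
  exists (eball y (r / 2), [set t | t < r / 2 /\ t < a]).
    split=> /=; first by apply: open_nbhs_nbhs; split; [exact: open_eball|apply: eball_center; rewrite divr_gt0].
    by apply: filterI; [exact: nbhs_right_lt (divr_gt0 rr0 _)|exact: nbhs_right_lt].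
  move=> [y' t] /= [yy' [tr ta]] x xt; apply/ltW/(lt_trans ta)/hr.
  rewrite /eball/= (le_lt_trans (enorm_triangle y' _ _))//.
  by rewrite (splitr r) ltrD// (lt_trans xt).
move=> h; have hf := @filterI _ (0^'+) (at_right_proper_filter 0) _ _ h (nbhs_right_gt 0).
have [delta [hd d0]] := filter_ex hf.
exists (divergence X), delta; split => //.
  by move=> x y yE; exact: hd.
move=> F xi mF xia.
have bX := Cc_Bc gc; have bxi := Bc_div xia.1.
have := @calibration_test R n E m c (fun i => (p (c i)).1) (fun i => (p (c i)).2) ch cov xi xia mE F mF; congr (_%:E <= _)%E.
rewrite setDE !Bc_int_indic.
have b1 := Bc_indic mE bxi.
have mEC : measurable (~` E : set T) by exact: measurableC.
rewrite -(Bc_intD mF b1 (Bc_indic mEC bX)).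
congr Rintegral; apply/funext => x; rewrite -/X; congr (_ + _ * _).
by rewrite !indicE in_setC; case: (_ \in _); rewrite ?subrr ?subr0.
Qed.

End mean_convex.

(** * Distance to the boundary and essential points *)

Section distance.
Context {R : realType} {n : nat}.
Implicit Types (x y z v : 'rV[R]_n) (A E F : set 'rV[R]_n).
Local Notation T := (lebesgue_rV R n).
Local Notation mu := (@lebesgue R n).

Lemma edist_le A x y : A y -> (edist_to x A <= (enorm (x - y))%:E)%E.
Proof. by move=> Ay; apply: ereal_inf_lbound; exists y. Qed.

Lemma edist_geP A x (a : \bar R) :
  (forall y, A y -> (a <= (enorm (x - y))%:E)%E) -> (a <= edist_to x A)%E.
Proof. by move=> h; apply: le_ereal_inf_tmp => _ [y Ay <-]; exact: h. Qed.

Lemma edist_ge0 A x : (0 <= edist_to x A)%E.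
Proof. by apply: edist_geP => y _; rewrite lee_fin enorm_ge0. Qed.

Lemma edist_ltP A x (a : R) : (edist_to x A < a%:E)%E -> exists2 y, A y & enorm (x - y) < a.
Proof. by move=> /ereal_inf_lt[_ [y Ay <-]]; rewrite lte_fin => h; exists y. Qed.

Lemma measurable_edist A : measurable_fun setT (fun x : T => edist_to x A).
Proof.
apply: (measurability _ (ErealGenInftyO.measurableE R)).
move=> _ [_ [r ->] <-]; rewrite setTI.
rewrite (_ : _ @^-1` _ = \bigcup_(y in A) eball y r).
  by apply: lebesgue_measurable_open; apply: bigcup_open => y _; exact: open_eball.
apply/seteqP; split=> x /=.
  by rewrite in_itv/= => /edist_ltP[y Ay xy]; exists y.
move=> [y Ay xy]; rewrite in_itv/=; apply: le_lt_trans (edist_le x Ay) _.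
by rewrite lte_fin.
Qed.

Lemma nbhs_shift_set A v x : nbhs x (shift_set A v) <-> nbhs (x + v) A.
Proof.
split=> /nbhs_eballP[r r0 rA]; apply/nbhs_eballP; exists r => // y.
  move=> yr; have := rA (y - v); rewrite /shift_set/= subrK; apply.
  by move: yr; rewrite /eball/= opprD addrCA addrC.
by move=> yr; apply: rA; move: yr; rewrite /eball/= opprD addrACA subrr addr0.
Qed.

Lemma boundary_shift A v : boundary (shift_set A v) = shift_set (boundary A) v.
Proof.
have cl x : closure (shift_set A v) x <-> closure A (x + v).
  split=> h B hB.
    have /h : nbhs x (shift_set B v) by exact/nbhs_shift_set.
    by move=> [y [Ay By]]; exists (y + v).
  have /h : nbhs (x + v) (shift_set B (- v)) by apply/nbhs_shift_set; rewrite addrK.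
  by move=> [y [Ay By]]; exists (y - v); split => //; rewrite /shift_set/= subrK.
apply/seteqP; split=> x [xc xI]; split.
- exact/cl.
- by move=> h; apply: xI; exact/nbhs_shift_set.
- exact/cl.
- by move=> h; apply: xI; exact/nbhs_shift_set.
Qed.

Lemma edist_shift A v x : edist_to x (shift_set A v) = edist_to (x + v) A.
Proof.
apply/eqP; rewrite eq_le; apply/andP; split; apply: edist_geP => y Ay.
  rewrite (_ : x + v - y = x - (y - v)); last by rewrite opprB addrA addrAC.
  by apply: edist_le; rewrite /shift_set/= subrK.
rewrite (_ : x - y = x + v - (y + v)); last by rewrite opprD addrACA subrr addr0.
exact: edist_le.
Qed.

(** The boundary point is the last one up to which the segment meets the set;
    this is a supremum of parameters. *)
Lemma segment_boundary A x y : A x -> ~ A y ->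
  exists2 t : R, 0 <= t <= 1 & boundary A (x + t *: (y - x)).
Proof.
move=> Ax Ay; pose S := [set t : R | 0 <= t <= 1 /\ A (x + t *: (y - x))].
have S0 : S 0 by split; rewrite ?lexx ?ler01// scale0r addr0.
have Sub : ubound S 1 by move=> t [/andP[]].
have hS : has_sup S by split; [exists 0|exists 1].
pose t := sup S.
have t0 : 0 <= t by apply: ub_le_sup => //; exists 1.
have t1 : t <= 1 by apply: ge_sup => //; exists 0.
have dist (s : R) : x + s *: (y - x) - (x + t *: (y - x)) = (s - t) *: (y - x).
  by rewrite opprD addrACA subrr add0r scalerBl.
pose l := enorm (y - x) + 1.
have l0 : 0 < l by rewrite ltr_wpDl ?enorm_ge0.
exists t; first by rewrite t0.
split.
  move=> B /nbhs_eballP[r r0 rB].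
  have rl : 0 < r / l by rewrite divr_gt0.
  have [s Ss st] := sup_adherent rl hS.
  have s_le : s <= t by apply: ub_le_sup => //; exists 1.
  exists (x + s *: (y - x)); split; first exact: Ss.2.
  apply: rB; rewrite /eball/= dist enormZ distrC ger0_norm ?subr_ge0//.
  have h : t - s < r / l by move: st; rewrite -/t; lra.
  apply: (@le_lt_trans _ _ ((t - s) * l)); first by rewrite ler_wpM2l ?subr_ge0// lerDl.
  by rewrite -ltr_pdivlMr.
move=> /nbhs_eballP[r r0 rA].
have [t1'|t1'] := ltP t 1; last first.
  apply: Ay; have t_1 : t = 1 by apply/eqP; rewrite eq_le t1.
  have := rA (x + t *: (y - x)) (eball_center _ r0).
  by rewrite t_1 scale1r addrC subrK.
pose s := Num.min 1 (t + r / l / 2).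
have rl : 0 < r / l / 2 by rewrite !divr_gt0.
have ts : t < s by rewrite lt_min t1' ltrDl.
suff : S s by move=> Ss; have := ub_le_sup (ex_intro _ 1 Sub) Ss; rewrite leNgt -/t ts.
split; first by rewrite (le_trans t0 (ltW ts)) ge_min lexx.
apply: rA; rewrite /eball/= dist enormZ ger0_norm ?subr_ge0 ?(ltW ts)//.
have st : s - t <= r / l / 2 by rewrite lerBlDl ge_min lexx orbT.
apply: (@le_lt_trans _ _ (r / l / 2 * l)).
  by apply: ler_pM; rewrite ?enorm_ge0 ?subr_ge0 ?(ltW ts)// lerDl.
by rewrite mulrAC divfK ?gt_eqF// ltr_pdivrMr// ltr_pMr// ltr1n.
Qed.

(** The support of the restriction of the Lebesgue measure to [A]; it does not
    change when [A] is modified by a null set. *)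
Definition ess_support A : set 'rV[R]_n :=
  [set y | forall r : R, 0 < r -> (0 < mu (A `&` eball y r))%E].

(** No boundary point is produced by a null part of the set or of its
    complement. This makes pointwise distances to the boundary comparable with
    relations between sets that hold up to null sets. *)
Definition essential_boundary A :=
  forall y, boundary A y -> ess_support A y /\ ess_support (~` A) y.

Lemma boundaryC A : boundary (~` A) = boundary A.
Proof.
by rewrite /boundary closure_setC interiorC !setDE setCK setIC.
Qed.

Hypothesis mu_neq0 : mu setT != 0%E.

Lemma interior_ess_support A y : interior A y -> ess_support A y.
Proof.
move=> /nbhs_eballP[s s0 sA] r r0; have rs : 0 < Num.min r s by rewrite lt_min r0.
apply: lt_le_trans (lebesgue_eball_gt0 y mu_neq0 rs) _.
apply: le_lebesgue_outer => z; rewrite /eball/= lt_min => /andP[zr zs].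
by split => //; exact: sA.
Qed.

Lemma essential_boundary_mem A y : essential_boundary A -> A y -> ess_support A y.
Proof.
move=> eA Ay; have [yI|yI] := pselect (interior A y); first exact: interior_ess_support.
by apply: (eA y _).1; split => //; exact: subset_closure.
Qed.

Lemma essential_boundaryC A : essential_boundary A -> essential_boundary (~` A).
Proof. by move=> eA y; rewrite boundaryC setCK => /eA[]. Qed.

(** If the end of the segment were outside the set, the segment would meet the
    boundary, at a distance that is at least its length; hence the end point
    is itself a boundary point. *)
Lemma edist_ess_support A x y : essential_boundary A -> A x ->
  ((enorm (x - y))%:E <= edist_to x (boundary A))%E -> ess_support A y.
Proof.
move=> eA Ax xy; have [Ay|Ay] := pselect (A y); first exact: essential_boundary_mem.
have [t /andP[t0 t1] tb] := segment_boundary Ax Ay.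
have := le_trans xy (edist_le x tb).
rewrite opprD addrA subrr add0r -scalerN opprB enormZ ger0_norm// lee_fin => h.
suff -> : y = x + t *: (y - x) by exact: (eA _ tb).1.
have [->|xy0] := eqVneq x y; first by rewrite subrr scaler0 addr0.
have n0 : 0 < enorm (x - y) by rewrite enorm_gt0 subr_eq0.
have -> : t = 1 by apply/eqP; rewrite eq_le t1/= -(ler_pM2r n0) mul1r.
by rewrite scale1r addrC subrK.
Qed.

End distance.

(** * Sets nested at a positive distance *)

Section nested.
Context {R : realType} {n : nat}.
Implicit Types (x y z v w : 'rV[R]_n) (A C E F G : set 'rV[R]_n) (rho : R).
Local Notation T := (lebesgue_rV R n).
Local Notation mu := (@lebesgue R n).

Lemma lebesgue_null_sub A C : A `<=` C -> mu C = 0%E -> mu A = 0%E.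
Proof.
move=> AC C0; apply/eqP; rewrite eq_le lebesgue_outer_ge0 andbT -C0.
exact: le_lebesgue_outer.
Qed.

Lemma lebesgue_nullU A C : mu A = 0%E -> mu C = 0%E -> mu (A `|` C) = 0%E.
Proof.
move=> A0 C0; apply/eqP; rewrite eq_le lebesgue_outer_ge0 andbT.
by rewrite (le_trans (outer_measureU2 _ _ _))//= -/(mu A) -/(mu C) A0 C0 adde0.
Qed.

Lemma Rintegral_indic A : measurable (A : set T) -> \int[mu]_x \1_A x = fine (mu A).
Proof. by move=> mA; rewrite /Rintegral integral_indic// setIT. Qed.

Lemma Rintegral_eq0 (f : T -> R) : (forall x, f x = 0) -> \int[mu]_x f x = 0.
Proof. by move=> f0; rewrite /Rintegral integral0_eq// => x _; rewrite f0. Qed.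

Lemma measurable_cap_ball A y (r : R) : measurable (A : set T) ->
  measurable (A `&` eball y r : set T) /\ (mu (A `&` eball y r) < +oo)%E.
Proof.
move=> mA; split; first by apply: measurableI => //; exact: measurable_eball.
apply: (@lebesgue_bounded_lty _ _ _ (r + enorm y)) => x [_]; rewrite /eball/= => xr.
by have := enormD (x - y) y; rewrite subrK; lra.
Qed.

Let translation_between x y z w rho : enorm (x - z) < (rho - enorm (y - z)) / 2 ->
  enorm (x + w - y) < (rho - enorm (y - z)) / 2 -> enorm w < rho.
Proof.
move=> d g; have h2 := enormD (x + w - y) (y - x); rewrite addrA subrK addrAC subrr add0r in h2.
by have := enormD (y - z) (z - x); rewrite addrA subrK (enormB z x); lra.
Qed.

(** If two sets have positive measure near two points at distance less than [rho],
    some translation by less than [rho] makes them overlap: the overlap measure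
    integrates, over all translations, to the product of the two measures. *)
Lemma ess_support_overlap A C y z rho : measurable (A : set T) -> measurable (C : set T) ->
  ess_support A y -> ess_support C z -> enorm (y - z) < rho ->
  exists2 w, enorm w < rho & (0 < mu (C `&` shift_set A w))%E.
Proof.
move=> mA mC Ay Cz yz; apply: contrapT => /forall2NP h.
pose r := (rho - enorm (y - z)) / 2.
have r0 : 0 < r by rewrite divr_gt0// subr_gt0.
have r2 : r <= 2 * r by rewrite ler_peMl ?ler1n// ltW.
have [mA' A'oo] := measurable_cap_ball y r mA; have [mC' C'oo] := measurable_cap_ball z r mC.
(* Measurability on the product space is available for preimages of Borel sets,
   hence the passage to a Borel hull [G] of [A] near [y]. *)
have [H [bH A'H HA]] := borel_hull (A `&` eball y r).
have mH : measurable (H : set T) := measurable_borel bH.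
pose G : set 'rV[R]_n := H `&` eball y r; pose D : set 'rV[R]_n := C `&` eball z r.
have bG : measurable (G : set (borel_rV R n)).
  by apply: measurableI => //; apply: sub_sigma_algebra; exact: open_eball.
have mG : measurable (G : set T) := measurable_borel bG.
have A'G : A `&` eball y r `<=` G by move=> x Ax; split; [exact: A'H|exact: Ax.2].
have GA0 : mu (G `\` (A `&` eball y r)) = 0%E.
  have : mu (H `\` (A `&` eball y r)) = 0%E.
    have Hoo : (mu H < +oo)%E by rewrite HA.
    have -> : mu (H `\` (A `&` eball y r)) = (mu H - mu (H `&` (A `&` eball y r)))%E := measureD mH mA' Hoo.
    by rewrite setIidr// HA subee// ge0_fin_numE// lebesgue_outer_ge0.
  by apply: lebesgue_null_sub => x [[]].
have G0 : (0 < mu G)%E by apply: lt_le_trans (Ay r r0) _; exact: le_lebesgue_outer.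
have Goo : (mu G < +oo)%E by apply: le_lt_trans A'oo; rewrite -HA; apply: le_lebesgue_outer => x [].
have D0 : (0 < mu D)%E := Cz r r0.
pose M := enorm y + enorm z + 2 * r.
have Gr x : G x -> enorm (x - y) < r by case.
have Dr x : D x -> enorm (x - z) < r by case.
pose F (p : T * T) : R := \1_D p.1 * \1_G ((p.1 : 'rV[R]_n) + p.2).
have mF : measurable_fun setT F.
  apply: measurable_funM; first exact: measurable_indic_fst.
  rewrite (_ : (fun p => _) = \1_((fun p : T * T => (p.1 : 'rV[R]_n) + p.2) @^-1` G)).
    apply: measurable_indic.
    exact: (@measurable_preimage_borel R n _ _ _ G measurable_prod_coordD bG).
  by apply/funext => p; rewrite !indicE.
have norm1 (B : set 'rV[R]_n) x : `|\1_B x : R| <= 1 by exact: norm_indic_le1.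
have FC p : `|F p| <= 1 by rewrite /F normrM -[leRHS]mulr1; apply: ler_pM => //; exact: norm1.
have FM x w : M < enorm x \/ M < enorm w -> F (x, w) = 0.
  move=> hM; rewrite /F/= !indicE; have [xD|xD] := boolP (x \in D); last by rewrite mul0r.
  have [xG|xG] := boolP (_ \in G); last by rewrite mulr0.
  rewrite !inE in xD xG; have /Gr g := xG; have /Dr d := xD.
  exfalso; have := enormD (x - z) z; rewrite subrK => h1.
  have h2 := enormD (x + w - y) (y - x); rewrite addrA subrK addrAC subrr add0r in h2.
  have := enormB y x; have := enormD (x - z) (z - y); rewrite addrA subrK => h3 h4.
  have h5 := enormD y (- z); rewrite enormN in h5; rewrite (enormB z y) in h3.
  have := enorm_ge0 y; have := enorm_ge0 z; case: hM; rewrite /M; lra.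
have [_ _ eF] := Bc_Fubini mF FC FM.
have iG := Rintegral_indic mG; have iD := Rintegral_indic (mC' : measurable (D : set T)).
(* Integrating over the translations first gives the product of the measures;
   integrating over the points first gives the overlaps, which are null. *)
have e1 : \int[mu]_x (\int[mu]_w F (x, w)) = fine (mu D) * fine (mu G).
  have bcG : Bc (\1_G : 'rV[R]_n -> R).
    split; first exact: measurable_indic.
    exists 1, M => x; split; first exact: norm1.
    move=> Mx; have nG : ~ G x.
      move=> /Gr h2; have h1 := enormD (x - y) y; rewrite subrK addrC in h1.
      have := lt_le_trans Mx h1; apply/negP; rewrite -leNgt; apply: lerD; first by rewrite lerDl enorm_ge0.
      exact: (le_trans (ltW h2) r2).
    by rewrite indicE (memNset nG).
  transitivity (\int[mu]_x (fine (mu G) * \1_D x)).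
    apply: eq_Rintegral => x _.
    transitivity (\int[mu]_w (\1_D x * \1_G (w + x))).
      by apply: eq_Rintegral => w _; rewrite /F/= addrC.
    by rewrite (Bc_intZ (\1_D x) measurableT (Bc_shift x bcG)) (Bc_intT_shift x bcG) iG mulrC.
  have bcD : Bc (\1_D : 'rV[R]_n -> R); last first.
    by rewrite (Bc_intZ (fine (mu G)) measurableT bcD) iD mulrC.
  split; first exact: measurable_indic.
  exists 1, M => x; split; first exact: norm1.
  move=> Mx; have nD : ~ D x.
    move=> /Dr h2; have h1 := enormD (x - z) z; rewrite subrK addrC in h1.
    have := lt_le_trans Mx h1; apply/negP; rewrite -leNgt; apply: lerD; first by rewrite lerDr enorm_ge0.
    exact: (le_trans (ltW h2) r2).
  by rewrite indicE (memNset nD).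
have e2 : \int[mu]_w (\int[mu]_x F (x, w)) = 0.
  apply: Rintegral_eq0 => w.
  transitivity (\int[mu]_x \1_(D `&` shift_set G w) x).
    by apply: eq_Rintegral => x _; rewrite /F/= !indicE in_setI -mulnb natrM.
  have mS : measurable (D `&` shift_set G w : set T).
    exact: (measurableI _ _ mC' (@lebesgue_measurable_shift R n G w mG)).
  rewrite (Rintegral_indic mS); suff -> : mu (D `&` shift_set G w) = 0%E by [].
  have [wr|wr] := ltP (enorm w) rho; last first.
    suff -> : D `&` shift_set G w = set0 by exact: lebesgue_outer0.
    rewrite -subset0 => x [/Dr d /Gr g].
    by have := translation_between d g; rewrite ltNge wr.
  have CA0 : mu (C `&` shift_set A w) = 0%E.
    have [/(_ wr)[]|/negP] := h w; rewrite -leNgt => h0.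
    by apply/eqP; rewrite eq_le lebesgue_outer_ge0 andbT.
  have GA1 : mu (shift_set (G `\` (A `&` eball y r)) w) = 0%E by rewrite lebesgue_shift.
  apply: lebesgue_null_sub (lebesgue_nullU CA0 GA1) => x [[Cx _] Gx].
  have [Ax|Ax] := pselect ((A `&` eball y r) (x + w)).
    by left; exact: (conj Cx Ax.1).
  by right; exact: (conj Gx Ax).
have fpos (B : set T) : (0 < mu B)%E -> (mu B < +oo)%E -> 0 < fine (mu B).
  by move=> B0 Boo; apply: fine_gt0; rewrite B0 Boo.
have := mulr_gt0 (fpos D D0 C'oo) (fpos G G0 Goo).
by rewrite -e1 eF e2 ltxx.
Qed.

(** [F] lies, up to null sets, at distance at least [rho] inside [G].
    Translations instead of distances make the relation insensitive to null
    sets, and compatible with the translation invariance of the scheme. *)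
Definition nested F G rho := forall w, enorm w < rho -> mu (F `\` shift_set G w) = 0%E.

(** Two such points at smaller distance could be made to overlap by a
    translation of length less than [rho]. *)
Lemma nested_ess_support F G rho y z : measurable (F : set T) -> measurable (G : set T) ->
  nested F G rho -> ess_support F y -> ess_support (~` G) z -> rho <= enorm (y - z).
Proof.
move=> mF mG FG Fy Gz; rewrite leNgt; apply/negP => yz.
have mGC : measurable (~` G : set T) by exact: measurableC.
have [w wr] := ess_support_overlap mF mGC Fy Gz yz.
suff -> : mu (~` G `&` shift_set F w) = 0%E by rewrite ltxx.
rewrite -(lebesgue_shift _ (- w)).
have := FG (- w); rewrite enormN => /(_ wr); apply: lebesgue_null_sub => x.
by rewrite /shift_set/= subrK => -[].
Qed.

Lemma nestedC F G rho : nested F G rho -> nested (~` G) (~` F) rho.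
Proof.
move=> FG w wr; rewrite -(lebesgue_shift _ (- w)).
have := FG (- w); rewrite enormN => /(_ wr); apply: lebesgue_null_sub => x.
by rewrite /shift_set/= subrK => -[Gx /contrapT Fx].
Qed.

(** A translation vector is split in proportion to the two distances. *)
Lemma nested_trans F G E rho sigma : 0 < rho -> 0 < sigma -> nested F G rho -> nested G E sigma ->
  nested F E (rho + sigma).
Proof.
move=> r0 s0 FG GE w wr.
pose a := rho / (rho + sigma).
have rs0 : 0 < rho + sigma by rewrite addr_gt0.
have h1 : mu (F `\` shift_set G (a *: w)) = 0%E.
  apply: FG; rewrite enormZ ger0_norm ?divr_ge0 ?ltW//.
  by rewrite /a mulrAC ltr_pdivrMr// ltr_pM2l.
have h2 : mu (shift_set (G `\` shift_set E ((1 - a) *: w)) (a *: w)) = 0%E.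
  rewrite lebesgue_shift; apply: GE.
  have -> : 1 - a = sigma / (rho + sigma).
    by rewrite /a -{1}(@divff _ (rho + sigma)) ?gt_eqF// -mulrBl addrAC subrr add0r.
  rewrite enormZ ger0_norm ?divr_ge0 ?ltW//.
  by rewrite mulrAC ltr_pdivrMr// ltr_pM2l.
apply: lebesgue_null_sub (lebesgue_nullU h1 h2) => x [Fx Ex].
have [Gx|Gx] := pselect (shift_set G (a *: w) x); [right|left] => //.
split => // Ex'; apply: Ex; move: Ex'; rewrite /shift_set/= -addrA -scalerDl.
by rewrite addrCA subrr addr0 scale1r.
Qed.

Hypothesis mu_neq0 : mu setT != 0%E.

(** On the segment from [x] to [z] the point at distance [edist_to x (boundary
    F)] from [x] is still in the essential support of [F], hence at distance
    at least [rho] from [z]. *)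
Let edist_gap F G rho x z : measurable (F : set T) -> measurable (G : set T) ->
  essential_boundary F -> 0 < rho -> nested F G rho -> F x -> ess_support (~` G) z ->
  (edist_to x (boundary F) + rho%:E <= (enorm (x - z))%:E)%E.
Proof.
move=> mF mG eF r0 FG Fx zG.
have [xz|xz] := leP (enorm (x - z))%:E (edist_to x (boundary F)).
  have zF := edist_ess_support mu_neq0 eF Fx xz.
  have := nested_ess_support mF mG FG zF zG; rewrite subrr enorm0.
  by rewrite leNgt r0.
have d0 := edist_ge0 (boundary F) x.
have dfin : edist_to x (boundary F) \is a fin_num.
  by rewrite ge0_fin_numE// (lt_trans xz)// ltry.
pose s := fine (edist_to x (boundary F)); have sE : edist_to x (boundary F) = s%:E by rewrite fineK.
rewrite sE lte_fin in xz; have s0 : 0 <= s by exact: fine_ge0.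
have l0 : 0 < enorm (x - z) := le_lt_trans s0 xz.
pose y := x + (s / enorm (x - z)) *: (z - x).
have xy : enorm (x - y) = s.
  rewrite /y opprD addrA subrr add0r -scalerN opprB enormZ ger0_norm ?divr_ge0//.
    by rewrite divfK// gt_eqF.
  exact: ltW.
have yF : ess_support F y by apply: (edist_ess_support mu_neq0 eF Fx); rewrite xy sE.
have := nested_ess_support mF mG FG yF zG.
have -> : y - z = (1 - s / enorm (x - z)) *: (x - z).
  by apply/rowP => i; rewrite !mxE; ring.
rewrite enormZ ger0_norm; last by rewrite subr_ge0 ler_pdivrMr// mul1r ltW.
rewrite mulrBl mul1r divfK ?gt_eqF// sE -EFinD lee_fin; lra.
Qed.

Let edist_add F G rho x : (forall y z, boundary F y -> boundary G z -> rho <= enorm (y - z)) ->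
  (rho%:E <= edist_to x (boundary F) + edist_to x (boundary G))%E.
Proof.
move=> h; have h1 y : boundary F y -> (rho%:E <= (enorm (x - y))%:E + edist_to x (boundary G))%E.
  move=> yF; rewrite -leeBlDl//; apply: edist_geP => z zG; rewrite leeBlDl// -EFinD lee_fin.
  apply: le_trans (h _ _ yF zG) _; rewrite (enormB x y).
  exact: enorm_triangle.
have := edist_ge0 (boundary G) x; case E : (edist_to x (boundary G)) => [b| |]//= b0; last first.
  by rewrite addey ?leey// gt_eqF// (lt_le_trans _ (edist_ge0 _ _)).
rewrite -leeBlDr//; apply: edist_geP => y /h1; rewrite E => h2.
by rewrite leeBlDr.
Qed.

(** If [F] lies at distance [rho] inside [G], then the signed distances to the
    boundaries differ by at least [rho]. The inequality is arranged so that all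
    terms are nonnegative, as distances to an empty boundary are infinite. *)
Lemma nested_edist F G rho x : measurable (F : set T) -> measurable (G : set T) ->
  essential_boundary F -> essential_boundary G -> 0 < rho -> nested F G rho ->
  (rho%:E + ((if x \in F then edist_to x (boundary F) else 0) +
             (if x \in G then 0 else edist_to x (boundary G))) <=
   (if x \in F then 0 else edist_to x (boundary F)) +
   (if x \in G then edist_to x (boundary G) else 0))%E.
Proof.
move=> mF mG eF eG r0 FG.
have mFC : measurable (~` F : set T) by exact: measurableC.
have mGC : measurable (~` G : set T) by exact: measurableC.
have [xF|xF] := boolP (x \in F); have [xG|xG] := boolP (x \in G); rewrite ?inE ?notin_setE in xF xG.
- rewrite adde0 add0e; apply: edist_geP => z zG; rewrite addeC.
  exact: edist_gap mF mG eF r0 FG xF (eG z zG).2.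
- have := nested_ess_support mF mG FG (essential_boundary_mem mu_neq0 eF xF)
    (essential_boundary_mem mu_neq0 (essential_boundaryC eG) xG).
  by rewrite subrr enorm0 leNgt r0.
- rewrite adde0 adde0; apply: edist_add => y z yF zG.
  exact: nested_ess_support mF mG FG (eF y yF).1 (eG z zG).2.
- rewrite add0e adde0; apply: edist_geP => z zF; rewrite addeC -boundaryC.
  apply: (edist_gap mGC mFC (essential_boundaryC eG) r0 (nestedC FG) xG).
  by rewrite setCK; exact: (eF z zF).1.
Qed.

End nested.

Section gap.
Context {R : realType} {n : nat}.
Local Notation T := (lebesgue_rV R n).
Local Notation mu := (@lebesgue R n).
Local Open Scope ereal_scope.

(** A uniform gap between the integrands costs [rho] times the measure of the
    domain, which the integrals do not allow unless the domain is null. *)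
Lemma integral_gap_null (D : set T) (f g : T -> \bar R) (rho : R) : measurable D ->
  (0 < rho)%R -> measurable_fun setT f -> measurable_fun setT g ->
  (forall x, 0 <= f x) -> (forall x, 0 <= g x) ->
  (forall x, D x -> rho%:E + g x <= f x) -> \int[mu]_(x in D) f x < +oo ->
  \int[mu]_(x in D) f x <= \int[mu]_(x in D) g x -> mu D = 0.
Proof.
move=> mD r0 mf mg f0 g0 fg foo le.
have mf' : measurable_fun D f by apply: measurable_funTS.
have mg' : measurable_fun D g by apply: measurable_funTS.
have r0' : 0 <= rho%:E by rewrite lee_fin ltW.
have h : rho%:E * mu D + \int[mu]_(x in D) g x <= \int[mu]_(x in D) f x.
  rewrite -integral_cst// -ge0_integralD//.
  have h0 x : D x -> 0 <= rho%:E + g x by move=> _; exact: adde_ge0.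
  have mh : measurable_fun D (fun x => rho%:E + g x) by exact: emeasurable_funD.
  exact: (ge0_le_integral mu mD h0 mh mf' fg).
have gfin : \int[mu]_(x in D) g x \is a fin_num.
  rewrite ge0_fin_numE; last exact: integral_ge0.
  apply: le_lt_trans foo; apply: le_trans h; rewrite leeDr// mule_ge0//.
have := le_trans h le; rewrite -[X in _ <= X]add0e leeD2rE// => h0.
apply/eqP; rewrite eq_le lebesgue_outer_ge0 andbT.
by move: h0; rewrite -[X in _ <= X](mule0 rho%:E) lee_pmul2l.
Qed.

End gap.

(** * Good representatives have no inessential boundary points *)

Section representatives.
Context {R : realType} {n : nat}.
Implicit Types (x y z v w : 'rV[R]_n) (A E F G : set 'rV[R]_n) (xi : 'rV[R]_n -> 'rV[R]_n).
Local Notation T := (lebesgue_rV R n).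
Local Notation mu := (@lebesgue R n).

Lemma Bc_int_null A f : measurable (A : set T) -> mu A = 0%E -> Bc f -> \int[mu]_(x in A) f x = 0.
Proof.
move=> mA A0 bf; have [_ [C [M hC]]] := bf.
have h := @int_setY R n A set0 f C mA (@measurable0 _ T) bf (fun x => (hC x).1).
have AY : A `+` set0 = A by rewrite /setY setD0 set0D setU0.
rewrite AY A0 /= mulr0 ltry in h; have := h isT.
by rewrite Rintegral_set0 subr0 normr_le0 => /eqP.
Qed.

Section outer_boundary.
Hypothesis mu_neq0 : mu setT != 0%E.

Lemma ess_supportP A y :
  (forall r : R, 0 < r -> exists2 p, eball y r p & interior A p) -> ess_support A y.
Proof.
move=> h r r0; have [p yp pA] := h r r0.
have /nbhs_eballP[s s0 sA] : nbhs p (A `&` eball y r).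
  by apply: filterI => //; apply: open_nbhs_nbhs; split => //; exact: open_eball.
exact: lt_le_trans (lebesgue_eball_gt0 p mu_neq0 s0) (le_lebesgue_outer sA).
Qed.

(** Small steps along the gradient and against it lead to interior points of
    the complement and of the set. *)
Lemma chart_ess_support E c (r : R) psi y : chart E c r psi -> eball c r y -> boundary E y ->
  ess_support E y /\ ess_support (~` E) y.
Proof.
move=> ch yb yE; have [r0 _ g0 EU] := ch.
have gy : 0 < dotp (grad psi y) (grad psi y) by rewrite -enorm_sqr exprn_gt0// enorm_gt0 g0.
have gy' : dotp (- grad psi y) (grad psi y) < 0 by rewrite dotpNl oppr_lt0.
split; apply: ess_supportP => s s0; have ys := eball_center y s0.
  have h := @filterI _ (0^'+) (at_right_proper_filter 0) _ _ (chart_inside ch yb yE gy')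
    (@filterI _ (0^'+) (at_right_proper_filter 0) _ _ (near_eball_line (- grad psi y) yb) (near_eball_line (- grad psi y) ys)).
  have [t [[_ p0] [pb ps]]] := filter_ex h.
  exists (t *: - grad psi y + y) => //.
  apply: filterS (filterI (near_lt (chart_continuous ch pb) p0) (chart_nbhs pb)) => z [z0 zb].
  by apply/(EU z zb)/ltW.
have h := @filterI _ (0^'+) (at_right_proper_filter 0) _ _ (chart_outside ch yb yE gy)
  (@filterI _ (0^'+) (at_right_proper_filter 0) _ _ (near_eball_line (grad psi y) yb) (near_eball_line (grad psi y) ys)).
have [t [pE [pb ps]]] := filter_ex h.
exists (t *: grad psi y + y) => //.
have p0 : 0 < psi (t *: grad psi y + y) by rewrite ltNge; apply/negP => /(EU _ pb).
apply: filterS (filterI (near_gt (chart_continuous ch pb) p0) (chart_nbhs pb)) => z [z0 zb].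
by move=> /(EU z zb); rewrite leNgt z0.
Qed.

Lemma C2_boundary_essential E : C2_boundary E -> essential_boundary E.
Proof.
move=> E2 y yE; have [U [psi h]] := E2 y yE; have [r ch _] := C2_defining_chart h.
by apply: (chart_ess_support ch) yE; apply: eball_center; have [] := ch.
Qed.

End outer_boundary.

Lemma borel_continuous (g : 'rV[R]_n -> R) : continuous g ->
  measurable_fun setT (g : borel_rV R n -> R).
Proof.
move=> cg; apply: (measurability _ (measurable_realfun.RGenOpens.measurableE R)) => _ [_ [a [b ->] <-]].
rewrite setTI; apply: sub_sigma_algebra; apply: open_comp; last exact: interval_open.
by move=> x _; exact: cg.
Qed.

Lemma measurable_borel_eball x (r : R) : measurable (eball x r : set (borel_rV R n)).
Proof. by apply: sub_sigma_algebra; exact: open_eball. Qed.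

(** Approximations from below, of class C1, of the indicator of the ball of
    radius [r] around [x]; they are supported in that ball. *)
Let ball_approx x (r : R) (k : nat) y : R :=
  1 - cutoff (k.+1%:R * (r ^+ 2 - dotp (y - x) (y - x))).

Let C1_ball_approx x r k : C1_on setT (ball_approx x r k).
Proof.
apply: (C1_onB openT (C1_on_cst _)); apply: (C1_on_cutoff openT).
exact: (C1_onM openT (C1_on_cst _) (C1_onB openT (C1_on_cst _) (C1_on_dist x))).
Qed.

Let ball_approx0 x r k y : 0 < r -> r <= enorm (y - x) -> ball_approx x r k y = 0.
Proof.
move=> r0 yr; rewrite /ball_approx cutoff1 ?subrr// pmulr_rle0// subr_le0 -enorm_sqr.
by rewrite ler_pXn2r ?nnegrE ?enorm_ge0 ?(ltW r0).
Qed.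

Let ball_approx01 x r k y : 0 <= ball_approx x r k y <= 1.
Proof.
have /andP[c0 c1] := cutoff01 (k.+1%:R * (r ^+ 2 - dotp (y - x) (y - x))).
by rewrite /ball_approx subr_ge0 c1 gerBl.
Qed.

Let ball_approx_cvg x r y : 0 < r -> ball_approx x r k y @[k --> \oo] --> (\1_(eball x r) y : R).
Proof.
move=> r0; apply: cvg_near_cst; rewrite indicE.
have [yr|yr] := ltP (enorm (y - x)) r; last first.
  by apply: nearW => k; rewrite memNset ?ball_approx0// /eball/= ltNge yr.
have d0 : 0 < r ^+ 2 - dotp (y - x) (y - x).
  by rewrite subr_gt0 -enorm_sqr ltr_pXn2r ?nnegrE ?enorm_ge0 ?(ltW r0).
rewrite mem_set//; have [N _ hN] := near_infty_natSinv_lt (PosNum d0).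
exists N => // k /= Nk; rewrite /ball_approx cutoff0 ?subr0//.
have /= := hN k Nk; rewrite invf_plt ?posrE//= => h.
by rewrite -ler_pdivrMr// div1r ltW.
Qed.

(** A measure that represents the distributional gradient of a set does not charge
    balls in which the set or its complement is negligible, in the sense that the
    normal integrates to zero over them: the integral is a limit of tests with
    fields of class C1 supported in the ball, and these tests vanish. *)
Lemma gauss_green_null F (m : {finite_measure set (borel_rV R n) -> \bar R}) nu x (r rho : R) i :
  measurable (F : set T) -> gauss_green F m nu -> 0 < rho -> rho < r ->
  mu (F `&` eball x r) = 0%E \/ mu (~` F `&` eball x r) = 0%E ->
  Rintegral m (eball x rho) (fun y => nu y 0 i) = 0.
Proof.
move=> mF [mnu nu1 GG] rho0 rhor F0.
pose xi k y : 'rV[R]_n := ball_approx x rho k y *: delta_mx 0 i.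
have xi1 k : C1c (xi k).
  apply: (C1cZr (M := rho + enorm x)); [|exact: C1_ball_approx|exact: C1_on_cst].
  move=> y yM; apply: ball_approx0 => //.
  by have := enormD (y - x) x; rewrite subrK; lra.
have zero k : \int[mu]_(y in F) divergence (xi k) y = 0.
  have bd := Bc_div (xi1 k); have mB := measurable_eball x r.
  have out y : ~ eball x r y -> divergence (xi k) y = 0.
    rewrite /eball/= => /negP; rewrite -leNgt => yr.
    have yo : [set z | rho < enorm (z - x)] y by exact: lt_le_trans yr.
    have oo : open [set z | rho < enorm (z - x)].
      rewrite openE => z /= zr; apply/nbhs_eballP; exists (enorm (z - x) - rho); first by rewrite subr_gt0.
      move=> u; rewrite /eball/= => uz; have := enormD (z - u) (u - x).
      by rewrite addrA subrK (enormB z u); move: uz; lra.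
    rewrite (divergence_eq oo yo (eta := fun=> 0)) ?divergence_cst// => z zr.
    by rewrite /xi ball_approx0 ?scale0r// ltW.
  have loc D : \int[mu]_(y in D) divergence (xi k) y =
      \int[mu]_(y in D `&` eball x r) divergence (xi k) y.
    rewrite Bc_int_indic; apply: eq_Rintegral => y _; rewrite indicE.
    by have [yb|yb] := pselect (eball x r y); [rewrite mem_set ?mul1r|rewrite memNset// out// mulr0].
  case: F0 => F0.
    rewrite loc; apply: Bc_int_null => //; exact: measurableI.
  have mFC : measurable (~` F : set T) by exact: measurableC.
  have z1 : \int[mu]_(y in ~` F) divergence (xi k) y = 0.
    rewrite loc; apply: Bc_int_null => //; exact: measurableI.
  have := int_divergence_eq0 (xi1 k).
  have <- : \int[mu]_(y in F) divergence (xi k) y + \int[mu]_(y in ~` F) divergence (xi k) y =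
      \int[mu]_y divergence (xi k) y; last by rewrite z1 addr0.
  have intE D : \int[mu]_(y in D) divergence (xi k) y = \int[mu]_y (\1_D y * divergence (xi k) y).
    by rewrite -[in LHS](setTI D) Bc_int_indic.
  rewrite (intE F) (intE (~` F)) -(Bc_intD measurableT (Bc_indic mF bd) (Bc_indic mFC bd)).
  apply: eq_Rintegral => y _; rewrite -mulrDl !indicE in_setC.
  by case: (y \in F); rewrite ?addr0 ?add0r mul1r.
have mzero k : (\int[m]_y (ball_approx x rho k y * nu y 0 i)%:E = 0)%E.
  have := GG _ (xi1 k); rewrite (Bc_int_fin mF (Bc_div (xi1 k))) zero => /esym.
  by under eq_integral do rewrite /xi dotpZl dotp_delta.
pose f k (y : borel_rV R n) : \bar R := (ball_approx x rho k y * nu y 0 i)%:E.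
pose g (y : borel_rV R n) : \bar R := (\1_(eball x rho) y * nu y 0 i)%:E.
have mf k : measurable_fun setT (f k).
  have mb : measurable_fun setT (ball_approx x rho k : borel_rV R n -> R); last first.
    by apply/measurable_EFinP; exact: (measurable_funM mb (mnu i)).
  by apply: borel_continuous => y; exact: (C1_on_continuous (C1_ball_approx x rho k)).
have mg : measurable_fun setT g.
  apply/measurable_EFinP; apply: measurable_funM; last exact: mnu.
  by apply: measurable_indic; exact: measurable_borel_eball.
have fg : {ae m, forall y, setT y -> f ^~ y @ \oo --> g y}.
  apply: nearW => y _; apply: cvg_EFin; first exact: nearW.
  by apply: cvgM; [exact: ball_approx_cvg|exact: cvg_cst].
have fb : {ae m, forall y k, setT y -> (`|f k y| <= (EFin \o cst (1%R : R)) y)%E}.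
  apply: filterS nu1 => y ny k _; rewrite /= lee_fin normrM -[leRHS]mulr1.
  apply: ler_pM => //; last by rewrite -ny coord_le_enorm.
  by have /andP[b0 b1] := ball_approx01 x rho k y; rewrite ger0_norm.
have [_ _ h] := dominated_convergence measurableT mf mg fg (finite_measure_integrable_cst m 1 measurableT) fb.
rewrite Rintegral_mkcond /Rintegral.
suff -> : (\int[m]_y ((fun y => nu y 0 i) \_ (eball x rho) y)%:E = 0)%E by [].
transitivity (\int[m]_y g y)%E.
  apply: eq_integral => y _; rewrite patchE /g indicE; congr (_%:E).
  by case: (y \in _); rewrite ?mul1r ?mul0r.
rewrite -(cvg_lim _ h)//; apply: lim_near_cst => //.
by apply: nearW => k; exact: mzero.
Qed.

(** If the set or its complement were negligible around a point of the reduced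
    boundary, the averaged normals would vanish at small scales and could not
    converge to a unit vector. Points of the closure inherit the property. *)
Lemma good_representative_essential F : measurable (F : set T) -> good_representative F ->
  essential_boundary F.
Proof.
move=> mF gF; have mFC : measurable (~` F : set T) by exact: measurableC.
have key x (r : R) : reduced_boundary F x -> 0 < r ->
    ~ (mu (F `&` eball x r) = 0%E \/ mu (~` F `&` eball x r) = 0%E).
  move=> [m [nu [GG _ [w w1 cw]]]] r0 F0.
  have n0 : mean_normal m nu x s @[s --> 0^'+] --> (0 : 'rV[R]_n).
    apply: cvg_near_cst; near=> s.
    apply/rowP => i; rewrite !mxE (gauss_green_null i mF GG _ _ F0) ?mul0r//.
  have w0 : w = 0 by apply: cvg_unique cw n0; exact: norm_hausdorff.
  by move: w1; rewrite w0 enorm0 => /esym/eqP; rewrite oner_eq0.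
move=> y; rewrite -gF => yF.
have sup A : (forall x r, reduced_boundary F x -> 0 < r -> mu (A `&` eball x r) != 0%E) -> ess_support A y.
  move=> h r r0; have [x [xF xy]] := yF _ (open_nbhs_nbhs (conj (@open_eball _ _ y r) (eball_center y r0))).
  have s0 : 0 < r - enorm (x - y) by rewrite subr_gt0.
  have sub : A `&` eball x (r - enorm (x - y)) `<=` A `&` eball y r.
    move=> z [Az zx]; split => //; rewrite /eball/= (le_lt_trans (enorm_triangle x _ _))//.
    by rewrite -ltrBrDr.
  apply: lt_le_trans (le_lebesgue_outer sub).
  by rewrite lt_def lebesgue_outer_ge0 andbT; exact: h.
by split; apply: sup => x r xF r0; apply/eqP => h0; apply: (key x r xF r0); [left|right].
Unshelve. all: by end_near. Qed.

End representatives.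

(** * Comparison of the minimizers of one step *)

Section minimizers.
Context {R : realType} {n : nat}.
Implicit Types (x y z v w : 'rV[R]_n) (A B D E F G K : set 'rV[R]_n) (h rho : R).
Local Notation T := (lebesgue_rV R n).
Local Notation mu := (@lebesgue R n).
Local Notation dist F := (fun x => edist_to x (boundary F)).

(** The part of a step that concerns measures only; unlike the choice of a
    representative it obviously passes to translates. *)
Definition minimizer h F E := measurable (E : set T) /\
  forall E', measurable (E' : set T) -> (atw_functional h F E <= atw_functional h F E')%E.

Lemma measurable_setY A B : measurable (A : set T) -> measurable (B : set T) ->
  measurable (A `+` B : set T).
Proof. by move=> mA mB; apply: measurableU; exact: measurableD. Qed.

Lemma int_dist_ge0 F D : (0 <= \int[mu]_(x in D) edist_to x (boundary F))%E.
Proof. by apply: integral_ge0 => x _; exact: edist_ge0. Qed.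

Lemma int_dist_sub F D D' : measurable (D : set T) -> measurable (D' : set T) -> D `<=` D' ->
  (\int[mu]_(x in D) edist_to x (boundary F) <= \int[mu]_(x in D') edist_to x (boundary F))%E.
Proof.
move=> mD mD' DD'; have md : measurable_fun (D' : set T) (fun x : T => edist_to x (boundary F)).
  by apply: measurable_funTS; exact: measurable_edist.
exact: (ge0_subset_integral mu mD mD' md (fun x _ => edist_ge0 _ x) DD').
Qed.

Lemma atw_functional_self h F : atw_functional h F F = perimeter F.
Proof. by rewrite /atw_functional setYK integral_set0 mule0 adde0. Qed.

Lemma minimizer_perimeter h F E : 0 < h -> measurable (F : set T) -> minimizer h F E ->
  (perimeter E <= perimeter F)%E.
Proof.
move=> h0 mF [mE minE]; rewrite -(atw_functional_self h F).
apply: le_trans (minE _ mF); rewrite leeDl// mule_ge0 ?int_dist_ge0//.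
by rewrite lee_fin invr_ge0 ltW.
Qed.

Lemma minimizer_int_dist h F E : 0 < h -> measurable (F : set T) -> minimizer h F E ->
  (perimeter F < +oo)%E -> (\int[mu]_(x in E `+` F) edist_to x (boundary F) < +oo)%E.
Proof.
move=> h0 mF [mE minE] PF; have := minE _ mF; rewrite atw_functional_self => le.
have h1 : ((h^-1)%:E * \int[mu]_(x in E `+` F) edist_to x (boundary F) < +oo)%E.
  apply: le_lt_trans PF; apply: le_trans le; rewrite leeDr//; exact: perimeter_ge0.
move: h1; have := int_dist_ge0 F (E `+` F).
case: (\int[mu]_(x in E `+` F) _)%E => [r _ _|_|//]; first by rewrite ltry.
by rewrite gt0_muley ?lte_fin ?invr_gt0.
Qed.

(** Cancelling the common part of the symmetric differences in the comparison of a
    minimizer with a competitor. *)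
Lemma minimizer_compare h F E E' K D D' : 0 < h -> measurable (F : set T) ->
  minimizer h F E -> (perimeter F < +oo)%E -> measurable (E' : set T) ->
  measurable (K : set T) -> measurable (D : set T) -> measurable (D' : set T) ->
  [disjoint K & D] -> [disjoint K & D'] -> E `+` F = K `|` D -> E' `+` F = K `|` D' ->
  (perimeter E + (h^-1)%:E * \int[mu]_(x in D) edist_to x (boundary F) <=
   perimeter E' + (h^-1)%:E * \int[mu]_(x in D') edist_to x (boundary F))%E.
Proof.
move=> h0 mF minE PF mE' mK mD mD' KD KD' eE eE'.
have := minE.2 _ mE'; have := minimizer_int_dist h0 mF minE PF.
rewrite /atw_functional eE eE'.
have md X : measurable_fun X (fun x : T => edist_to x (boundary F)).
  by apply: measurable_funTS; exact: measurable_edist.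
have d0 (X : set T) x : X x -> (0 <= edist_to x (boundary F))%E by move=> _; exact: edist_ge0.
have IU (X Y : set T) : measurable X -> measurable Y -> [disjoint X & Y] ->
    (\int[mu]_(x in X `|` Y) edist_to x (boundary F) =
     \int[mu]_(x in X) edist_to x (boundary F) + \int[mu]_(x in Y) edist_to x (boundary F))%E.
  by move=> mX mY XY; exact: (ge0_integral_setU mu mX mY (md _) (d0 _) XY).
rewrite (IU _ _ mK mD KD) (IU _ _ mK mD' KD').
set a := (\int[mu]_(x in K) _)%E; set b := (\int[mu]_(x in D) _)%E; set b' := (\int[mu]_(x in D') _)%E.
have a0 : (0 <= a)%E := int_dist_ge0 F K.
have b0 : (0 <= b)%E := int_dist_ge0 F D; have b'0 : (0 <= b')%E := int_dist_ge0 F D'.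
move=> aboo; have afin : a \is a fin_num.
  by rewrite ge0_fin_numE// (le_lt_trans _ aboo)// leeDl.
rewrite (ge0_muleDr _ a0 b0) (ge0_muleDr _ a0 b'0).
rewrite (addeCA (perimeter E)) (addeCA (perimeter E')) leeD2lE//.
by rewrite fin_numM.
Qed.

(** Comparison with the competitor [E `&` B]. *)
Lemma minimizer_cap h F E B : 0 < h -> measurable (F : set T) -> minimizer h F E ->
  (perimeter F < +oo)%E -> measurable (B : set T) ->
  (perimeter E + (h^-1)%:E * \int[mu]_(x in (E `\` B) `\` F) edist_to x (boundary F) <=
   perimeter (E `&` B) + (h^-1)%:E * \int[mu]_(x in (E `\` B) `&` F) edist_to x (boundary F))%E.
Proof.
move=> h0 mF minE PF mB; have mE := minE.1.
have mD : measurable (E `\` B : set T) by exact: measurableD.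
apply: (minimizer_compare h0 mF minE PF (K := (E `+` F) `\` (E `\` B))).
- exact: measurableI.
- by apply: measurableD => //; exact: measurable_setY.
- exact: measurableD.
- exact: measurableI.
- by apply/disj_setPS => x [[_ n1] [d1 _]].
- by apply/disj_setPS => x [[_ n1] [d1 _]].
- by apply/seteqP; split=> x; rewrite /setY/=; have [] := pselect (E x); have [] := pselect (F x); have [] := pselect (B x); tauto.
- by apply/seteqP; split=> x; rewrite /setY/=; have [] := pselect (E x); have [] := pselect (F x); have [] := pselect (B x); tauto.
Qed.

(** Comparison with the competitor [B `|` E]. *)
Lemma minimizer_cup h F E B : 0 < h -> measurable (F : set T) -> minimizer h F E ->
  (perimeter F < +oo)%E -> measurable (B : set T) ->
  (perimeter E + (h^-1)%:E * \int[mu]_(x in (B `\` E) `&` F) edist_to x (boundary F) <=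
   perimeter (B `|` E) + (h^-1)%:E * \int[mu]_(x in (B `\` E) `\` F) edist_to x (boundary F))%E.
Proof.
move=> h0 mF minE PF mB; have mE := minE.1.
have mD : measurable (B `\` E : set T) by exact: measurableD.
apply: (minimizer_compare h0 mF minE PF (K := (E `+` F) `\` (B `\` E))).
- exact: measurableU.
- by apply: measurableD => //; exact: measurable_setY.
- exact: measurableI.
- exact: measurableD.
- by apply/disj_setPS => x [[_ n1] [d1 _]].
- by apply/disj_setPS => x [[_ n1] [d1 _]].
- by apply/seteqP; split=> x; rewrite /setY/=; have [] := pselect (E x); have [] := pselect (F x); have [] := pselect (B x); tauto.
- by apply/seteqP; split=> x; rewrite /setY/=; have [] := pselect (E x); have [] := pselect (F x); have [] := pselect (B x); tauto.
Qed.

Lemma atw_functional_shift h F E v : measurable (F : set T) -> measurable (E : set T) ->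
  atw_functional h (shift_set F v) (shift_set E v) = atw_functional h F E.
Proof.
move=> mF mE.
have e : (\int[mu]_(x in shift_set E v `+` shift_set F v) edist_to x (boundary (shift_set F v)) =
    \int[mu]_(x in E `+` F) edist_to x (boundary F))%E.
  rewrite boundary_shift -(ge0_integral_shift v (measurable_setY mE mF) (measurable_edist (boundary F)) (edist_ge0 _)).
  by apply: eq_integral => x _; exact: edist_shift.
by rewrite /atw_functional e (perimeter_shift v mE).
Qed.

Lemma minimizer_shift h F E v : measurable (F : set T) -> minimizer h F E ->
  minimizer h (shift_set F v) (shift_set E v).
Proof.
move=> mF [mE minE]; split; first exact: lebesgue_measurable_shift.
move=> E' mE'; rewrite atw_functional_shift//.
have mE'' : measurable (shift_set E' (- v) : set T) by exact: lebesgue_measurable_shift.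
by rewrite -(shift_setNK E' v) atw_functional_shift//; exact: minE.
Qed.

(** Adding two minimality inequalities and cancelling finite perimeters, with
    values that are possibly infinite on the other side. *)
Let ereal_cancel (p q p' q' a b c d : \bar R) : p \is a fin_num -> q \is a fin_num ->
  (0 <= p' -> 0 <= q' -> p + a <= p' + b -> q + c <= q' + d -> p' + q' <= p + q ->
  a + c <= b + d)%E.
Proof.
move=> pf qf p0 q0 h1 h2 h3; have := leeD h1 h2; rewrite addeACA [X in (_ <= X)%E]addeACA => h4.
have pqf : (p + q)%E \is a fin_num by rewrite fin_numD pf.
by rewrite -(leeD2lE _ _ pqf) (le_trans h4)// leeD2r.
Qed.

Let intD_if D F (f : T -> \bar R) : (\int[mu]_(x in D `&` F) f x =
  \int[mu]_(x in D) (if x \in F then f x else 0))%E.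
Proof.
rewrite integral_mkcondr; apply: eq_integral => x _.
by rewrite patchE.
Qed.

Let intC_if D F (f : T -> \bar R) : (\int[mu]_(x in D `\` F) f x =
  \int[mu]_(x in D) (if x \in F then 0 else f x))%E.
Proof.
rewrite setDE intD_if; apply: eq_integral => x _.
by rewrite in_setC; case: (x \in F).
Qed.

Let measurable_if_in F (f g : T -> \bar R) : measurable (F : set T) -> measurable_fun setT f ->
  measurable_fun setT g -> measurable_fun setT (fun x : T => if x \in F then f x else g x).
Proof.
move=> mF mf mg.
have mb : measurable_fun setT (fun x : T => x \in F).
  apply: (measurable_fun_bool true); rewrite setTI (_ : _ @^-1` _ = F)//.
  by apply/seteqP; split=> x => [/set_mem|/mem_set].
exact: (measurable_fun_ifT mb mf mg).
Qed.

Let int_add_scale (D : set T) (u : 'rV[R]_n -> R) (f : T -> \bar R) (c : R) : measurable D -> Bc u ->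
  (forall x, 0 <= u x) -> measurable_fun setT f -> (forall x, 0 <= f x)%E -> 0 <= c ->
  (\int[mu]_(x in D) ((u x)%:E + c%:E * f x) =
     (\int[mu]_(x in D) u x)%:E + c%:E * \int[mu]_(x in D) f x)%E.
Proof.
move=> mD bu u0 mf f0 c0.
have mf' : measurable_fun D f by apply: measurable_funTS.
have mu' : measurable_fun D (fun x : T => (u x)%:E).
  by apply: measurable_funTS; apply/measurable_EFinP; exact: bu.1.
have mcf : measurable_fun D (fun x : T => c%:E * f x)%E by exact: measurable_funeM.
have u0' x : D x -> (0 <= (u x)%:E)%E by move=> _; rewrite lee_fin.
have cf0 x : D x -> (0 <= c%:E * f x)%E by move=> _; exact: mule_ge0.
by rewrite (ge0_integralD mu mD u0' mu' cf0 mcf) (Bc_int_fin mD bu) (ge0_integralZl mu mD mf' (fun x _ => f0 x)).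
Qed.

Section comparison.
Hypothesis mu_neq0 : mu setT != 0%E.

(** The comparison principle for a step: if [F] is at positive distance inside [G],
    a minimizer for [F] is contained in a minimizer for [G]. Exchanging the part of
    the first minimizer outside the second one does not increase the sum of the
    perimeters, by submodularity, and strictly decreases the sum of the distance
    terms. *)
Lemma minimizer_comparison h F G A B rho : 0 < h -> 0 < rho ->
  measurable (F : set T) -> measurable (G : set T) ->
  essential_boundary F -> essential_boundary G ->
  (perimeter F < +oo)%E -> (perimeter G < +oo)%E ->
  minimizer h F A -> minimizer h G B -> nested F G rho -> mu (A `\` B) = 0%E.
Proof.
move=> h0 r0 mF mG eF eG PF PG minA minB FG.
have mA := minA.1; have mB := minB.1.
have PA : perimeter A \is a fin_num.
  by apply: perimeter_fin_num; apply: le_lt_trans PF; exact: minimizer_perimeter h0 mF minA.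
have PB : perimeter B \is a fin_num.
  by apply: perimeter_fin_num; apply: le_lt_trans PG; exact: minimizer_perimeter h0 mG minB.
have := ereal_cancel PA PB (perimeter_ge0 _) (perimeter_ge0 _)
  (minimizer_cap h0 mF minA PF mB) (minimizer_cup h0 mG minB PG mA) (perimeter_submod mu_neq0 mA mB).
have hV : (0 < (h^-1)%:E)%E by rewrite lte_fin invr_gt0.
rewrite -!ge0_muleDr ?int_dist_ge0// lee_pmul2l// => le.
have mD : measurable (A `\` B : set T) by exact: measurableD.
have mdF := measurable_edist (boundary F); have mdG := measurable_edist (boundary G).
have m0 : measurable_fun setT (fun _ : T => 0%E : \bar R) by exact: measurable_cst.
pose f1 (x : T) : \bar R := (if x \in F then 0 else edist_to x (boundary F))%E.
pose f2 (x : T) : \bar R := (if x \in G then edist_to x (boundary G) else 0)%E.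
pose g1 (x : T) : \bar R := (if x \in F then edist_to x (boundary F) else 0)%E.
pose g2 (x : T) : \bar R := (if x \in G then 0 else edist_to x (boundary G))%E.
have mf1 : measurable_fun setT f1 by exact: measurable_if_in.
have mf2 : measurable_fun setT f2 by exact: measurable_if_in.
have mg1 : measurable_fun setT g1 by exact: measurable_if_in.
have mg2 : measurable_fun setT g2 by exact: measurable_if_in.
have f10 x : (0 <= f1 x)%E by rewrite /f1; case: (x \in F) => //; exact: edist_ge0.
have f20 x : (0 <= f2 x)%E by rewrite /f2; case: (x \in G) => //; exact: edist_ge0.
have g10 x : (0 <= g1 x)%E by rewrite /g1; case: (x \in F) => //; exact: edist_ge0.
have g20 x : (0 <= g2 x)%E by rewrite /g2; case: (x \in G) => //; exact: edist_ge0.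
have ts (f : T -> \bar R) : measurable_fun setT f -> measurable_fun (A `\` B : set T) f by move=> ?; apply: measurable_funTS.
have intf : (\int[mu]_(x in A `\` B) (f1 x + f2 x) =
    \int[mu]_(x in (A `\` B) `\` F) edist_to x (boundary F) +
    \int[mu]_(x in (A `\` B) `&` G) edist_to x (boundary G))%E.
  by rewrite (ge0_integralD mu mD (fun x _ => f10 x) (ts _ mf1) (fun x _ => f20 x) (ts _ mf2)) intC_if intD_if.
have intg : (\int[mu]_(x in A `\` B) (g1 x + g2 x) =
    \int[mu]_(x in (A `\` B) `&` F) edist_to x (boundary F) +
    \int[mu]_(x in (A `\` B) `\` G) edist_to x (boundary G))%E.
  by rewrite (ge0_integralD mu mD (fun x _ => g10 x) (ts _ mg1) (fun x _ => g20 x) (ts _ mg2)) intC_if intD_if.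
have gap x : (A `\` B) x -> (rho%:E + (g1 x + g2 x) <= f1 x + f2 x)%E.
  by move=> _; exact: (nested_edist mu_neq0 x mF mG eF eG r0 FG).
apply: (@integral_gap_null R n (A `\` B) (fun x => f1 x + f2 x)%E (fun x => g1 x + g2 x)%E rho
  mD r0 (emeasurable_funD mf1 mf2) (emeasurable_funD mg1 mg2)
  (fun x => adde_ge0 (f10 x) (f20 x)) (fun x => adde_ge0 (g10 x) (g20 x)) gap).
- rewrite intf; apply: lte_add_pinfty.
    apply: le_lt_trans (minimizer_int_dist h0 mF minA PF).
    apply: (int_dist_sub F (measurableD mD mF) (measurable_setY mA mF)).
    by move=> x [[Ax _] Fx]; left.
  apply: le_lt_trans (minimizer_int_dist h0 mG minB PG).
  apply: (int_dist_sub G (measurableI _ _ mD mG) (measurable_setY mB mG)).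
  by move=> x [[_ Bx] Gx]; right.
- by rewrite intf intg.
Qed.

End comparison.

(** The first step: a calibrated set shrinks at a speed bounded from below. Where a
    translate of the initial set cuts the minimizer, either the divergence of the
    calibration or the distance term is positive. *)
Lemma minimizer_calibrated E0 g (delta : R) : measurable (E0 : set T) -> 0 < delta -> Cc g ->
  (perimeter E0 < +oo)%E ->
  (forall x y, boundary E0 y -> enorm (x - y) < delta -> delta <= g x) ->
  (forall F xi, measurable (F : set T) -> admissible xi ->
      ((\int[mu]_(x in F `&` E0) divergence xi x + \int[mu]_(x in F `\` E0) g x)%:E <=
       perimeter F)%E) ->
  exists2 h0 : R, 0 < h0 & forall h E, 0 < h -> h < h0 -> minimizer h E0 E ->
    nested E E0 (delta * h).
Proof.
move=> mE0 d0 gc PE0 gd cal.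
have [C C0 hC] := Cc_bounded gc.
(* For smaller [h], far from the boundary of [E0], the distance term, of order
   [delta / h], outweighs the bound [C] of [g]; near the boundary [g] is at
   least [delta]. *)
pose h0 := Num.min 1 (delta / (2 * delta + C)).
exists h0; first by rewrite lt_min ltr01 divr_gt0// ltr_wpDr// mulr_gt0.
move=> h E hpos hh0 minE w wh; have mE := minE.1.
move: hh0; rewrite lt_min ltr_pdivlMr ?ltr_wpDr ?mulr_gt0// => /andP[h1 hC'].
pose B := shift_set E0 w.
have mB : measurable (B : set T) by exact: lebesgue_measurable_shift.
pose G x := g (x + w).
have bG : Bc G := Bc_shift w (Cc_Bc gc).
have mD : measurable (E `\` B : set T) by exact: measurableD.
have mEB : measurable (E `&` B : set T) by exact: measurableI.
have PEoo : (perimeter E < +oo)%E by apply: le_lt_trans PE0; exact: minimizer_perimeter hpos mE0 minE.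
have PE := perimeter_fin_num PEoo.
(* The calibration, translated by [w], bounds from below the perimeter that is
   saved by cutting with the translate [B] of [E0]. *)
have calB : (perimeter (E `&` B) + (\int[mu]_(x in E `\` B) G x)%:E <= perimeter E)%E.
  rewrite -leeBrDr//; apply: perimeter_le => // xi [xi1 xi2]; rewrite leeBrDr// -EFinD.
  have [s1 s2] := C1c_shift (- w) xi1.
  have mS : measurable (shift_set E (- w) : set T) by exact: lebesgue_measurable_shift.
  have := cal _ _ mS (conj s1 (fun x => xi2 (x - w))); rewrite perimeter_shift//.
  have -> : \int[mu]_(x in shift_set E (- w) `&` E0) divergence (fun x => xi (x - w)) x =
      \int[mu]_(x in E `&` B) divergence xi x.
    rewrite (@eq_Rintegral _ _ _ mu _ (fun x => divergence xi (x - w))); last by move=> x _; exact: s2.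
    rewrite -(Bc_int_shift w (measurableI _ _ mS mE0) (Bc_shift (- w) (Bc_div xi1))).
    have -> : shift_set (shift_set E (- w) `&` E0) w = E `&` B.
      by apply/seteqP; split=> x; rewrite /shift_set /B/= addrK.
    by apply: eq_Rintegral => x _; rewrite addrK.
  have -> : \int[mu]_(x in shift_set E (- w) `\` E0) g x = \int[mu]_(x in E `\` B) G x; last by [].
  rewrite -(Bc_int_shift w (measurableD mS mE0) (Cc_Bc gc)).
  have -> // : shift_set (shift_set E (- w) `\` E0) w = E `\` B.
  by apply/seteqP; split=> x; rewrite /shift_set /B/= addrK.
have PEB : perimeter (E `&` B) \is a fin_num.
  apply: perimeter_fin_num; move: calB; rewrite -leeBrDr// => /le_lt_trans; apply.
  by rewrite -(fineK PE) -EFinB ltry.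
have hV : 0 < h^-1 by rewrite invr_gt0.
have md X : measurable_fun X (fun x : T => edist_to x (boundary E0)).
  by apply: measurable_funTS; exact: measurable_edist.
pose f1 (x : T) : \bar R := (if x \in E0 then 0 else edist_to x (boundary E0))%E.
pose g1 (x : T) : \bar R := (if x \in E0 then edist_to x (boundary E0) else 0)%E.
have m0 : measurable_fun setT (fun _ : T => 0%E : \bar R) by exact: measurable_cst.
have mf1 : measurable_fun setT f1 := measurable_if_in mE0 m0 (md _).
have mg1 : measurable_fun setT g1 := measurable_if_in mE0 (md _) m0.
have f10 x : (0 <= f1 x)%E by rewrite /f1; case: (x \in E0) => //; exact: edist_ge0.
have g10 x : (0 <= g1 x)%E by rewrite /g1; case: (x \in E0) => //; exact: edist_ge0.
pose a := (\int[mu]_(x in (E `\` B) `\` E0) edist_to x (boundary E0))%E.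
pose b := (\int[mu]_(x in (E `\` B) `&` E0) edist_to x (boundary E0))%E.
have bN : Bc (fun x => `|G x|) := Bc_norm bG.
have bP : Bc (fun x => `|G x| + G x) := BcD bN bG.
have P0 x : 0 <= `|G x| + G x by have := ler_norm (- G x); rewrite normrN; lra.
(* Minimality against [E `&` B]; the absolute value of [G] is added on both
   sides so that all integrands are nonnegative. *)
have key : ((\int[mu]_(x in E `\` B) (`|G x| + G x))%:E + (h^-1)%:E * a <=
    (\int[mu]_(x in E `\` B) `|G x|)%:E + (h^-1)%:E * b)%E.
  rewrite (Bc_intD mD bN bG) EFinD -addeA leeD2lE//.
  rewrite -(leeD2lE _ _ PEB) addeA.
  apply: le_trans (minimizer_cap hpos mE0 minE PE0 mB); exact: leeD2r.
have k0 : 0 < delta - h^-1 * enorm w by rewrite subr_gt0 mulrC ltr_pdivrMr.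
have mfun (u : 'rV[R]_n -> R) (f : T -> \bar R) : Bc u -> measurable_fun setT f ->
    measurable_fun setT (fun x : T => ((u x)%:E + (h^-1)%:E * f x)%E).
  move=> bu mf; apply: emeasurable_funD; last exact: measurable_funeM.
  by apply/measurable_EFinP; exact: bu.1.
have fun0 (u : 'rV[R]_n -> R) (f : T -> \bar R) : (forall x, 0 <= u x) -> (forall x, 0 <= f x)%E ->
    forall x, (0 <= (u x)%:E + (h^-1)%:E * f x)%E.
  by move=> u0 f0 x; rewrite adde_ge0 ?lee_fin// mule_ge0// lee_fin ltW.
apply: (integral_gap_null mD k0 (mfun _ _ bP mf1) (mfun _ _ bN mg1) (fun0 _ _ P0 f10)
  (fun0 _ _ (fun x => normr_ge0 (G x)) g10)).
- move=> x [Ex Bx]; rewrite /f1 /g1.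
  have xwE : ~ E0 (x + w) by [].
  have [xE|xE] := boolP (x \in E0); rewrite ?inE ?notin_setE in xE.
    (* Inside [E0] but outside its translate: the boundary is at distance at most
       [enorm w]. *)
    have [t /andP[t0 t1] tb] := segment_boundary xE xwE.
    have e : x + w - x = w by rewrite addrAC subrr add0r.
    rewrite e in tb.
    have dw : (edist_to x (boundary E0) <= (enorm w)%:E)%E.
      apply: le_trans (edist_le x tb) _.
      rewrite opprD addrA subrr add0r enormN enormZ ger0_norm// lee_fin.
      by rewrite ler_piMl ?enorm_ge0.
    have Gd : delta <= G x.
      apply: (gd _ _ tb); rewrite opprD addrACA subrr add0r -{1}(scale1r w) -scalerBl enormZ.
      rewrite ger0_norm ?subr_ge0//; apply: (@le_lt_trans _ _ (enorm w)).
        by rewrite ler_piMl ?enorm_ge0// gerBl.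
      by apply: lt_trans wh _; rewrite gtr_pMr.
    have dfin : edist_to x (boundary E0) \is a fin_num.
      by rewrite ge0_fin_numE ?edist_ge0// (le_lt_trans dw)// ltry.
    move: dw; rewrite -(fineK dfin); move: (fine _) => s; rewrite lee_fin => sw.
    rewrite mule0 adde0 -EFinM -!EFinD lee_fin.
    have : h^-1 * s <= h^-1 * enorm w by rewrite ler_pM2l.
    lra.
  (* Outside [E0]: either [x + w] is close to the boundary and [g] is large, or
     the distance is. *)
  have [[p pb pd]|np] := pselect (exists2 p, boundary E0 p & enorm (x + w - p) < delta).
    have Gd := gd _ _ pb pd; rewrite mule0 adde0.
    apply: (@le_trans _ _ (`|G x| + G x)%:E); last first.
      by rewrite leeDl// mule_ge0 ?edist_ge0// lee_fin ltW.
    rewrite -EFinD lee_fin; have := mulr_ge0 (ltW hV) (enorm_ge0 w).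
    have -> : G x = g (x + w) by [].
    lra.
  have dd : ((delta - enorm w)%:E <= edist_to x (boundary E0))%E.
    apply: edist_geP => p pb; rewrite lee_fin.
    have pd : delta <= enorm (x + w - p) by rewrite leNgt; apply/negP => pd; apply: np; exists p.
    by have := enormD (x - p) w; rewrite addrAC; lra.
  rewrite mule0 adde0.
  apply: (@le_trans _ _ ((`|G x| + G x)%:E + (h^-1)%:E * (delta - enorm w)%:E)%E); last first.
    by rewrite leeD2l// lee_pmul2l// lte_fin.
  rewrite -EFinM -!EFinD lee_fin mulrBr.
  have e1 : 2 * delta + C <= h^-1 * delta by rewrite [leRHS]mulrC ler_pdivlMr// mulrC ltW.
  by have := hC (x + w); rewrite -/(G x) ler_norml; lra.
- rewrite (int_add_scale mD bP P0 mf1 f10 (ltW hV)) -intC_if.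
  apply: lte_add_pinfty; first by rewrite ltry.
  apply: (@le_lt_trans _ _ ((h^-1)%:E * \int[mu]_(x in E `+` E0) edist_to x (boundary E0))%E).
    rewrite lee_pmul2l ?lte_fin//; apply: (int_dist_sub E0 (measurableD mD mE0) (measurable_setY mE mE0)).
    by move=> x [[Ex _] E0x]; left.
  have := minimizer_int_dist hpos mE0 minE PE0; have := int_dist_ge0 E0 (E `+` E0).
  by case: (\int[mu]_(x in E `+` E0) _)%E => // s _ _; rewrite -EFinM ltry.
- by rewrite (int_add_scale mD bP P0 mf1 f10 (ltW hV)) (int_add_scale mD bN (fun x => normr_ge0 (G x)) mg1 g10 (ltW hV)) -intC_if -intD_if.
Qed.

End minimizers.

(** * The discrete flow *)

Section flow.
Context {R : realType} {n : nat}.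
Implicit Types (x y z v w : 'rV[R]_n) (A B D E F G K : set 'rV[R]_n) (h rho delta : R).
Local Notation T := (lebesgue_rV R n).
Local Notation mu := (@lebesgue R n).

Lemma nested_le F G rho sigma : sigma <= rho -> nested F G rho -> nested F G sigma.
Proof. by move=> sr FG w wr; apply: FG; exact: lt_le_trans wr sr. Qed.

Lemma nested_diff F G rho : 0 < rho -> nested F G rho -> mu (F `\` G) = 0%E.
Proof.
move=> r0 /(_ 0); rewrite enorm0 => /(_ r0).
by rewrite (_ : shift_set G 0 = G)//; apply/seteqP; split=> x; rewrite /shift_set/= addr0.
Qed.

Lemma nested_shift F G rho v : nested F G rho -> nested F (shift_set G v) (rho - enorm v).
Proof.
move=> FG w wr.
rewrite (_ : shift_set (shift_set G v) w = shift_set G (w + v)); last first.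
  by apply/seteqP; split=> x; rewrite /shift_set/= addrA.
by apply: FG; rewrite (le_lt_trans (enormD _ _))// -ltrBrDr.
Qed.

Section sequence.
Hypothesis mu_neq0 : mu setT != 0%E.
Variables (h delta : R) (Ek : nat -> set 'rV[R]_n).
Hypotheses (h0 : 0 < h) (d0 : 0 < delta) (mE0 : measurable (Ek 0%N : set T)).
Hypothesis PE0 : (perimeter (Ek 0%N) < +oo)%E.
Hypothesis minE : forall k, minimizer h (Ek k) (Ek k.+1).
Hypothesis essE : forall k, essential_boundary (Ek k).
Hypothesis first_step : nested (Ek 1%N) (Ek 0%N) delta.

Lemma measurable_step k : measurable (Ek k : set T).
Proof. by case: k => // k; exact: (minE k).1. Qed.

Lemma perimeter_step k : (perimeter (Ek k) <= perimeter (Ek 0%N))%E.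
Proof.
elim: k => // k ih; apply: le_trans ih.
exact: (minimizer_perimeter h0 (measurable_step k) (minE k)).
Qed.

Let perimeter_step_lty k : (perimeter (Ek k) < +oo)%E.
Proof. exact: le_lt_trans (perimeter_step k) PE0. Qed.

(** The speed of the first step is preserved by all later steps: the next step
    is compared with the translates of the present one by less than [delta],
    each of which is a step of the translated scheme. *)
Lemma nested_step k : nested (Ek k.+1) (Ek k) delta.
Proof.
elim: k => [|k ih]; first exact: first_step.
move=> w wd; have dw : 0 < delta - enorm w by rewrite subr_gt0.
have mk := measurable_step k; have mk1 := measurable_step k.+1.
have PG : (perimeter (shift_set (Ek k) w) < +oo)%E by rewrite perimeter_shift// perimeter_step_lty.
have eG : essential_boundary (shift_set (Ek k) w).
  move=> y; rewrite boundary_shift => /(essE (k := k))[y1 y2].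
  have sh A : ess_support A (y + w) -> ess_support (shift_set A w) y.
    move=> Ay r r0; have := Ay r r0; rewrite -(lebesgue_shift _ w).
    rewrite (_ : shift_set (A `&` eball (y + w) r) w = shift_set A w `&` eball y r)//.
    apply/seteqP; split=> x; rewrite /shift_set /eball/= => -[Ax xr]; split => //.
      by move: xr; rewrite opprD addrACA subrr addr0.
    by rewrite opprD addrACA subrr addr0.
  by split; [exact: (sh _ y1)|exact: (sh _ y2)].
have minG : minimizer h (shift_set (Ek k) w) (shift_set (Ek k.+1) w) := minimizer_shift w mk (minE k).
have FG : nested (Ek k.+1) (shift_set (Ek k) w) (delta - enorm w) := @nested_shift _ _ _ w ih.
have mG : measurable (shift_set (Ek k) w : set T) by exact: lebesgue_measurable_shift.
have eF : essential_boundary (Ek k.+1) := @essE k.+1.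
exact: (minimizer_comparison mu_neq0 h0 dw mk1 mG eF eG (perimeter_step_lty k.+1) PG (minE k.+1) minG FG).
Qed.

Lemma nested_iter k m : nested (Ek (k + m.+1)) (Ek k) (m.+1%:R * delta).
Proof.
elim: m => [|m ih]; first by rewrite addn1 mul1r; exact: nested_step.
rewrite addnS (_ : m.+2%:R * delta = delta + m.+1%:R * delta); last first.
  by rewrite -[in LHS]addn1 natrD mulrDl mul1r addrC.
exact: (nested_trans d0 (mulr_gt0 (ltr0Sn _ _) d0) (nested_step (k + m.+1)) ih).
Qed.

Lemma diff_step k l : (k <= l)%N -> mu (Ek l `\` Ek k) = 0%E.
Proof.
move=> kl; have := @nested_iter k (l - k).-1; have [->|kl'] := eqVneq k l.
  by rewrite setDv => _; exact: lebesgue_outer0.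
have lk : (l - k).-1.+1 = (l - k)%N by rewrite prednK// subn_gt0 ltn_neqAle kl' kl.
rewrite lk subnKC// => /nested_diff; apply.
by rewrite mulr_gt0// ltr0n subn_gt0 ltn_neqAle kl' kl.
Qed.

(** Each step has least perimeter among the sets between itself and the
    previous step, since adding such a part to the minimizer does not increase
    the distance term. By submodularity, cutting an arbitrary competitor with
    the previous step does not increase its perimeter, as the previous step is
    itself outward minimizing. *)
Lemma outward_minimizing k F : measurable (F : set T) -> mu (Ek k `\` F) = 0%E ->
  mu (F `\` Ek 0%N) = 0%E -> (perimeter (Ek k) <= perimeter F)%E.
Proof.
elim: k F => [|k ih] F mF EF FE.
  have F0 : mu (Ek 0%N `+` F) = 0%E by exact: lebesgue_nullU.
  by rewrite (perimeter_ae mE0 mF F0).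
have mk := measurable_step k; have mk1 := measurable_step k.+1.
have mB : measurable (F `&` Ek k : set T) by exact: measurableI.
have PB : perimeter (F `&` Ek k `|` Ek k.+1) = perimeter (F `&` Ek k).
  apply: perimeter_ae => //; first exact: measurableU.
  apply: lebesgue_null_sub (lebesgue_nullU EF (diff_step (leqnSn k))) => x [[[h1|h1] h2]|[h1 h2]].
  - by have := h2 h1.
  - by have [Fx|Fx] := pselect (F x); [right; split => // kx; exact: h2|left].
  - by exfalso; apply: h2; left.
have h1 : (perimeter (Ek k.+1) <= perimeter (F `&` Ek k))%E.
  rewrite -PB; have := minimizer_cup h0 mk (minE k) (perimeter_step_lty k) mB.
  rewrite (_ : (F `&` Ek k `\` Ek k.+1) `\` Ek k = set0); last first.
    by rewrite -subset0 => x [[[_ kx] _]].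
  rewrite integral_set0 mule0 adde0; apply: le_trans; rewrite leeDl// mule_ge0 ?int_dist_ge0//.
  by rewrite lee_fin invr_ge0 ltW.
apply: le_trans h1 _.
have h2 : (perimeter (Ek k) <= perimeter (F `|` Ek k))%E.
  apply: ih; first exact: measurableU.
    by rewrite setDUr setDv setI0; exact: lebesgue_outer0.
  by rewrite setDUl; apply: lebesgue_nullU => //; exact: diff_step.
have := perimeter_submod mu_neq0 mF mk.
have Pk := perimeter_fin_num (perimeter_step_lty k).
move=> h3; rewrite -(leeD2rE _ _ Pk); apply: le_trans h3; exact: leeD2l.
Qed.

End sequence.

(** What the passage to the limit needs to know about an approximation with
    time step [h]: it shrinks at speed at least [delta], up to a delay of one
    step, and it minimizes the perimeter among the sets between itself and the
    initial set. *)
Definition shrinking_flow (E0 : set 'rV[R]_n) h delta (Ft : R -> set 'rV[R]_n) :=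
  [/\ forall t, 0 <= t -> measurable (Ft t : set T),
      forall s t, 0 <= s -> s + h < t -> nested (Ft t) (Ft s) (delta * (t - s - h)),
      forall s t, 0 <= s -> s <= t -> mu (Ft t `\` Ft s) = 0%E,
      forall t, 0 <= t -> mu (Ft t `\` E0) = 0%E &
      forall t F, 0 <= t -> measurable (F : set T) -> mu (Ft t `\` F) = 0%E ->
        mu (F `\` E0) = 0%E -> (perimeter (Ft t) <= perimeter F)%E].

Lemma floor_step h t : 0 < h -> 0 <= t -> exists k : nat, k%:R * h <= t < k.+1%:R * h.
Proof.
move=> h0 t0; exists (Num.truncn (t / h)).
have th0 : 0 <= t / h by rewrite divr_ge0// ltW.
by have := truncn_itv th0; rewrite ler_pdivlMr// ltr_pdivrMr.
Qed.

(** The perimeter of the initial set is finite by its calibration, used with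
    the whole space as a competitor. The speed is that of the first step, and
    every later step has an essential boundary because it is a good
    representative. *)
Lemma atw_shrinking_flow (E0 : set 'rV[R]_n) : mu setT != 0%E -> compact E0 -> C2_boundary E0 ->
  (forall x, boundary E0 x -> 0 < mean_curvature E0 x) ->
  (perimeter E0 < +oo)%E /\
  exists delta h0 : R, [/\ 0 < delta, 0 < h0 & forall h (Eh : R -> set 'rV[R]_n),
    0 < h -> h < h0 -> atw_approximation h E0 Eh -> shrinking_flow E0 h delta Eh].
Proof.
move=> mu_neq0 cE C2 mc.
have mE0 : measurable (E0 : set T).
  by apply: lebesgue_measurable_closed; apply: compact_closed => //; exact: norm_hausdorff.
have [g [delta [d0 gc gd cal]]] := mean_convex_calibration mE0 (compact_boundary cE) mc.
have PE0 : (perimeter E0 < +oo)%E.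
  apply: (@le_lt_trans _ _ (- \int[mu]_(x in setT `\` E0) g x)%:E); last exact: ltry.
  apply: perimeter_le => // xi xia; have := cal _ _ measurableT xia.
  by rewrite perimeter_setT setTI !lee_fin; lra.
split => //; have [h1 h10 first] := minimizer_calibrated mE0 d0 gc PE0 gd cal.
exists delta, h1; split => // h Eh hpos hh1 [Ek [Ek0 step EhE]].
have mink k : minimizer h (Ek k) (Ek k.+1) by have [m1 m2 _] := step k.
have mEk k : measurable (Ek k : set T) by case: k => [|k]; [rewrite Ek0|have [] := step k].
have essk k : essential_boundary (Ek k).
  case: k => [|k]; first by rewrite Ek0; exact: C2_boundary_essential.
  by have [m1 _ gr] := step k; exact: good_representative_essential.
have dh : 0 < delta * h by rewrite mulr_gt0.
have PEk0 : (perimeter (Ek 0%N) < +oo)%E by rewrite Ek0.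
have mEk0 : measurable (Ek 0%N : set T) := mEk 0%N.
have first_step : nested (Ek 1%N) (Ek 0%N) (delta * h).
  by rewrite Ek0; apply: (first h) => //; rewrite -Ek0; exact: mink.
have iter k m : nested (Ek (k + m.+1)%N) (Ek k) (m.+1%:R * (delta * h)).
  exact: (nested_iter mu_neq0 hpos dh mEk0 PEk0 mink essk first_step).
have diff := diff_step mu_neq0 hpos dh mEk0 PEk0 mink essk first_step.
have ordered s t k l : s <= t -> k%:R * h <= s -> t < l.+1%:R * h -> (k <= l)%N.
  move=> st ks tl; rewrite -ltnS -(ltr_nat R) -(ltr_pM2r hpos).
  exact: le_lt_trans ks (le_lt_trans st tl).
split.
- by move=> t t0; have [k kt] := floor_step hpos t0; rewrite (EhE _ _ kt).
- move=> s t s0 sht; have t0 : 0 <= t by lra.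
  have [k kt] := floor_step hpos s0; have [l lt] := floor_step hpos t0.
  rewrite (EhE _ _ kt) (EhE _ _ lt); case/andP: kt => k1 k2; case/andP: lt => l1 l2.
  have kl : (k < l)%N.
    rewrite -(ltr_nat R) -(ltr_pM2r hpos); move: l2; rewrite -[in X in X -> _]addn1 natrD mulrDl mul1r.
    by lra.
  have := iter k (l - k).-1; have -> : (l - k).-1.+1 = (l - k)%N by rewrite prednK// subn_gt0.
  rewrite subnKC ?(ltnW kl)//; apply: nested_le.
  rewrite natrB ?(ltnW kl)// mulrCA ler_pM2l// mulrBl.
  by move: l2; rewrite -[in X in X -> _]addn1 natrD mulrDl mul1r; lra.
- move=> s t s0 st; have t0 : 0 <= t by exact: le_trans st.
  have [k kt] := floor_step hpos s0; have [l lt] := floor_step hpos t0.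
  rewrite (EhE _ _ kt) (EhE _ _ lt); case/andP: kt => k1 k2; case/andP: lt => l1 l2.
  by apply: diff; exact: (ordered s t).
- move=> t t0; have [l lt] := floor_step hpos t0; rewrite (EhE _ _ lt) -Ek0.
  exact: diff.
- move=> t F t0 mF EF FE; have [l lt] := floor_step hpos t0.
  rewrite (EhE _ _ lt); apply: (outward_minimizing mu_neq0 hpos dh mEk0 PEk0 mink essk first_step) => //.
    by rewrite -(EhE _ _ lt).
  by rewrite Ek0.
Qed.

End flow.

(** * Completed Lebesgue measure on the line *)

Section completed_line.
Context {R : realType}.
Local Notation S := (caratheodory_type (wlength (@idfun R))^*%mu).
Local Notation leb := (@completed_lebesgue_measure R).

(** The sigma-algebra of the completed measure is that of the outer measure,
    which contains the Borel sets. *)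
Lemma completed_measurable (A : set R) : measurable A -> measurable (A : set S).
Proof. by move=> mA; exact: (@sub_caratheodory _ _ R (wlength idfun) A mA). Qed.

Lemma completed_measurable_fun d (U : measurableType d) (f : R -> U) (D : set R) :
  measurable D -> measurable_fun D f -> measurable_fun (D : set S) (f : S -> U).
Proof. by move=> mD mf _ Y mY; apply: completed_measurable; exact: mf. Qed.

Lemma completed_itvcc (a b : R) : leb `[a, b]%classic = (Num.max 0 (b - a))%:E.
Proof.
have -> : leb `[a, b]%classic = lebesgue_measure (`[a, b]%classic : set R) by [].
rewrite lebesgue_measure_itv/= lte_fin; case: ltP => ab.
  by rewrite (max_idPr _) ?EFinB// subr_ge0 ltW.
by rewrite (max_idPl _)// subr_le0.
Qed.

Lemma completed_itvoo (a b : R) : leb `]a, b[%classic = (Num.max 0 (b - a))%:E.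
Proof.
have -> : leb `]a, b[%classic = lebesgue_measure (`]a, b[%classic : set R) by [].
rewrite lebesgue_measure_itv/= lte_fin; case: ltP => ab.
  by rewrite (max_idPr _) ?EFinB// subr_ge0 ltW.
by rewrite (max_idPl _)// subr_le0.
Qed.

End completed_line.

(** * Time slices *)

Section slices.
Context {R : realType} {n : nat}.
Local Notation S := (caratheodory_type (wlength (@idfun R))^*%mu).
Local Notation leb := (@completed_lebesgue_measure R).
Local Notation T := (lebesgue_rV R n).
Local Notation mu := (@lebesgue R n).
Local Notation T' := (lebesgue_rV R (n + 1)).
Local Notation mu' := (@lebesgue R (n + 1)).
Implicit Types (A C E N : set 'rV[R]_(n + 1)) (t : R).

Let slice_box (c : option ('rV[R]_(n + 1) * 'rV[R]_(n + 1))) t : option ('rV[R]_n * 'rV[R]_n) :=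
  if c is Some ab then
    if (ab.1 0 (rshift n ord0) <= t <= ab.2 0 (rshift n ord0)) then Some (lsubmx ab.1, lsubmx ab.2) else None
  else None.

Let time_slice_box c t : time_slice (box c) t `<=` box (slice_box c t).
Proof.
case: c => [[a b]|//] x /= h; have := h (rshift n ord0); rewrite row_mxEr mxE => ->.
by move=> i; rewrite /= !mxE; have := h (lshift 1 i); rewrite row_mxEl.
Qed.

Let measurable_slice_box c : measurable_fun setT (fun t : S => box_vol (slice_box c t)).
Proof.
case: c => [[a b]|]; last exact: measurable_cst.
pose I : set R := `[a 0 (rshift n ord0), b 0 (rshift n ord0)]%classic.
rewrite (_ : (fun t => _) = fun t : S =>
  (box_vol (Some (lsubmx a, lsubmx b)) * (\1_I t)%:E)%E); last first.
  apply/funext => t /=; rewrite indicE (_ : (t \in I) = (a 0 (rshift n ord0) <= t <= b 0 (rshift n ord0))).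
    by case: ifP => _; rewrite ?mule1 ?mule0.
  by rewrite mem_setE in_itv.
apply: measurable_funeM; apply/measurable_EFinP; apply: measurable_indic.
by apply: completed_measurable; exact: measurable_itv.
Qed.

Let int_slice_box c : (\int[leb]_t box_vol (slice_box c t) = box_vol c)%E.
Proof.
case: c => [[a b]|]; last by rewrite integral0_eq.
pose I : set R := `[a 0 (rshift n ord0), b 0 (rshift n ord0)]%classic.
have mI : measurable (I : set S) by apply: completed_measurable; exact: measurable_itv.
transitivity (\int[leb]_t (box_vol (Some (lsubmx a, lsubmx b)) * (\1_I t)%:E))%E.
  apply: eq_integral => t _ /=; rewrite indicE (_ : (t \in I) = (a 0 (rshift n ord0) <= t <= b 0 (rshift n ord0))).
    by case: ifP => _; rewrite ?mule1 ?mule0.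
  by rewrite mem_setE in_itv.
have mind : measurable_fun setT (fun t : S => (\1_I t : R)%:E).
  by apply/measurable_EFinP; apply: measurable_indic.
have ind0 (t : S) : setT t -> (0 <= (\1_I t : R)%:E)%E by move=> _; rewrite lee_fin.
rewrite (ge0_integralZl leb measurableT mind ind0 (box_vol_ge0 _)).
have -> : (\int[leb]_t (\1_I t)%:E = leb I)%E by rewrite integral_indic// setIT.
rewrite (completed_itvcc (a 0 (rshift n ord0)) (b 0 (rshift n ord0))) -EFinM; congr (_%:E).
rewrite big_split_ord/= big_ord1; congr (_ * _).
by apply: eq_bigr => i _; rewrite !mxE.
Qed.

(** Almost all slices of a null set are null: slice a covering by boxes. *)
Lemma slice_null N : mu' N = 0%E -> {ae leb, forall t, mu (time_slice N t) = 0%E}.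
Proof.
move=> N0.
have /choice[F hF] : forall m : nat, exists F : nat -> option ('rV[R]_(n + 1) * 'rV[R]_(n + 1)),
    N `<=` \bigcup_k box (F k) /\ (\sum_(k <oo) box_vol (F k) <= (m.+1%:R^-1)%:E)%E.
  move=> m; have m0 : (0 < m.+1%:R^-1 :> R)%R by rewrite invr_gt0.
  have fin : mu' N \is a fin_num by rewrite N0.
  have [_ [F NF <-] /ltW hF] := lb_ereal_inf_adherent m0 fin.
  by exists F; split => //; move: hF; rewrite -/(lebesgue_outer N) -/(mu' N) N0 add0e.
pose phi m (t : S) : \bar R := (\sum_(k <oo) box_vol (slice_box (F m k) t))%E.
have phi0 m t : (0 <= phi m t)%E by apply: nneseries_ge0 => k _ _; exact: box_vol_ge0.
have mphi m : measurable_fun setT (phi m).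
  apply: ge0_emeasurable_sum => [k t _ _|k _]; first exact: box_vol_ge0.
  exact: measurable_slice_box.
have iphi m : (\int[leb]_t phi m t <= (m.+1%:R^-1)%:E)%E.
  rewrite (integral_nneseries leb measurableT (fun k => measurable_slice_box (F m k)) (fun k t _ => box_vol_ge0 _)).
  apply: le_trans (hF m).2; rewrite le_eqVlt; apply/orP; left; apply/eqP.
  by apply: eq_eseriesr => k _; exact: int_slice_box.
have sphi m t : (mu (time_slice N t) <= phi m t)%E.
  apply: ereal_inf_lbound; exists (fun k => slice_box (F m k) t) => //.
  move=> x /((hF m).1)[k _ xk]; exists k => //; exact: time_slice_box.
pose psi (t : S) := einfs (phi^~ t) 0%N.
have psile m t : (psi t <= phi m t)%E by apply: ereal_inf_lbound; exists m.
have psi0 t : (0 <= psi t)%E by apply: le_ereal_inf_tmp => _ [m _ <-].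
have mpsi : measurable_fun setT psi by exact: (measurable_fun_einfs mphi).
have ipsi : (\int[leb]_t `|psi t| = 0)%E.
  have -> : (\int[leb]_t `|psi t| = \int[leb]_t psi t)%E.
    by apply: eq_integral => t _; rewrite gee0_abs.
  apply/eqP; rewrite eq_le integral_ge0 ?andbT//.
  apply/lee_addgt0Pr => e e0; rewrite add0e.
  have [m _ hm] := near_infty_natSinv_lt (PosNum e0).
  apply: (@le_trans _ _ (\int[leb]_t phi m t)%E).
    exact: (ge0_le_integral leb measurableT (fun t _ => psi0 t) mpsi (mphi m) (fun t _ => psile m t)).
  by rewrite (le_trans (iphi m))// lee_fin ltW//; exact: (hm m (leqnn m)).
have := (ae_eq_integral_abs leb measurableT mpsi).1 ipsi.
apply: filterS => t /(_ I) /= pt; apply/eqP; rewrite eq_le lebesgue_outer_ge0 andbT -pt.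
by apply: le_ereal_inf_tmp => _ [m _ <-]; exact: sphi.
Qed.

Lemma measurable_row_mx t i : measurable_fun setT (fun x : T => row_mx (x : 'rV[R]_n) (const_mx t : 'rV[R]_1) 0 i).
Proof.
case: (split_ordP i) => j ->.
  by under eq_fun do rewrite row_mxEl; exact: measurable_coord.
by under eq_fun do rewrite row_mxEr mxE; exact: measurable_cst.
Qed.

Lemma measurable_borel_slice A t : measurable (A : set (borel_rV R (n + 1))) ->
  measurable (time_slice A t : set T).
Proof.
move=> mA; exact: (@measurable_preimage_borel R (n + 1) _ T (fun x => row_mx x (const_mx t)) A (measurable_row_mx t) mA).
Qed.

Lemma measurable_null (N : set 'rV[R]_n) : mu N = 0%E -> measurable (N : set T).
Proof.
move=> N0; suff : (@lebesgue_outer R n).-caratheodory N by [].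
apply: le_caratheodory_measurable => X.
rewrite [leLHS](_ : _ = lebesgue_outer (X `&` N) + lebesgue_outer (X `&` ~` N))%E//.
have -> : lebesgue_outer (X `&` N) = 0%E by apply: (lebesgue_null_sub _ N0) => x [].
by rewrite add0e; apply: le_lebesgue_outer => x [].
Qed.

(** Up to a null set every measurable set is Borel: its bounded pieces, of
    finite measure, differ from their Borel hulls by null sets. *)
Lemma borel_superset E : measurable (E : set T') ->
  exists A, [/\ measurable (A : set (borel_rV R (n + 1))), E `<=` A & mu' (A `\` E) = 0%E].
Proof.
move=> mE; pose B (k : nat) : set 'rV[R]_(n + 1) := [set x | enorm x <= k%:R].
have mB k : measurable (B k : set T') by exact: measurable_cball.
have /choice[A hA] : forall k : nat, exists A : set 'rV[R]_(n + 1),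
    [/\ measurable (A : set (borel_rV R (n + 1))), E `&` B k `<=` A & mu' A = mu' (E `&` B k)].
  by move=> k; exact: borel_hull.
exists (\bigcup_k A k); split.
- by apply: bigcup_measurable => k _; have [] := hA k.
- move=> x Ex; have [_ EA _] := hA (Num.truncn (enorm x)).+1.
  exists (Num.truncn (enorm x)).+1 => //; apply: EA; split => //.
  by rewrite /B/= ltW//; have /andP[] := truncn_itv (enorm_ge0 x).
have null k : mu' (A k `\` (E `&` B k)) = 0%E.
  have [bA EA hm] := hA k; have mA := measurable_borel bA.
  have mEB : measurable (E `&` B k : set T') by exact: measurableI.
  have oo : (mu' (E `&` B k) < +oo)%E.
    by apply: (@lebesgue_bounded_lty _ _ _ k%:R) => x [].
  have e : mu' (A k `\` (E `&` B k)) = (mu' (A k) - mu' (A k `&` (E `&` B k)))%E.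
    have hoo : (mu' (A k) < +oo)%E by rewrite hm.
    exact: (measureD mA mEB hoo).
  by rewrite e setIidr// hm subee// ge0_fin_numE// lebesgue_outer_ge0.
have : mu' (\bigcup_k (A k `\` (E `&` B k))) = 0%E.
  apply/eqP; rewrite eq_le lebesgue_outer_ge0 andbT.
  apply: le_trans (lebesgue_outer_sigma_subadditive _) _.
  by rewrite eseries0// => k _ _; exact: null.
by apply: lebesgue_null_sub => x [[k _ Ak] Ex]; exists k => //; split => // -[].
Qed.

Lemma slice_measurable E : measurable (E : set T') ->
  {ae leb, forall t, measurable (time_slice E t : set T)}.
Proof.
move=> /borel_superset[A [bA EA N0]]; apply: (@filterS _ _ (ae_filter_ringOfSetsType leb) _ _ _ (slice_null N0)) => t t0.
have -> : time_slice E t = time_slice A t `\` time_slice (A `\` E) t.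
  apply/seteqP; split=> x; rewrite /time_slice/=; first by move=> Ex; split; [exact: EA|case].
  by move=> [Ax h]; apply: contrapT => Ex; exact: h.
by apply: measurableD; [exact: measurable_borel_slice|exact: measurable_null].
Qed.

(** For a Borel set this is the measurability of the sections of a measurable
    set of the product. The exceptional null set of times is harmless because
    the measure on the line is complete. *)
Lemma slice_setY_measurable E (C : set 'rV[R]_n) : measurable (E : set T') -> measurable (C : set T) ->
  measurable_fun setT (fun t : S => mu (C `+` time_slice E t)).
Proof.
move=> mE mC; have [A [bA EA N0]] := borel_superset mE.
pose f (p : R * T) : 'rV[R]_(n + 1) := row_mx (p.2 : 'rV[R]_n) (const_mx p.1).
have mf i : measurable_fun setT (fun p : R * T => f p 0 i).
  rewrite /f; case: (split_ordP i) => j ->.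
    under eq_fun do rewrite row_mxEl.
    exact: (measurableT_comp (measurable_coord j) measurable_snd).
  by under eq_fun do rewrite row_mxEr mxE; exact: measurable_fst.
pose P : set (R * T) := (setT `*` C) `+` (f @^-1` A).
have mP : measurable P.
  have m1 : measurable (setT `*` C : set (R * T)) by exact: measurableX.
  have m2 : measurable (f @^-1` A) by exact: (measurable_preimage_borel mf bA).
  by apply: measurableU; exact: measurableD.
have mg : measurable_fun setT (fun t : S => mu (C `+` time_slice A t)).
  apply: completed_measurable_fun => //.
  have := measurable_fun_xsection (@lebesgue R n) mP; congr measurable_fun.
  apply/funext => t /=; congr lebesgue; apply/seteqP; split=> x; rewrite /xsection/= inE.
    by rewrite /P /setY/= => -[[[_ h1] h2]|[h1 h2]]; [left|right]; split => // h; apply: h2.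
  by rewrite /P /setY/= => -[[h1 h2]|[h1 h2]]; [left|right]; split => // -[].
apply: (ae_measurable_fun completed_lebesgue_measure_is_complete _ mg).
apply: (@filterS _ _ (ae_filter_ringOfSetsType leb) _ _ _ (slice_null N0)) => t t0 _.
have le (X Y : set 'rV[R]_n) : X `<=` Y `|` time_slice (A `\` E) t -> (mu X <= mu Y)%E.
  move=> XY; apply: le_trans (le_lebesgue_outer XY) _.
  by rewrite (le_trans (outer_measureU2 _ _ _))//= -/(mu Y) -/(mu (time_slice (A `\` E) t)) t0 adde0.
apply/eqP; rewrite eq_le; apply/andP; split; apply: le => x; rewrite /setY /time_slice/=.
  move=> [[Cx Ax]|[Ax Cx]]; [left|]; first by left; split => // /EA.
  by have [Ex|Ex] := pselect (E (row_mx x (const_mx t))); [left; right|right].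
move=> [[Cx Ex]|[Ex Cx]]; last by left; right; split => //; exact: EA.
by have [Ax|Ax] := pselect (A (row_mx x (const_mx t))); [right|left; left].
Qed.

End slices.

(** * Differences of nested sets *)

Section support_points.
Context {R : realType} {n : nat}.
Implicit Types (x y z : 'rV[R]_n) (A F G : set 'rV[R]_n).
Local Notation T := (lebesgue_rV R n).
Local Notation mu := (@lebesgue R n).

(** A set of positive measure has positive measure around some point: otherwise
    finitely many balls in which it is null would cover any bounded part of it. *)
Lemma ess_support_exists A : mu A != 0%E -> exists y, ess_support A y.
Proof.
move=> A0; apply: contrapT => /forallNP h.
have /choice[r hr] : forall y, exists r : R, 0 < r /\ mu (A `&` eball y r) = 0%E.
  move=> y; have /existsNP[r /not_implyP[r0 hr]] := h y; exists r; split => //.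
  by apply/eqP; rewrite eq_le lebesgue_outer_ge0 andbT leNgt; exact/negP.
move/negP : A0; apply.
pose K (k : nat) : set 'rV[R]_n := [set x | enorm x <= k%:R].
have null k : mu (A `&` K k) = 0%E.
  have : compact (K k) by exact: compact_closed_ball.
  rewrite compact_cover => /(_ 'rV[R]_n setT (fun y => eball y (r y))).
  move=> /(_ (fun y _ => @open_eball _ _ y _)) [].
    by move=> y _; exists y => //; apply: eball_center; exact: (hr y).1.
  move=> D _ Dcover; pose s := finmap.enum_fset D.
  have null_seq (s' : seq 'rV[R]_n) : mu (A `&` [set x | exists2 y, y \in s' & eball y (r y) x]) = 0%E.
    elim: s' => [|y s' ih].
      by apply: (lebesgue_null_sub _ (@lebesgue_outer0 R n)) => x [_ [y]].
    apply: lebesgue_null_sub (lebesgue_nullU (hr y).2 ih) => x [Ax [z]].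
    rewrite inE => /orP[/eqP ->|zs] zx; first by left.
    by right; split => //; exists z.
  apply: lebesgue_null_sub (null_seq s) => x [Ax /Dcover[y /= yD yx]].
  by split => //; exists y.
have : mu (\bigcup_k (A `&` K k)) = 0%E.
  apply/eqP; rewrite eq_le lebesgue_outer_ge0 andbT.
  apply: le_trans (lebesgue_outer_sigma_subadditive _) _.
  by rewrite eseries0// => k _ _; exact: null.
move=> B0; apply/eqP; apply: (lebesgue_null_sub _ B0) => x Ax.
exists (Num.truncn (enorm x)).+1 => //; split => //.
by rewrite /K/= ltW//; have /andP[] := truncn_itv (enorm_ge0 x).
Qed.

Lemma ess_supportS A F y : A `<=` F -> ess_support A y -> ess_support F y.
Proof.
move=> AF Ay r r0; apply: lt_le_trans (Ay r r0) _.
by apply: le_lebesgue_outer => x [Ax xr]; split => //; exact: AF.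
Qed.

Lemma ess_support_ball A y (r : R) z : ess_support (A `&` eball y r) z -> enorm (y - z) <= r.
Proof.
move=> h; apply/ler_addgt0Pr => e e0; have := h e e0.
have [->|/set0P[x [[_ xy] xz]] _] := eqVneq ((A `&` eball y r) `&` eball z e) set0.
  have -> : mu set0 = 0%E by exact: lebesgue_outer0.
  by rewrite ltxx.
have := enormD (y - x) (x - z); rewrite addrA subrK (enormB y x).
by move: xy xz; rewrite /eball/=; lra.
Qed.

Lemma null_ball_of_support A y (r s : R) : s < r -> (forall z, ess_support A z -> r <= enorm (y - z)) ->
  mu (A `&` eball y s) = 0%E.
Proof.
move=> sr h; apply/eqP; apply: contraT => /ess_support_exists[z zA].
have := h z (ess_supportS (@subIsetl _ _ _) zA).
by rewrite leNgt (le_lt_trans (ess_support_ball zA) sr).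
Qed.

(** Around a point where the first set leaves the second one uncovered, the
    intermediate sets are forced: [F'] contains a ball of radius [rho / 2] and
    [G'] misses it, up to null sets. *)
Lemma nested_difference_ball F F' G G' (rho : R) : measurable (F : set T) -> measurable (F' : set T) ->
  measurable (G : set T) -> measurable (G' : set T) -> 0 < rho ->
  nested F F' rho -> nested G' G rho -> mu (F `\` G) != 0%E ->
  (mu (eball (0%R : 'rV[R]_n) (rho / 2)) <= mu (F' `\` G'))%E.
Proof.
move=> mF mF' mG mG' r0 FF' G'G /ess_support_exists[y yFG].
have rr : rho / 2 < rho by rewrite ltr_pdivrMr// ltr_pMr// ltr1n.
have yF : ess_support F y by apply: ess_supportS yFG => x [].
have yG : ess_support (~` G) y by apply: ess_supportS yFG => x [].
have n1 : mu (~` F' `&` eball y (rho / 2)) = 0%E.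
  by apply: null_ball_of_support rr _ => z; exact: (nested_ess_support mF mF' FF' yF).
have n2 : mu (G' `&` eball y (rho / 2)) = 0%E.
  apply: null_ball_of_support rr _ => z zG'; rewrite enormB.
  exact: (nested_ess_support mG' mG G'G zG' yG).
rewrite -(lebesgue_shift _ (- y)).
have sub : shift_set (eball 0 (rho / 2)) (- y) `<=`
    (F' `\` G') `|` ((~` F' `&` eball y (rho / 2)) `|` (G' `&` eball y (rho / 2))).
  move=> x; rewrite /shift_set /eball/= subr0 => xr.
  have [Fx|Fx] := pselect (F' x); last by right; left.
  by have [Gx|Gx] := pselect (G' x); [right; right|left].
apply: le_trans (le_lebesgue_outer sub) _.
rewrite (le_trans (outer_measureU2 _ _ _))//= -/(mu (F' `\` G')).
by have -> : lebesgue_outer ((~` F' `&` eball y (rho / 2)) `|` (G' `&` eball y (rho / 2))) = 0%E :=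
  lebesgue_nullU n1 n2; rewrite adde0.
Qed.

End support_points.

(** * Continuity points of monotone functions *)

Section monotone.
Context {R : realType}.
Implicit Types (q : R -> R) (t s e : R).

(** At a continuity point the one-sided limits agree, so that values shortly
    before and shortly after differ by little. *)
Lemma nondecreasing_gap q t e : {homo q : x y / x <= y} -> ~ discontinuity q t -> 0 < e ->
  exists2 eta, 0 < eta & forall s s', t - eta < s < t -> t < s' < t + eta -> q s' - q s < e.
Proof.
move=> qm qc e0; have e2 : 0 < e / 2 by rewrite divr_gt0.
have cl : cvg (q x @[x --> t^'-]).
  apply: nondecreasing_at_left_is_cvgr; apply: nearW => x; first by move=> a b _ _; exact: qm.
  by exists (q t) => z [y]; rewrite /= in_itv/= => /andP[_ yt] <-; apply: qm; exact: ltW.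
have cr : cvg (q x @[x --> t^'+]).
  apply: nondecreasing_at_right_is_cvgr; apply: nearW => x; first by move=> a b _ _; exact: qm.
  by exists (q t) => z [y]; rewrite /= in_itv/= => /andP[ty _] <-; apply: qm; exact: ltW.
have lE : lim (q x @[x --> t^'-]) = lim (q x @[x --> t^'+]).
  by apply/eqP; apply: contrapT => /negP ne; apply: qc.
set l := lim _ in lE.
have hl : \forall s \near t^'-, `|l - q s| < e / 2 by move/cvgrPdist_lt : cl => /(_ _ e2).
have hr : \forall s \near t^'+, `|l - q s| < e / 2.
  by move/cvgrPdist_lt : cr => /(_ _ e2); rewrite -lE.
move: hl hr => /nbhs_ballP[a /= a0 ha] /nbhs_ballP[b /= b0 hb].
exists (Num.min a b); first by rewrite lt_min a0.
move=> s s' /andP[s1 s2] /andP[s3 s4].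
have : `|l - q s| < e / 2.
  apply: ha => //; rewrite /ball/= gtr0_norm ?subr_gt0// ltrBlDr -ltrBlDl.
  by apply: le_lt_trans s1; rewrite lerD2l lerN2 ge_min lexx.
have : `|l - q s'| < e / 2.
  apply: hb => //; rewrite /ball/= distrC gtr0_norm ?subr_gt0// ltrBlDl.
  by apply: lt_le_trans s4 _; rewrite lerD2l ge_min lexx orbT.
by rewrite !ltr_norml => /andP[? ?] /andP[? ?]; lra.
Qed.

End monotone.

(** * Convergence of the perimeters *)

Lemma squeeze_dist {R : realType} (a b p q e : R) : a <= p -> p <= b -> a <= q -> q <= b ->
  - a - - b < e -> `|p - q| <= e.
Proof. by move=> ? ? ? ? ?; rewrite ler_norml; apply/andP; split; lra. Qed.

Lemma completed_integrable_cst {R : realType} (a b r : R) :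
  (@completed_lebesgue_measure R).-integrable `]a, b[%classic (EFin \o cst r).
Proof.
have mD : measurable (`]a, b[%classic : set (caratheodory_type (wlength (@idfun R))^*%mu)).
  by apply: completed_measurable; exact: measurable_itv.
apply/integrableP; split; first exact: (measurable_cst (r%:E)).
have -> : (\int[@completed_lebesgue_measure R]_(x in `]a, b[%classic) `|(EFin \o cst r) x| =
   `|r|%:E * completed_lebesgue_measure `]a, b[%classic)%E.
  exact: (integral_cst completed_lebesgue_measure mD `|r|%:E).
by rewrite (completed_itvoo a b) -EFinM ltry.
Qed.

Section limit.
Context {R : realType} {n : nat}.
Implicit Types (t s e : R).
Local Notation S := (caratheodory_type (wlength (@idfun R))^*%mu).
Local Notation leb := (@completed_lebesgue_measure R).
Local Notation T := (lebesgue_rV R n).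
Local Notation mu := (@lebesgue R n).

Hypothesis mu_neq0 : mu setT != 0%E.
Variables (E0 : set 'rV[R]_n) (delta : R) (h : nat -> R) (Ft : nat -> R -> set 'rV[R]_n).
Variables (tmax : R) (E : set 'rV[R]_(n + 1)).
Hypotheses (mE0 : measurable (E0 : set T)) (PE0 : (perimeter E0 < +oo)%E) (delta0 : 0 < delta).
Hypotheses (h0 : forall j, 0 < h j) (hcvg : h @ \oo --> 0).
Hypothesis flow : forall j, shrinking_flow E0 (h j) delta (Ft j).
Hypothesis mE : measurable (E : set (lebesgue_rV R (n + 1))).

Let D : set S := `]0, tmax[%classic.
Let err j (t : S) : \bar R := mu (Ft j t `+` time_slice E t).

Hypothesis merr : forall j, measurable_fun D (err j).
Hypothesis err_cvg : (\int[leb]_(t in D) err j t)%E @[j --> \oo] --> 0%E.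

Let mD : measurable D.
Proof. by apply: completed_measurable; exact: measurable_itv. Qed.

Let err0 j t : (0 <= err j t)%E. Proof. exact: lebesgue_outer_ge0. Qed.

Let int_err_small e : 0 < e -> exists N, forall j, (N <= j)%N -> (\int[leb]_(t in D) err j t < e%:E)%E.
Proof.
move=> e0; have nb : nbhs 0%E [set x : \bar R | (x < e%:E)%E].
  by apply: open_nbhs_nbhs; split; [exact: open_ereal_lt_ereal|rewrite /= lte_fin].
by have [N _ hN] := err_cvg nb; exists N => j Nj; exact: hN.
Qed.

Let mF j t : 0 <= t -> measurable (Ft j t : set T).
Proof. by have [m _ _ _ _] := flow j; exact: m. Qed.

(** Late approximations are ordered: after a delay [e], any of them is contained
    in any other one. Otherwise they would differ by a ball of fixed radius on a
    time interval of length [e / 3]. *)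
Lemma flows_ordered e : 0 < e -> exists J, forall i j s t, (J <= i)%N -> (J <= j)%N ->
  0 <= s -> s + e <= t -> t < tmax -> mu (Ft j t `\` Ft i s) = 0%E.
Proof.
move=> e0.
(* In the middle third of the delay, and for time steps below [e / 6], both
   nestings hold with the distance [delta * (e / 6)]. *)
pose rho := delta * (e / 6).
have rho0 : 0 < rho by rewrite mulr_gt0// divr_gt0.
pose B := eball (0 : 'rV[R]_n) (rho / 2).
have B0 : (0 < mu B)%E by apply: lebesgue_eball_gt0 => //; rewrite divr_gt0.
have Boo : (mu B < +oo)%E.
  by apply: (@lebesgue_bounded_lty _ _ _ (rho / 2)) => x; rewrite /B /eball/= subr0 => /ltW.
have Bfin : mu B \is a fin_num by rewrite ge0_fin_numE ?ltW.
pose b := fine (mu B); have bE : mu B = b%:E by rewrite fineK.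
have b0 : 0 < b by rewrite -lte_fin -bE.
have c0 : 0 < b * (e / 3) / 2 by rewrite !(mulr_gt0, divr_gt0).
have [N hN] := int_err_small c0.
have e60 : 0 < e / 6 by rewrite divr_gt0.
have [N' _ hN'] : \forall j \near \oo, `|0 - h j| < e / 6 by move/cvgrPdist_lt : hcvg => /(_ _ e60).
exists (maxn N N') => i j s t; rewrite !geq_max => /andP[iN iN'] /andP[jN jN'] s0 ste tT.
apply/eqP; apply: contraT => neq.
have hsmall k : (N' <= k)%N -> h k < e / 6.
  by move=> /hN' /=; rewrite sub0r normrN gtr0_norm.
have hi := hsmall i iN'; have hj := hsmall j jN'.
pose I : set S := `]s + e / 3, s + 2 * (e / 3)[%classic.
have mI : measurable I by apply: completed_measurable; exact: measurable_itv.
have ID : I `<=` D by move=> u; rewrite /I /D /= !in_itv/= => /andP[? ?]; apply/andP; split; lra.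
(* During that third the two approximations differ by a ball, while both are
   close to the limit set in the mean. *)
have low u : I u -> (b%:E <= err i u + err j u)%E.
  rewrite /I/= in_itv/= => /andP[u1 u2]; have u0 : 0 <= u by lra.
  have [_ nj _ _ _] := flow j; have [_ ni _ _ _] := flow i.
  have n1 : nested (Ft j t) (Ft j u) rho.
    have ujt : u + h j < t by lra.
    by apply: nested_le (nj u t u0 ujt); rewrite /rho ler_pM2l//; lra.
  have n2 : nested (Ft i u) (Ft i s) rho.
    have siu : s + h i < u by lra.
    by apply: nested_le (ni s u s0 siu); rewrite /rho ler_pM2l//; lra.
  have t0 : 0 <= t by lra.
  rewrite -bE.
  apply: le_trans (nested_difference_ball (mF j t0) (mF j u0) (mF i s0) (mF i u0) rho0 n1 n2 neq) _.
  rewrite /err (le_trans _ (outer_measureU2 _ _ _))//=.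
  apply: le_lebesgue_outer => x [Fj Fi].
  by have [Ex|Ex] := pselect (time_slice E u x); [left; right|right; left].
have ltI : leb I = (e / 3)%:E.
  rewrite (completed_itvoo (s + e / 3) (s + 2 * (e / 3))) (max_idPr _); last by lra.
  by congr (_%:E); lra.
have : (\int[leb]_(u in I) b%:E <= \int[leb]_(u in I) (err i u + err j u))%E.
  apply: (ge0_le_integral leb mI) low.
  - by move=> u _; rewrite lee_fin ltW.
  - exact: measurable_cst.
  - by apply: emeasurable_funD; apply: measurable_funS (merr _).
have -> : (\int[leb]_(u in I) b%:E)%E = (b * (e / 3))%:E.
  by rewrite EFinM -ltI; exact: (integral_cst leb mI b%:E).
have mi k : measurable_fun I (err k) by apply: measurable_funS (merr k).
rewrite (ge0_integralD leb mI (fun u _ => err0 i u) (mi i) (fun u _ => err0 j u) (mi j)).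
have sub k : (\int[leb]_(u in I) err k u <= \int[leb]_(u in D) err k u)%E.
  exact: (ge0_subset_integral leb mI mD (merr k) (fun u _ => err0 k u) ID).
move=> le; have small k : (N <= k)%N -> (\int[leb]_(u in I) err k u < (b * (e / 3) / 2)%:E)%E.
  by move=> Nk; exact: le_lt_trans (sub k) (hN k Nk).
have := le_lt_trans le (lteD (small i iN) (small j jN)).
by rewrite -EFinD lte_fin -splitr ltxx.
Qed.

(** The times at which the slice can be compared with the approximations: some
    subsequence, which may depend on the time, converges to it in measure. *)
Definition good_time t := measurable (time_slice E t : set T) /\
  forall e J, 0 < e -> exists2 j, (J <= j)%N & (err j t < e%:E)%E.

(** Each tail infimum of the errors lies below errors of arbitrarily small
    integral, hence vanishes almost everywhere. *)
Lemma good_time_ae : {ae leb, forall t, D t -> good_time t}.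
Proof.
have null J : {ae leb, forall t, D t -> einfs (err^~ t) J = 0%E}.
  have mi : measurable_fun D (fun t => einfs (err^~ t) J) by exact: (measurable_fun_einfs merr).
  have ile j t : (J <= j)%N -> (einfs (err^~ t) J <= err j t)%E.
    by move=> Jj; apply: ereal_inf_lbound; exists j.
  have i0 t : (0 <= einfs (err^~ t) J)%E by apply: le_ereal_inf_tmp => _ [m _ <-]; exact: err0.
  apply: (ae_eq_integral_abs leb mD mi).1.
  have -> : (\int[leb]_(t in D) `|einfs (err^~ t) J| = \int[leb]_(t in D) einfs (err^~ t) J)%E.
    by apply: eq_integral => t _; rewrite gee0_abs.
  apply/eqP; rewrite eq_le integral_ge0 ?andbT//.
  apply/lee_addgt0Pr => e e0; rewrite add0e; have [N hN] := int_err_small e0.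
  apply: le_trans (ltW (hN (maxn N J) (leq_maxl _ _))).
  exact: (ge0_le_integral leb mD (fun t _ => i0 t) mi (merr _) (fun t _ => ile _ t (leq_maxr _ _))).
have aeI := ae_filter_ringOfSetsType leb.
apply: (@filterS2 _ _ aeI _ _ _ _ (ae_foralln null) (slice_measurable mE)) => t t0 mt Dt; split => //.
move=> e J e0; have /ereal_inf_lt[_ [j /= Jj <-] je] : (einfs (err^~ t) J < e%:E)%E.
  by rewrite t0// lte_fin.
by exists j.
Qed.

Lemma good_time_exists a b : 0 <= a -> a < b -> b <= tmax ->
  exists2 t, a < t < b & good_time t.
Proof.
move=> a0 ab bT; apply: contrapT => hne.
have aeI := ae_filter_ringOfSetsType leb.
have [N [mN N0 hN]] := good_time_ae.
have sub : `]a, b[%classic `<=` N.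
  move=> t tab; apply: hN => /= gt; apply: hne; exists t; first by move: tab; rewrite /= in_itv.
  by apply: gt; move: tab; rewrite /D/= !in_itv/= => /andP[? ?]; apply/andP; split; lra.
have : (leb `]a, b[%classic <= leb N)%E.
  by apply: le_measure; rewrite ?inE//; apply: completed_measurable; exact: measurable_itv.
by rewrite N0 (completed_itvoo a b) lee_fin leNgt lt_max subr_gt0 ab orbT.
Qed.

Let pF_le j t (G : set 'rV[R]_n) : 0 <= t -> measurable (G : set T) -> mu (Ft j t `\` G) = 0%E ->
  mu (G `\` E0) = 0%E -> (perimeter (Ft j t) <= perimeter G)%E.
Proof. by have [_ _ _ _ h5] := flow j; exact: h5. Qed.

Let null_small (A : set 'rV[R]_n) : (forall e, 0 < e -> (mu A <= e%:E)%E) -> mu A = 0%E.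
Proof.
move=> hA; apply/eqP; rewrite eq_le lebesgue_outer_ge0 andbT.
by apply/lee_addgt0Pr => e e0; rewrite add0e; exact: hA.
Qed.

Let slice_sub_E0 t : D t -> good_time t -> mu (time_slice E t `\` E0) = 0%E.
Proof.
rewrite /D/= in_itv/= => /andP[t0 _] [_ gt]; apply: null_small => e e0.
have [j _ je] := gt e 0%N e0; apply: le_trans (ltW je).
have [_ _ _ h4 _] := flow j; have F0 := h4 t (ltW t0).
have sub : time_slice E t `\` E0 `<=` (Ft j t `+` time_slice E t) `|` (Ft j t `\` E0).
  move=> x [Ex E0x]; have [Fx|Fx] := pselect (Ft j t x); first by right.
  by left; right.
apply: le_trans (le_lebesgue_outer sub) _.
by rewrite (le_trans (outer_measureU2 _ _ _))//= -/(mu (Ft j t `\` E0)) F0 adde0.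
Qed.

(** After a delay, the perimeters of late approximations and of the limit compare:
    the approximations minimize the perimeter outward, and the perimeter is lower
    semicontinuous. *)
Lemma perimeter_delay e : 0 < e -> exists J, forall j s t, (J <= j)%N -> 0 < s -> s + e <= t -> t < tmax ->
  (good_time s -> (perimeter (Ft j t) <= perimeter (time_slice E s))%E) /\
  (good_time t -> (perimeter (time_slice E t) <= perimeter (Ft j s))%E).
Proof.
move=> e0; have [J hJ] := flows_ordered e0; exists J => j s t Jj s0 ste tT.
have t0 : 0 < t by lra.
split=> [gs|gt].
- have Ds : D s by rewrite /D/= in_itv/= s0; lra.
  apply: pF_le => //; [exact: ltW|exact: gs.1| |exact: slice_sub_E0].
  apply: null_small => d d0; have [i Ji id] := gs.2 d J d0; apply: le_trans (ltW id).
  have F0 := hJ i j s t Ji Jj (ltW s0) ste tT.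
  have sub : Ft j t `\` time_slice E s `<=` (Ft i s `+` time_slice E s) `|` (Ft j t `\` Ft i s).
    move=> x [Fx Ex]; have [Fi|Fi] := pselect (Ft i s x); last by right.
    by left; left.
  apply: le_trans (le_lebesgue_outer sub) _.
  by rewrite (le_trans (outer_measureU2 _ _ _))//= -/(mu (Ft j t `\` Ft i s)) F0 adde0.
- apply: (perimeter_lsc gt.1) => d d0; have [i Ji id] := gt.2 d J d0.
  exists (Ft i t); split; [exact: mF (ltW t0)|exact: ltW|].
  have [_ _ _ h4 _] := flow j.
  apply: pF_le; [exact: ltW|exact: mF (ltW s0)| |exact: h4 (ltW s0)].
  exact: (hJ j i s t Jj Ji (ltW s0) ste tT).
Qed.

Let P0 : R := fine (perimeter E0).
Let P0E : perimeter E0 = P0%:E.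
Proof. by rewrite fineK; [|exact: perimeter_fin_num]. Qed.

Let pF_E0 j t : 0 <= t -> (perimeter (Ft j t) <= P0%:E)%E.
Proof.
move=> t0; rewrite -P0E; have [_ _ _ h4 _] := flow j.
apply: pF_le => //; first exact: h4.
by rewrite setDv; exact: lebesgue_outer0.
Qed.

Let pE_E0 t : D t -> good_time t -> (perimeter (time_slice E t) <= P0%:E)%E.
Proof.
rewrite /D/= in_itv/= => /andP[t0 _] gt; apply: (perimeter_lsc gt.1) => d d0.
have [i _ id] := gt.2 d 0%N d0.
by exists (Ft i t); split; [exact: mF (ltW t0)|exact: ltW|exact: pF_E0 (ltW t0)].
Qed.

Let pF j t : R := fine (perimeter (Ft j t)).
Let pFE j t : 0 <= t -> perimeter (Ft j t) = (pF j t)%:E.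
Proof.
by move=> t0; rewrite fineK//; apply: perimeter_fin_num; rewrite (le_lt_trans (pF_E0 j t0))// ltry.
Qed.
Let pE t : R := fine (perimeter (time_slice E t)).
Let pEE t : D t -> good_time t -> perimeter (time_slice E t) = (pE t)%:E.
Proof.
by move=> Dt gt; rewrite fineK//; apply: perimeter_fin_num; rewrite (le_lt_trans (pE_E0 Dt gt))// ltry.
Qed.
Let pE0 t : 0 <= pE t. Proof. by apply: fine_ge0; exact: perimeter_ge0. Qed.

Let pE_antitone s t : D s -> D t -> good_time s -> good_time t -> s <= t -> pE t <= pE s.
Proof.
move=> Ds Dt gs gt; rewrite le_eqVlt => /predU1P[->//|st].
have e0 : 0 < (t - s) / 2 by rewrite divr_gt0// subr_gt0.
have [J hJ] := perimeter_delay e0.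
have := Ds; have := Dt; rewrite /D/= !in_itv/= => /andP[t0 tT] /andP[s0 sT].
have u1 : s + (t - s) / 2 <= (s + t) / 2 by lra.
have u2 : (s + t) / 2 + (t - s) / 2 <= t by lra.
have u3 : 0 < (s + t) / 2 by lra.
have u4 : (s + t) / 2 < tmax by lra.
have /(_ gs) h1 := (hJ J s ((s + t) / 2) (leqnn _) s0 u1 u4).1.
have /(_ gt) h2 := (hJ J ((s + t) / 2) t (leqnn _) u3 u2 tT).2.
by rewrite -lee_fin -(pEE Ds gs) -(pEE Dt gt) (le_trans h2).
Qed.

(** A monotone function of time that agrees with the perimeter of the limit at the
    good times. The value 0 keeps the supremum over a nonempty set. *)
Let pset t : set R := [set 0] `|` [set pE s | s in [set s | [/\ D s, good_time s & t <= s]]].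
Let phat t : R := sup (pset t).

Let pset_has_sup t : has_sup (pset t).
Proof.
split; first by exists 0; left.
exists P0 => _ [->|[s [Ds gs _] <-]]; first by apply: fine_ge0; exact: perimeter_ge0.
by rewrite -lee_fin -(pEE Ds gs); exact: pE_E0.
Qed.

Let phat_antitone s t : s <= t -> phat t <= phat s.
Proof.
move=> st; apply: ge_sup; first exact: (pset_has_sup t).1.
move=> _ [->|[u [Du gu tu] <-]]; apply: ub_le_sup; try exact: (pset_has_sup s).2; first by left.
by right; exists u => //; split => //; exact: le_trans tu.
Qed.

Let phat_good t : D t -> good_time t -> phat t = pE t.
Proof.
move=> Dt gt; apply/eqP; rewrite eq_le; apply/andP; split.
  apply: ge_sup; first exact: (pset_has_sup t).1.
  move=> _ [->|[u [Du gu tu] <-]]; [exact: pE0|exact: pE_antitone].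
by apply: ub_le_sup; [exact: (pset_has_sup t).2|right; exists t].
Qed.

(** At a continuity time the perimeter of the approximation is squeezed
    between the perimeters of the limit at good times shortly before and
    shortly after. *)
Let pF_cvg t : D t -> ~ discontinuity (fun s => - phat s) t -> good_time t ->
  (perimeter (Ft j t))%E @[j --> \oo] --> perimeter (time_slice E t).
Proof.
move=> Dt ct gt; have := Dt; rewrite /D/= in_itv/= => /andP[t0 tT].
rewrite (pEE Dt gt); have -> : (fun j => perimeter (Ft j t)) = EFin \o (fun j => pF j t).
  by apply/funext => j /=; rewrite pFE// ltW.
apply: cvg_EFin; first exact: nearW.
apply/cvgrPdist_le => e e0.
have qm : {homo (fun s => - phat s) : x y / x <= y} by move=> x y xy; rewrite lerN2 phat_antitone.
have [eta eta0 gap] := nondecreasing_gap qm ct e0.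
have [s /andP[s1 s2] gs] : exists2 s, Num.max 0 (t - eta) < s < t & good_time s.
  apply: good_time_exists; [by rewrite le_max lexx|by rewrite gt_max t0 ltrBlDr ltrDl|exact: ltW].
have [s' /andP[s3 s4] gs'] : exists2 s, t < s < Num.min tmax (t + eta) & good_time s.
  by apply: good_time_exists; [exact: ltW|rewrite lt_min tT ltrDl|rewrite ge_min lexx].
move: s1 s4; rewrite gt_max lt_min => /andP[s0 s1] /andP[s'T s4].
have Ds : D s by rewrite /D/= in_itv/= s0; lra.
have Ds' : D s' by rewrite /D/= in_itv/= s'T andbT; lra.
have := gap s s'; rewrite s1 s2 s3 s4 => /(_ isT isT) g.
have d0 : 0 < Num.min (t - s) (s' - t) by rewrite lt_min !subr_gt0 s2.
have [J hJ] := perimeter_delay d0.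
exists J => // j /= Jj.
have d1 : s + Num.min (t - s) (s' - t) <= t by rewrite -lerBrDl ge_min lexx.
have d2 : t + Num.min (t - s) (s' - t) <= s' by rewrite -lerBrDl ge_min lexx orbT.
have /(_ gs) := (hJ j s t Jj s0 d1 tT).1.
have /(_ gs') := (hJ j t s' Jj t0 d2 s'T).2.
rewrite (pEE Ds gs) (pEE Ds' gs') (pFE j (ltW t0)) !lee_fin.
have := pE_antitone Ds Dt gs gt (ltW s2); have := pE_antitone Dt Ds' gt gs' (ltW s3).
move: g; rewrite (phat_good Ds gs) (phat_good Ds' gs') => g h1 h2 h3 h4.
exact: (squeeze_dist h1 h2 h3 h4 g).
Qed.

(** Dominated convergence: the perimeter of the initial set bounds all
    perimeters, and a monotone function has countably many discontinuities. *)
Lemma perimeter_integral_cvg :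
  (\int[leb]_(t in D) perimeter (Ft j t))%E @[j --> \oo] -->
  (\int[leb]_(t in D) perimeter (time_slice E t))%E.
Proof.
have aeI := ae_filter_ringOfSetsType leb.
have mDR : measurable (`]0, tmax[%classic : set R) by exact: measurable_itv.
have mp j : measurable_fun D (fun t => perimeter (Ft j t)).
  pose q t := pF j (Num.max 0 t).
  have mq : measurable_fun (`]0, tmax[%classic : set R) q.
    apply: nonincreasing_measurable => // s t st.
    have m0 (u : R) : 0 <= Num.max 0 u by rewrite le_max lexx.
    have mm : Num.max 0 s <= Num.max 0 t.
      by rewrite ge_max le_max lexx/= le_max st orbT.
    have [_ _ h3 h4 _] := flow j.
    rewrite -lee_fin -!pFE//; apply: pF_le => //; [exact: mF|exact: h3|exact: h4].
  have := completed_measurable_fun mDR mq => /measurable_EFinP; apply: eq_measurable_fun => t.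
  rewrite inE /D/= in_itv/= => /andP[t0 _].
  by rewrite /= /q (max_idPr (ltW t0)) pFE// ltW.
have ml : measurable_fun D (fun t => perimeter (time_slice E t)).
  have mph : measurable_fun D (fun t : S => (phat t)%:E).
    apply/measurable_EFinP; apply: (completed_measurable_fun mDR).
    by apply: nonincreasing_measurable => // s t; exact: phat_antitone.
  apply: (ae_measurable_fun completed_lebesgue_measure_is_complete _ mph).
  apply: (@filterS _ _ aeI _ _ _ good_time_ae) => t gt Dt.
  by rewrite (pEE Dt (gt Dt)) phat_good//; exact: gt.
have fcvg : {ae leb, forall t, D t -> (perimeter (Ft j t))%E @[j --> \oo] --> perimeter (time_slice E t)}.
  have cdisc : countable [set x | x \in (`]0%R, tmax[) /\ discontinuity (fun s => - phat s) x].
    by apply: discontinuity_countable => s t _ _ st; rewrite lerN2 phat_antitone.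
  have disc0 : leb [set x | x \in (`]0%R, tmax[) /\ discontinuity (fun s => - phat s) x] = 0%E.
    exact: countable_lebesgue_measure0 cdisc.
  have aed : {ae leb, forall t, ~ (t \in (`]0%R, tmax[) /\ discontinuity (fun s => - phat s) t)}.
    exists [set x | x \in (`]0%R, tmax[) /\ discontinuity (fun s => - phat s) x]; split => //.
      by apply: completed_measurable; exact: countable_measurable.
    by move=> t /contrapT.
  apply: (@filterS2 _ _ aeI _ _ _ _ aed good_time_ae) => t nd gt Dt.
  by apply: pF_cvg => //; [move=> dt; apply: nd; split|exact: gt].
have icst : leb.-integrable D (EFin \o cst P0) by exact: completed_integrable_cst.
have fb : {ae leb, forall t j, D t -> (`|perimeter (Ft j t)| <= (EFin \o cst P0) t)%E}.
  apply: (@nearW _ _ _ aeI) => t j; rewrite /D/= in_itv/= => /andP[t0 _].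
  by rewrite gee0_abs ?perimeter_ge0// pF_E0// ltW.
by have [_ _] := dominated_convergence mD mp ml fcvg icst fb.
Qed.

End limit.

(** * Measurability of the approximation error *)

Section approximations.
Context {R : realType} {n : nat}.
Local Notation S := (caratheodory_type (wlength (@idfun R))^*%mu).
Local Notation leb := (@completed_lebesgue_measure R).
Local Notation T := (lebesgue_rV R n).
Local Notation mu := (@lebesgue R n).

Lemma atw_measurable (h : R) E0 (F : R -> set 'rV[R]_n) : 0 < h -> measurable (E0 : set T) ->
  atw_approximation h E0 F -> forall t, 0 <= t -> measurable (F t : set T).
Proof.
move=> h0 mE0 [Ek [Ek0 step hF]] t t0; have [k kt] := floor_step h0 t0; rewrite (hF k t kt).
by case: k {kt} => [|k]; [rewrite Ek0|have [] := step k].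
Qed.

Lemma atw_error_measurable (h tmax : R) E0 (F : R -> set 'rV[R]_n) (E : set 'rV[R]_(n + 1)) :
  0 < h -> measurable (E0 : set T) -> atw_approximation h E0 F ->
  measurable (E : set (lebesgue_rV R (n + 1))) ->
  measurable_fun (`]0, tmax[%classic : set S) (fun t : S => mu (F t `+` time_slice E t)).
Proof.
move=> h0 mE0 aF mE; have mF := atw_measurable h0 mE0 aF.
have [Ek [Ek0 step hF]] := aF.
pose I (k : nat) : set S := `[k%:R * h, k.+1%:R * h[%classic.
have mI k : measurable (I k) by apply: completed_measurable; exact: measurable_itv.
have mU : measurable (\bigcup_k I k) by exact: bigcup_measurable.
have sub : `]0, tmax[%classic `<=` \bigcup_k I k.
  move=> t; rewrite /= in_itv/= => /andP[t0 _]; have [k kt] := floor_step h0 (ltW t0).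
  by exists k => //; rewrite /I/= in_itv.
apply: (measurable_funS mU sub); apply/(measurable_fun_bigcup _ mI) => k.
have mk : measurable (Ek k : set T) by case: k => [|k]; [rewrite Ek0|have [] := step k].
have : measurable_fun (I k) (fun t : S => mu (Ek k `+` time_slice E t)).
  by apply: measurable_funTS; exact: slice_setY_measurable.
apply: eq_measurable_fun => t; rewrite inE /I/= in_itv/= => kt.
by rewrite (hF k t kt).
Qed.

Lemma integral_slice_null (E : set 'rV[R]_(n + 1)) (D : set S) : mu setT = 0%E ->
  measurable D -> measurable (E : set (lebesgue_rV R (n + 1))) ->
  (\int[leb]_(t in D) perimeter (time_slice E t) = 0)%E.
Proof.
move=> mu0 mD mE; have sl0 : {ae leb, forall t, D t -> perimeter (time_slice E t) = cst 0%E t}.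
  apply: (@filterS _ _ (ae_filter_ringOfSetsType leb) _ _ _ (slice_measurable mE)) => t mt _.
  by rewrite (perimeter_null mu0 mt).
have mf : measurable_fun D (fun t => perimeter (time_slice E t)).
  apply: (ae_measurable_fun completed_lebesgue_measure_is_complete _ (measurable_cst 0%E)).
  apply: (@filterS _ _ (ae_filter_ringOfSetsType leb) _ _ _ sl0) => t h Dt.
  by rewrite h.
rewrite (ae_eq_integral (cst 0%E) _ mD mf (measurable_cst 0%E) sl0).
exact: integral0.
Qed.

End approximations.

Theorem theorem1p4 (R : realType) (n : nat) (hn : (n <= 7)%N)
  (E0 : set 'rV[R]_n)
  (E0_compact : compact E0)
  (E0_C2 : C2_boundary E0)
  (E0_mean_convex : forall x, boundary E0 x -> 0 < mean_curvature E0 x)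
  (Eh : R -> R -> set 'rV[R]_n)
  (Eh_atw : forall h : R, 0 < h -> atw_approximation h E0 (Eh h))
  (T : R) (T_gt0 : 0 < T)
  (h : nat -> R)
  (h_gt0 : forall j, 0 < h j)
  (h_decr : nonincreasing_seq h)
  (h_cvg0 : h @ \oo --> 0)
  (E : set 'rV[R]_(n + 1))
  (E_meas : lebesgue_measurable E)
  (Eh_cvg :
     (fun j : nat =>
        \int[completed_lebesgue_measure (R := R)]_(t in `]0%R, T[%classic)
          lebesgue (Eh (h j) t `+` time_slice E t))%E @ \oo --> 0%E) :
  (fun j : nat =>
     \int[completed_lebesgue_measure (R := R)]_(t in `]0%R, T[%classic)
       perimeter (Eh (h j) t))%E @ \oo -->
  (\int[completed_lebesgue_measure (R := R)]_(t in `]0%R, T[%classic)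
     perimeter (time_slice E t))%E.
Proof.
have mE0 : measurable (E0 : set (lebesgue_rV R n)).
  by apply: lebesgue_measurable_closed; exact: compact_closed E0_compact.
(* If the whole space is null, both sides are integrals of vanishing functions. *)
have [mu0|mu_neq0] := eqVneq (lebesgue (setT : set (lebesgue_rV R n))) 0%E.
  have intF0 j : (\int[completed_lebesgue_measure (R := R)]_(t in `]0%R, T[%classic)
      perimeter (Eh (h j) t) = 0)%E.
    apply: integral0_eq => t; rewrite /= in_itv/= => /andP[t0 _]; apply: perimeter_null => //.
    exact: atw_measurable (h_gt0 j) mE0 (Eh_atw _ (h_gt0 j)) t (ltW t0).
  have intE0 : (\int[completed_lebesgue_measure (R := R)]_(t in `]0%R, T[%classic)
      perimeter (time_slice E t) = 0)%E.
    apply: (integral_slice_null mu0 _ E_meas).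
    by apply: completed_measurable; exact: measurable_itv.
  rewrite intE0 (_ : (fun j => _) = cst 0%E); first exact: cvg_cst.
  by apply/funext => j; exact: intF0.
have [PE0 [delta [h0 [delta0 h00 flow]]]] := atw_shrinking_flow mu_neq0 E0_compact E0_C2 E0_mean_convex.
have [N _ hN] : \forall j \near \oo, `|0 - h j| < h0 by move/cvgrPdist_lt : h_cvg0 => /(_ _ h00).
have hlt j : h (j + N)%N < h0.
  by have := hN (j + N)%N (leq_addl _ _); rewrite /= sub0r normrN gtr0_norm.
(* The speed of shrinking is known for small time steps only, hence the shift of the
   sequence. *)
pose hs j := h (j + N)%N.
have hs_cvg : hs @ \oo --> 0 by rewrite (cvg_shiftn N h).
have hs_flow j : shrinking_flow E0 (hs j) delta (Eh (hs j)).
  exact: flow (h_gt0 _) (hlt j) (Eh_atw _ (h_gt0 _)).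
have hs_err j := atw_error_measurable (tmax := T) (h_gt0 (j + N)%N) mE0 (Eh_atw _ (h_gt0 _)) E_meas.
pose err j : \bar R := (\int[completed_lebesgue_measure (R := R)]_(t in `]0%R, T[%classic)
  lebesgue (Eh (h j) t `+` time_slice E t))%E.
have hs_err_cvg : err (j + N)%N @[j --> \oo] --> 0%E by rewrite (cvg_shiftn N err).
pose P j : \bar R := (\int[completed_lebesgue_measure (R := R)]_(t in `]0%R, T[%classic)
  perimeter (Eh (h j) t))%E.
rewrite -(cvg_shiftn N P).
exact: (@perimeter_integral_cvg R n mu_neq0 E0 delta hs (fun j => Eh (hs j)) T E mE0 PE0 delta0
  (fun j => h_gt0 _) hs_cvg hs_flow E_meas hs_err hs_err_cvg).
Qed.
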